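(* Suppose that $q\in\{4,8\}$, and let $n,k$ be integers with $1\leq k\leq n-1$. The minimum weight of $\mathcal{C}_k(n,q)^\perp$ is $q^{n-k-1}(q+2)$, and the minimum weight codewords of $\mathcal{C}_k(n,q)^\perp$ are exactly the characteristic vectors of the hypercylinders embedded in an $(n-k+1)$-dimensional subspace of $\mathrm{PG}(n,q)$. Put $\delta(4)=168$ and $\delta(8)=32704$. The number of minimum weight codewords of $\mathcal{C}_k(n,q)^\perp$ is $$\genfrac{[}{]}{0pt}{}{n+1}{k-1}_q\,\genfrac{[}{]}{0pt}{}{n-k+2}{3}_q\,\delta(q),$$ and all minimum weight codewords are equivalent under the action of the automorphism group of the code $\mathcal{C}_k(n,q)^\perp$.
   Context: $\mathrm{PG}(n,q)$ is the $n$-dimensional projective space over $\mathbb{F}_q$, with point set $\mathcal{P}$; all dimensions are projective, and a subspace of dimension $-1$ is empty. For $q$ a power of $2$, $\mathcal{C}_k(n,q)$ is the $\mathbb{F}_2$-subspace of the space $\mathbb{F}_2^{\mathcal{P}}$ of functions $\mathcal{P}\to\mathbb{F}_2$ spanned by the characteristic functions of the $k$-dimensional subspaces, and $\mathcal{C}_k(n,q)^\perp$ is its orthogonal complement under the standard scalar product $v\cdot w=\sum_{P\in\mathcal{P}}v(P)w(P)$. The weight of a codeword is the number of points where it is non-zero; the minimum weight of a code is the least weight of its non-zero codewords, and a minimum weight codeword is a non-zero codeword attaining it. The automorphism group of the code is the group of permutations of $\mathcal{P}$ preserving the code. A hyperoval in a plane $\mathrm{PG}(2,q)$, $q$ even,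 is a set of $q+2$ points meeting every line in $0$ or $2$ points. A hypercylinder in an $m$-dimensional projective space ($m\geq 2$) over $\mathbb{F}_q$ is a set of the form $\left(\bigcup_{P\in\mathcal{O}}\langle P,\tau\rangle\right)\setminus\tau$, where $\pi$ and $\tau$ are disjoint subspaces of dimensions $2$ and $m-3$ respectively and $\mathcal{O}$ is a hyperoval in $\pi$. A hypercylinder embedded in an $(n-k+1)$-dimensional subspace $\Sigma$ of $\mathrm{PG}(n,q)$ is a hypercylinder of $\Sigma$ (so $m=n-k+1$), viewed as a set of points of $\mathrm{PG}(n,q)$. The Gaussian coefficient is $\genfrac{[}{]}{0pt}{}{a}{b}_q=\prod_{i=0}^{b-1}\frac{q^{a-i}-1}{q^{b-i}-1}$ (equal to $1$ if $b=0$). *)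

(* Defs.v *)
From HB Require Import structures.
From mathcomp Require Import all_boot all_order all_fingroup all_algebra.

Set Implicit Arguments.
Unset Strict Implicit.
Unset Printing Implicit Defensive.

Import GRing.Theory VectorInternalTheory.
Local Open Scope ring_scope.

Section FiniteSubspaces.
Variables (F : finFieldType) (vT : vectType F).
HB.instance Definition _ := [Countable of {vspace vT} by <:].
HB.instance Definition _ := [Finite of {vspace vT} by <:].
End FiniteSubspaces.

(* A projective subspace of PG(n, F) is a linear subspace of F^(n+1). *)
Notation subspace F n := {vspace 'rV[F]_n.+1}.

(* Integer-valued, so that the empty subspace 0%VS has dimension -1. *)
Definition pdim (F : finFieldType) (n : nat) (U : subspace F n) : int :=
  (\dim U)%:Z - 1.

Notation point F n := {U : subspace F n | pdim U == 0}.

(* The regular module ('F_2)^o is what makes words an 'F_2-vector space. *)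
Notation word F n := {ffun point F n -> ('F_2)^o}.

Section ProjectiveSpace.
Variables (F : finFieldType) (n : nat).
Local Notation subspace := (subspace F n).
Local Notation point := (point F n).
Local Notation word := (word F n).

Definition points (U : subspace) : {set point} :=
  [set P : point | (val P <= U)%VS].

Definition hyperoval (pi : subspace) (O : {set point}) : Prop :=
  [/\ pdim pi = 2,
      O \subset points pi,
      #|O| = (#|F| + 2)%N
    & forall L : subspace, pdim L = 1 -> (L <= pi)%VS ->
        #|O :&: points L| = 0%N \/ #|O :&: points L| = 2%N].

Definition hypercylinder (Sigma : subspace) (S : {set point}) : Prop :=
  pdim Sigma >= 2 /\
  exists (pi tau : subspace) (O : {set point}),
    [/\ (pi <= Sigma)%VS /\ pdim pi = 2,
        (tau <= Sigma)%VS /\ pdim tau = pdim Sigma - 3,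
        points pi :&: points tau = set0,
        hyperoval pi O
      & S = (\bigcup_(P in O) points (val P + tau)%VS) :\: points tau].

Definition charvec (S : {set point}) : word := [ffun P => (P \in S)%:R].

Definition code (k : nat) : {vspace word} :=
  <<[seq charvec (points U) | U : subspace in
       [pred U | pdim U == k%:Z]]>>%VS.

Definition dotprod (v w : word) : 'F_2 := \sum_(P : point) (v P : 'F_2) * w P.

Definition dual_code (k : nat) : {set word} :=
  [set v | [forall w : word, (w \in code k) ==> (dotprod v w == 0)]].

Definition weight (v : word) : nat := #|[set P | v P != 0]|.

Definition is_min_weight (C : {set word}) (d : nat) : Prop :=
  (exists2 c, c \in C & c != 0 /\ weight c = d) /\
  (forall c, c \in C -> c != 0 -> (d <= weight c)%N).

Definition min_codewords (C : {set word}) : {set word} :=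
  [set c in C | (c != 0) &&
     [forall c' in C, (c' != 0) ==> (weight c <= weight c')%N]].

(* Coordinate P of v becomes coordinate s P of the permuted word. *)
Definition permute (s : {perm point}) (v : word) : word :=
  [ffun P => v ((s^-1)%g P)].

Definition code_aut (C : {set word}) : {set {perm point}} :=
  [set s | permute s @: C == C].

Lemma code_aut_group_set (C : {set word}) : group_set (code_aut C).
Proof.
apply/group_setP; split=> [|s t].
  rewrite inE; apply/eqP/setP=> v.
  have p1 : permute 1%g =1 id.
    by move=> w; apply/ffunP=> P; rewrite ffunE invg1 perm1.
  by rewrite (eq_imset _ p1) imset_id.
rewrite !inE => /eqP sC /eqP tC.
have pM : permute (s * t)%g =1 permute t \o permute s.
  by move=> w; apply/ffunP=> P; rewrite !ffunE invMg permM.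
by rewrite (eq_imset _ pM) imset_comp sC tC.
Qed.

Canonical code_aut_group (C : {set word}) := Group (code_aut_group_set C).

End ProjectiveSpace.

Definition gauss_coef (q a b : nat) : rat :=
  \prod_(i < b) ((q%:R ^+ (a - i) - 1) / (q%:R ^+ (b - i) - 1)).

Definition delta (q : nat) : nat :=
  match q with 4 => 168 | 8 => 32704 | _ => 0 end.

(* Main.v *)
From HB Require Import structures.
Require Import Defs.
From mathcomp Require Import all_boot all_order all_fingroup all_algebra.
From mathcomp Require Import zify ring.
From mathcomp Require finfield.

Set Implicit Arguments.
Unset Strict Implicit.
Unset Printing Implicit Defensive.

Import GRing.Theory.
Local Open Scope ring_scope.

(* A word is a point set S, and it is dual to C_k when S meets every k-space in an
   even number of points. For k = 1 let w be the weight of a nonempty S in PG(r+2,q).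
   The lines through one point give w >= q+2 in a plane. In higher dimension there is,
   if w is small, a hyperplane H missing S; S is then an affine set A, and counting
   the pairs of points of A in each direction shows that in some direction no parallel
   hyperplane misses A, whence a factor q and w >= (q+2)q^r. In the case of equality
   some hyperplane section is again minimum. The radical of S consists of the vectors
   whose translations preserve S. That a minimum set has a radical of dimension r, and
   so is a hypercylinder, reduces by induction to the existence of a nonzero radical
   vector in PG(3,q). A line with q points has its remaining point in the radical, so
   one must find such a line: for q = 4 the points on the lines through one point
   suffice for this; for q = 8, 6-secants are excluded in the planes through them, and
   if all lines had 0, 2 or 4 points, the planes would have 0, 10, 12 or 16 points, with
   exactly five of the last kind, which is contradictory.
   For k > 1, projecting modulo a point off S that lies on a tangent, and keeping the
   points with an odd fibre, lowers k and does not increase the weight. If S is minimum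
   no such point lies on a secant, which forces S into a hyperplane.
   A hyperoval through the standard frame is given by the values of a function on F; for
   q = 4, 8 these functions are enumerated, there are 1 and 10 of them, and they are
   projectively equivalent. The number of minimum words follows by counting the
   pairs of a minimum set and a frame adapted to it. *)

(** * Counting points in subspaces *)

(** All counting is done with vectors: a point set is replaced by the set of its nonzero
    representatives, so that projections, translations and changes of coordinates become linear
    algebra, and a common factor q - 1 is cancelled afterwards. The lower bound and its case of
    equality come from one induction, since the factor q stems from the q members other than H of a
    pencil of hyperplanes: each of them meets S and obeys the bound one dimension lower. The
    obstacle is the passage from solids to higher dimensions, where radical vectors of hyperplane
    sections must be shown to be radical vectors of S. In PG(4,q) the minimum sections of
    codimension 2 are hyperovals, which have zero radical for q > 2, so the radicals of different
    solids have nothing visible in common; this dimension gets an argument of its own with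
    q-secants. From PG(5,q) on, a minimum section of codimension 2 has a nonzero radical, which lies
    in the radical of every hyperplane section through it and is therefore radical for S. *)

Lemma sum_ge_const (I : finType) (P : pred I) (g : I -> nat) b :
  (forall i, P i -> b <= g i)%N -> (#|[pred i | P i]| * b <= \sum_(i | P i) g i)%N.
Proof. by move=> ge; rewrite -sum_nat_const; exact: leq_sum. Qed.

Lemma sum_eq_const (I : finType) (P : pred I) (g : I -> nat) b :
  (forall i, P i -> b <= g i)%N -> (\sum_(i | P i) g i <= #|[pred i | P i]| * b)%N ->
  forall i, P i -> g i = b.
Proof.
move=> ge le i Pi; apply/eqP; rewrite eqn_leq ge // andbT leqNgt; apply/negP => lt.
move: le; rewrite leqNgt -sum_nat_const => /negP; apply.
rewrite (bigD1 i) //= [X in (_ < X)%N](bigD1 i) //= -addSn; apply: leq_add => //.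
by apply: leq_sum => j /andP[Pj _]; exact: ge.
Qed.

Section Counting.
Variables (F : finFieldType) (N : nat).
Local Notation V := 'rV[F]_N.
Local Notation q := #|F|.
Implicit Types (S : {set V}) (U W L P : {vspace V}) (x y v : V).

Lemma q_gt1 : (1 < q)%N. Proof. exact: card_finNzRing_gt1. Qed.

Lemma card_vs U : #|U| = (q ^ \dim U)%N.
Proof.
pose f (r : 'rV[F]_(\dim U)) : V := \sum_i r 0 i *: (vbasis U)`_i.
have finj : injective f.
  move=> r s /eqP; rewrite -subr_eq0 -sumrB => /eqP h.
  have {}h : \sum_i (r 0 i - s 0 i) *: (vbasis U)`_i = 0.
    by rewrite -[RHS]h; apply: eq_bigr => i _; rewrite scalerBl.
  have /freeP/(_ _ h) fr := basis_free (vbasisP U).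
  by apply/rowP => i; apply/eqP; rewrite -subr_eq0 fr.
have -> : #|U| = #|[set f r | r : 'rV[F]_(\dim U)]|.
  apply: eq_card => x; apply/idP/imsetP => [xU|[r _ ->]].
    exists (\row_i coord (vbasis U) i x) => //.
    rewrite {1}(coord_vbasis xU); apply: eq_bigr => i _; by rewrite mxE.
  apply: rpred_sum => i _; apply: rpredZ; apply: vbasis_mem; apply: mem_nth.
  by rewrite size_tuple.
by rewrite card_imset // card_mx mul1n.
Qed.

Lemma dim_addline W x : x \notin W -> \dim (W + <[x]>) = (\dim W).+1.
Proof.
move=> xW; rewrite dimv_disjoint_sum ?dim_vline.
  have -> : x != 0 by apply: contraNneq xW => ->; exact: mem0v.
  by rewrite addn1.
apply/eqP; rewrite -subv0; apply/subvP => y; rewrite memv_cap memv0.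
case/andP=> yW /vlineP[a ya]; rewrite ya in yW *.
have [->|a0] := eqVneq a 0; first by rewrite scale0r.
by move: xW; rewrite -[x](scalerK a0) rpredZ.
Qed.

Lemma exists_notin W U : (\dim W < \dim U)%N -> exists2 x, x \in U & x \notin W.
Proof. by move=> lt; apply/subvPn; apply: contraL lt => /dimvS; rewrite -leqNgt. Qed.

(** The points of the quotient [U / W]. The vectors of [U] off [W] are partitioned by these
    subspaces, [x] lying in [W + <[x]>] only; all incidence counts rest on this. *)
Definition cover W U : pred {vspace V} :=
  [pred W' | [&& (W <= W')%VS, (W' <= U)%VS & \dim W' == (\dim W).+1]].

Lemma coverP W U W' :
  reflect [/\ (W <= W')%VS, (W' <= U)%VS & \dim W' = (\dim W).+1] (cover W U W').
Proof. by apply: (iffP and3P) => -[? ? /eqP]. Qed.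

Lemma cover_eq W U W' x : cover W U W' -> x \in W' -> x \notin W ->
  W' = (W + <[x]>)%VS.
Proof.
case/coverP=> WW' W'U dW' xW' xW; apply/esym/eqP.
by rewrite eqEdim subv_add WW' dim_addline // dW' -memvE xW' leqnn.
Qed.

Lemma cover_line W U x : (W <= U)%VS -> x \in U -> x \notin W ->
  cover W U (W + <[x]>)%VS.
Proof.
move=> WU xU xW; apply/coverP; rewrite addvSl subv_add WU -memvE xU.
by rewrite dim_addline.
Qed.

Lemma cover_sum W U (g : V -> nat) : (W <= U)%VS ->
  (\sum_(x | (x \in U) && (x \notin W)) g x =
   \sum_(W' | cover W U W') \sum_(x | (x \in W') && (x \notin W)) g x)%N.
Proof.
move=> WU.
rewrite (partition_big (fun x => (W + <[x]>)%VS) (cover W U)) /=; last first.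
  by move=> x /andP[xU xW]; exact: cover_line.
apply: eq_bigr => W' cW'; apply: eq_bigl => x.
have [_ W'U _] := coverP _ _ _ cW'.
apply/andP/andP => [[/andP[xU xW] /eqP <-]|[xW' xW]].
  by split=> //; rewrite memvE addvSr.
rewrite (subvP W'U) //; split=> //.
by rewrite eq_sym; apply/eqP; exact: cover_eq cW' xW' xW.
Qed.

Definition ncov W U := #|[set W' | cover W U W']|.

Lemma card_diff W U : (W <= U)%VS ->
  (\sum_(x | (x \in U) && (x \notin W)) 1 = q ^ \dim U - q ^ \dim W)%N.
Proof.
move=> WU; rewrite -(card_vs U) -(card_vs W) sum1_card.
rewrite -(cardID (mem W) (mem U)).
have -> : #|[predI U & W]| = #|W|.
  apply: eq_card => x; rewrite !inE; case xW: (x \in W); last by rewrite andbF.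
  by rewrite (subvP WU).
by rewrite addKn; apply: eq_card => x; rewrite !inE andbC.
Qed.

Lemma ncovE W U : (W <= U)%VS ->
  (ncov W U * (q ^ \dim W * (q - 1)) = q ^ \dim U - q ^ \dim W)%N.
Proof.
move=> WU; rewrite -card_diff // cover_sum // /ncov -sum_nat_const.
rewrite (eq_bigl (cover W U)); last by move=> W'; rewrite inE.
apply: eq_bigr => W' /coverP[WW' _ d]; rewrite card_diff // d expnS.
by rewrite mulnBr muln1 mulnC.
Qed.

Lemma ncov_codim W U (k : nat) : (W <= U)%VS -> \dim U = (\dim W + k)%N ->
  (ncov W U * (q - 1) = q ^ k - 1)%N.
Proof.
move=> WU d; have := ncovE WU; rewrite d expnD.
have q0 : (0 < q ^ \dim W)%N by rewrite expn_gt0 (ltnW q_gt1).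
have -> : (q ^ \dim W * q ^ k - q ^ \dim W = q ^ \dim W * (q ^ k - 1))%N.
  by rewrite mulnBr muln1.
by rewrite mulnCA => /eqP; rewrite eqn_pmul2l // => /eqP.
Qed.

Lemma ncov_codim2 W U : (W <= U)%VS -> \dim U = (\dim W).+2 -> ncov W U = q.+1.
Proof.
move=> WU d; have := ncov_codim (k := 2) WU; rewrite addn2 => /(_ d).
by move: q_gt1; nia.
Qed.

Lemma ncov_codim3 W U : (W <= U)%VS -> \dim U = (\dim W).+3 ->
  ncov W U = (q ^ 2 + q + 1)%N.
Proof.
move=> WU d; have := ncov_codim (k := 3) WU; rewrite addn3 => /(_ d).
by move: q_gt1; rewrite !expnS expn0; nia.
Qed.

(* The points of PG(N - 1, F) are the vector lines; [S] is the set of all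
   vectors spanning a point of some point set. *)
Definition homog S :=
  0 \notin S /\ forall (a : F) x, a != 0 -> (a *: x \in S) = (x \in S).

Definition cnt S U := #|[set x in S | x \in U]|.

(** Points are one-dimensional subspaces, tested on the representative chosen by [vpick]; for a
    homogeneous [S] the choice is immaterial. *)
Definition wt S U :=
  #|[set P : {vspace V} | [&& \dim P == 1%N, (P <= U)%VS & vpick P \in S]]|.

Lemma cntE S U : cnt S U = (\sum_(x in U) (x \in S))%N.
Proof.
rewrite /cnt -sum1_card big_mkcond [RHS]big_mkcond; apply: eq_bigr => x _.
by rewrite inE andbC; case: (x \in U); case: (x \in S).
Qed.

Lemma cnt_split S W U : (W <= U)%VS ->
  (cnt S U = cnt S W + \sum_(x | (x \in U) && (x \notin W)) (x \in S))%N.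
Proof.
move=> WU; rewrite !cntE (bigID (mem W)) /=; congr (_ + _)%N.
apply: eq_bigl => x; case xW: (x \in W); last by rewrite andbF.
by rewrite (subvP WU).
Qed.

Lemma dim1_vline P : \dim P = 1%N -> P = <[vpick P]>%VS.
Proof.
move=> d; have P0 : vpick P != 0 by rewrite vpick0 -dimv_eq0 d.
by apply/esym/eqP; rewrite eqEdim -memvE memv_pick dim_vline P0 d.
Qed.

Lemma homog_neq0 S x : homog S -> x \in S -> x != 0.
Proof. by case=> h0 _; apply: contraTneq => ->. Qed.

Lemma homogZ S a x : homog S -> a != 0 -> (a *: x \in S) = (x \in S).
Proof. by case=> _; exact. Qed.

Lemma cnt_point S P : homog S -> \dim P = 1%N ->
  cnt S P = ((vpick P \in S) * (q - 1))%N.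
Proof.
move=> hS d; have P0 : vpick P != 0 by rewrite vpick0 -dimv_eq0 d.
rewrite cntE (dim1_vline d); set p := vpick P in P0 *.
have -> : vpick <[p]>%VS = p by rewrite /p -(dim1_vline d).
rewrite (bigD1 0) ?mem0v //= (negPf (proj1 hS)) add0n.
rewrite (eq_bigr (fun=> (p \in S) : nat)).
  rewrite sum_nat_const mulnC; congr (_ * _)%N.
  have inj : injective (fun a : F => a *: p).
    move=> a b /eqP; rewrite -subr_eq0 -scalerBl scaler_eq0 (negPf P0) orbF.
    by rewrite subr_eq0 => /eqP.
  rewrite subn1 -(cardsC1 (0 : F)) -(card_imset _ inj); apply: eq_card => y.
  apply/andP/imsetP.
    case=> /vlineP[a ->] ap; exists a => //; rewrite !inE.
    by apply: contraNneq ap => ->; rewrite scale0r.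
  case=> a; rewrite !inE => a0 ->; rewrite scaler_eq0 negb_or a0 P0.
  by rewrite memvZ ?memv_line.
move=> y /andP[/vlineP[a ->] ap]; rewrite homogZ //.
by apply: contraNneq ap => ->; rewrite scale0r.
Qed.

Lemma cnt0v S : homog S -> cnt S 0 = 0%N.
Proof.
move=> hS; apply/eqP; rewrite cards_eq0; apply/eqP/setP => x; rewrite !inE memv0.
by case: eqVneq => [->|]; rewrite ?(negPf (proj1 hS)) ?andbF.
Qed.

(** Each cover consists of [W] and its own part off [W]. The multiples of [cnt S W] are kept on both
    sides to avoid truncated subtraction. *)
Lemma cnt_cover S W U : (W <= U)%VS ->
  (cnt S U + ncov W U * cnt S W =
   cnt S W + \sum_(W' | cover W U W') cnt S W')%N.
Proof.
move=> WU; rewrite (cnt_split S WU) cover_sum // -addnA; congr (_ + _)%N.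
have -> : (ncov W U * cnt S W = \sum_(W' | cover W U W') cnt S W)%N.
  by rewrite sum_nat_const; congr (_ * _)%N; apply: eq_card => W'; rewrite inE.
rewrite -big_split /=; apply: eq_bigr => W' /coverP[WW' _ _].
by rewrite addnC -cnt_split.
Qed.

Lemma cnt_wt S U : homog S -> cnt S U = (wt S U * (q - 1))%N.
Proof.
move=> hS; have := cnt_cover S (sub0v U); rewrite cnt0v // muln0 addn0 add0n => ->.
rewrite /wt -sum1_card big_distrl /= big_mkcond [RHS]big_mkcond /=.
apply: eq_bigr => P _; rewrite inE /cover /= sub0v dimv0 /=.
case: eqP => [d|_]; last by rewrite andbF.
rewrite andbT; case: (P <= U)%VS => //=.
by rewrite cnt_point //; case: (_ \in S); rewrite ?mul1n ?mul0n.
Qed.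

Lemma wt_cntM S S' U U' (k : nat) : homog S -> homog S' ->
  (cnt S U = k * cnt S' U')%N -> (wt S U = k * wt S' U')%N.
Proof.
move=> h h'; rewrite !cnt_wt // mulnA => /eqP.
by rewrite eqn_pmul2r ?subn_gt0 ?q_gt1 // => /eqP.
Qed.

Lemma wt_cover S W U : homog S -> (W <= U)%VS ->
  (wt S U + ncov W U * wt S W = wt S W + \sum_(W' | cover W U W') wt S W')%N.
Proof.
move=> hS WU; have := cnt_cover S WU.
rewrite (eq_bigr (fun W' => wt S W' * (q - 1)))%N; last by move=> *; exact: cnt_wt.
rewrite -big_distrl /= !(cnt_wt _ hS) mulnA -!mulnDl => /eqP.
by rewrite eqn_pmul2r ?subn_gt0 ?q_gt1 // => /eqP.
Qed.

(** The count with one member of the pencil set aside, for comparing a known [L] with lower bounds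
    for all the others. *)
Lemma wt_cover_but S W U L (k : nat) : homog S -> (W <= U)%VS -> cover W U L ->
  ncov W U = k.+1 ->
  #|[pred W' | cover W U W' && (W' != L)]| = k /\
  (wt S U + k * wt S W = wt S L + \sum_(W' | cover W U W' && (W' != L)) wt S W')%N.
Proof.
move=> hS WU cL nk; split.
  move: nk; rewrite /ncov (cardD1 L) inE cL add1n => -[<-].
  by apply: eq_card => W'; rewrite !inE andbC.
have := wt_cover hS WU; rewrite nk (bigD1 L) //= mulSn addnCA => /eqP.
by rewrite eqn_add2l => /eqP.
Qed.

Lemma wtS S W U : (W <= U)%VS -> (wt S W <= wt S U)%N.
Proof.
move=> WU; apply/subset_leq_card/subsetP => P; rewrite !inE.
by case/and3P=> -> /subv_trans-> // ->.
Qed.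

Lemma wt_gt0P S U : homog S ->
  reflect (exists2 x, x \in S & x \in U) (0 < wt S U)%N.
Proof.
move=> hS; have q1 : (0 < q - 1)%N by rewrite subn_gt0 q_gt1.
have -> : (0 < wt S U)%N = (0 < cnt S U)%N by rewrite cnt_wt // muln_gt0 q1 andbT.
apply: (iffP card_gt0P) => [[x]|[x xS xU]]; last by exists x; rewrite inE xS.
by rewrite inE => /andP[]; exists x.
Qed.

Lemma wt_line S x : homog S -> x != 0 -> wt S <[x]> = (x \in S).
Proof.
move=> hS x0; have d : \dim <[x]> = 1%N by rewrite dim_vline x0.
have := cnt_point hS d; rewrite cnt_wt //.
have -> : (vpick <[x]> \in S) = (x \in S).
  have /vlineP[a ap] := memv_pick <[x]>%VS.
  have : vpick <[x]>%VS != 0 by rewrite vpick0 -dimv_eq0 d.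
  by rewrite ap scaler_eq0 negb_or => /andP[a0 _]; rewrite homogZ.
by move/eqP; rewrite eqn_pmul2r ?subn_gt0 ?q_gt1 // => /eqP.
Qed.

Lemma notin_line S x y : homog S -> x \notin S -> y \in S -> y \notin <[x]>%VS.
Proof.
move=> hS xS yS; apply: contra xS => /vlineP[a e]; move: yS (homog_neq0 hS yS).
by rewrite e scaler_eq0 negb_or => aS /andP[a0 _]; rewrite -(homogZ _ hS a0).
Qed.

Lemma wt_lt_exists S L U : homog S -> (wt S L < wt S U)%N ->
  exists2 y, y \in S & y \in U /\ y \notin L.
Proof.
move=> hS lt; have [y /and3P[yS yU yL]|none] := pickP [pred y | [&& y \in S, y \in U & y \notin L]].
  by exists y.
have q1 : (0 < q - 1)%N by rewrite subn_gt0 q_gt1.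
move: lt; rewrite -(ltn_pmul2r q1) -!cnt_wt // ltnNge => /negP[].
apply/subset_leq_card/subsetP => z; rewrite !inE => /andP[zS zU]; rewrite zS.
by apply/negPn/negP => zL; have := none z; rewrite /= zS zU zL.
Qed.

Definition evenset S U := forall L, (L <= U)%VS -> \dim L = 2%N -> ~~ odd (wt S L).

Lemma evensetS S W U : (W <= U)%VS -> evenset S U -> evenset S W.
Proof. by move=> WU e L LW; apply: e; exact: subv_trans WU. Qed.

Lemma even_line_ge2 S U L x : homog S -> evenset S U -> (L <= U)%VS ->
  \dim L = 2%N -> x \in S -> x \in L -> (2 <= wt S L)%N.
Proof.
move=> hS e LU d xS xL; have := e _ LU d.
have : (0 < wt S L)%N by apply/wt_gt0P => //; exists x.
by case: (wt S L) => [|[]].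
Qed.

(** By evenness each line through [x] carries a second point. *)
Lemma wt_ge_lines S U x : homog S -> evenset S U -> x \in S -> x \in U ->
  (wt S U >= 1 + ncov <[x]> U)%N.
Proof.
move=> hS e xS xU; have x0 := homog_neq0 hS xS.
have xU' : (<[x]> <= U)%VS by rewrite -memvE.
have := wt_cover hS xU'; rewrite wt_line // xS muln1.
have : (\sum_(W' | cover <[x]> U W') wt S W' >= ncov <[x]> U * 2)%N.
  rewrite /ncov -sum_nat_const.
  rewrite (eq_bigl (cover <[x]> U)); last by move=> W'; rewrite inE.
  apply: leq_sum => L /coverP[xL LU dL].
  by apply: even_line_ge2 e LU _ xS _ => //; rewrite ?memvE // dL dim_vline x0.
lia.
Qed.

Lemma wt_plane_ge S U : homog S -> evenset S U -> \dim U = 3%N -> (0 < wt S U)%N ->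
  (wt S U >= q + 2)%N.
Proof.
move=> hS e d /(wt_gt0P _ hS)[x xS xU]; have := wt_ge_lines hS e xS xU.
by rewrite ncov_codim2 -?memvE // ?dim_vline ?(homog_neq0 hS xS) //; lia.
Qed.

End Counting.

(** * The lower bound for sets of even type *)

Lemma Cauchy_Schwarz_nat (I : finType) (B : {set I}) (a : I -> nat) :
  ((\sum_(i in B) a i) ^ 2 <= #|B| * \sum_(i in B) a i ^ 2)%N.
Proof.
rewrite -(leq_pmul2l (isT : 0 < 2)%N) expnS expn1 big_distrlr /=.
have -> : (2 * (#|B| * \sum_(i in B) a i ^ 2) =
  \sum_(i in B) \sum_(j in B) (a i ^ 2 + a j ^ 2))%N.
  under [RHS]eq_bigr => i _ do rewrite big_split sum_nat_const /=.
  by rewrite big_split /= sum_nat_const -big_distrr /= mul2n addnn.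
rewrite big_distrr /=; apply: leq_sum => i _; rewrite big_distrr /=.
by apply: leq_sum => j _; exact: nat_Cauchy.
Qed.

Section LowerBound.
Variables (F : finFieldType) (N : nat).
Local Notation V := 'rV[F]_N.
Local Notation q := #|F|.
Implicit Types (S : {set V}) (U W L P : {vspace V}) (x y v : V).

Definition dot (x u : V) : F := (x *m u^T) 0 0.

Lemma dotDl x y u : dot (x + y) u = dot x u + dot y u.
Proof. by rewrite /dot mulmxDl mxE. Qed.
Lemma dotDr x y u : dot u (x + y) = dot u x + dot u y.
Proof. by rewrite /dot linearD mulmxDr mxE. Qed.
Lemma dotNl x u : dot (- x) u = - dot x u.
Proof. by rewrite /dot mulNmx mxE. Qed.
Lemma dotZr (a : F) x u : dot u (a *: x) = a * dot u x.
Proof. by rewrite /dot linearZ -scalemxAr mxE. Qed.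

Lemma dot_unit x : x != 0 -> exists w, dot x w = 1.
Proof.
case: (pickP (fun i => x 0 i != 0)) => [i xi _|h]; last first.
  by move/eqP; case; apply/rowP => i; have /negbFE/eqP := h i; rewrite mxE.
exists ((x 0 i)^-1 *: delta_mx 0 i); rewrite dotZr /dot trmx_delta -colE mxE.
by rewrite mulVf.
Qed.

(** For [w] with [dot x w = 1], each vector is uniquely a multiple of [w] plus a vector orthogonal
    to [x]. *)
Lemma card_orthogonal x : x != 0 ->
  (q * #|[set u | dot x u == 0%R]| = q ^ N)%N.
Proof.
move=> /dot_unit[w xw]; set K := [set u | _].
have -> : (q ^ N)%N = #|[set: V]| by rewrite cardsT card_mx mul1n.
rewrite -cardsT -cardsX.
rewrite -(card_in_imset (D := setX [set: F] K) (f := fun p => p.1 *: w + p.2)).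
  apply: eq_card => u; rewrite in_setT; apply/imsetP.
  exists (dot x u, u - dot x u *: w); last by rewrite /= addrC subrK.
  by rewrite !inE /= -scaleNr dotDr dotZr xw mulr1 subrr.
move=> [a u] [b u']; rewrite !inE /= => /eqP xu /eqP xu' e.
have ab : a = b by have := congr1 (dot x) e; rewrite !dotDr !dotZr xu xu' xw !mulr1 !addr0.
by move: e; rewrite ab => /addrI ->.
Qed.

(** * The affine part of a set and its parallel hyperplanes *)

Section Pencil.
Variables (S : {set V}) (U H : {vspace V}) (x0 : V).
Hypotheses (hS : homog S) (HU : (H <= U)%VS) (dU : \dim U = (\dim H).+1).
Hypotheses (x0U : x0 \in U) (x0H : x0 \notin H).

(** Scaling the coefficient of [x0] to 1 identifies the points of [S] in [U] off the hyperplane [H]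
    with an affine set of vectors of [H]. *)
Let A := [set h in H | x0 + h \in S].

Lemma affine_decomp x : x \in U -> x \notin H ->
  exists a h, [/\ a != 0, h \in H & x = a *: (x0 + h)].
Proof.
have -> : U = (H + <[x0]>)%VS.
  apply/esym/eqP; rewrite eqEdim subv_add HU -memvE x0U dim_addline // dU.
  by rewrite leqnn.
move=> /memv_addP[h hH [_ /vlineP[a ->] ->]] xH.
have a0 : a != 0 by apply: contraNneq xH => ->; rewrite scale0r addr0.
exists a, (a^-1 *: h); split; rewrite ?rpredZ //.
by rewrite scalerDr scalerA divff // scale1r addrC.
Qed.

Lemma wt_affine : wt S U = (wt S H + #|A|)%N.
Proof.
have q1 : (0 < q - 1)%N by rewrite subn_gt0 q_gt1.
apply/eqP; rewrite -(eqn_pmul2r q1) mulnDl -!cnt_wt // (cnt_split S HU).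
rewrite eqn_add2l -big_mkcondr sum1_card; apply/eqP.
rewrite subn1 -(cardsC1 (0 : F)) -cardsX.
rewrite -(card_in_imset (f := fun p : V * F => p.2 *: (x0 + p.1))).
  apply: eq_card => x; rewrite unfold_in; apply/andP/imsetP.
    case=> /andP[xU xH] xS.
    have [a [h [a0 hH e]]] := affine_decomp xU xH.
    by exists (h, a) => //; rewrite !inE a0 hH -(homogZ _ hS a0) -e xS.
  case=> -[h a]; rewrite !inE /= => /andP[/andP[hH xS] a0] ->.
  have -> : a *: (x0 + h) \notin H.
    apply: contra x0H => ax; rewrite -[x0](addrK h) rpredB //.
    by rewrite -[x0 + h](scalerK a0) rpredZ.
  by rewrite homogZ // xS andbT rpredZ // rpredD // (subvP HU).
move=> [h a] [h' a']; rewrite !inE /= => /andP[/andP[hH _] a0] /andP[/andP[h'H _] _] e.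
have aa : a = a'.
  apply/eqP; rewrite -subr_eq0; apply: contraNT x0H => d.
  rewrite -[x0](scalerK d) rpredZ //.
  have -> : (a - a') *: x0 = a' *: h' - a *: h.
    move: e; rewrite !scalerDr scalerBl => /(canRL (addrK _)) ->.
    by rewrite addrAC [a' *: x0 + _]addrC addrK.
  by rewrite rpredB // rpredZ.
by move: e; rewrite -aa => /(scalerI a0)/addrI ->.
Qed.

(** If the value [t] is missed, the functional takes at most q - 1 values on [A], and by
    Cauchy-Schwarz many ordered pairs of [A] share a value. *)
Lemma pencil_collision (u : V) (t : F) : (forall h, h \in A -> dot h u != t) ->
  (#|A| ^ 2 <= (q - 1) * #|[set p in setX A A | dot (p.1 - p.2) u == 0%R]|)%N.
Proof.
move=> ht; pose a s := #|[set h in A | dot h u == s]|.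
have sA : #|A| = (\sum_(s in [set~ t]) a s)%N.
  rewrite -sum1_card (partition_big (dot^~ u) (mem [set~ t])) /=.
    by apply: eq_bigr => s _; rewrite /a -sum1_card; apply: eq_bigl => h; rewrite !inE.
  by move=> h hA; rewrite !inE ht.
have -> : (q - 1)%N = #|[set~ t]| by rewrite cardsC1 subn1.
rewrite sA; apply: leq_trans (Cauchy_Schwarz_nat _ _) _.
rewrite leq_mul2l; apply/orP; right.
rewrite -[X in (_ <= X)%N]sum1_card.
rewrite (partition_big (fun p : V * V => dot p.1 u) (mem [set~ t])) /=; last first.
  by move=> [h h']; rewrite !inE /= => /andP[/andP[hA _] _]; rewrite ht // !inE.
apply: leq_sum => s _; rewrite expnS expn1 /a -cardsX -sum1_card.
rewrite [X in (_ <= X)%N](eq_bigl (mem (setX [set h in A | dot h u == s]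
  [set h in A | dot h u == s]))) //.
move=> [h h']; rewrite !inE /= dotDl dotNl subr_eq0.
case: (dot h u =P s) => [->|_]; rewrite !(andbT, andbF) //=.
by rewrite [s == _]eq_sym !andbA.
Qed.

(* Otherwise [pencil_collision] holds for every [u]; summing over [u] bounds
   [#|A|] by Cauchy-Schwarz. *)
Lemma full_direction : ((q - 1) ^ 2 < #|A|)%N ->
  exists u, forall t, exists2 h, h \in A & dot h u = t.
Proof.
move=> lA.
pose good (u : V) := [forall t, [exists h in A, dot h u == t]].
have [u /forallP gu|bad] := pickP good.
  by exists u => t; have /exists_inP[h hA /eqP] := gu t; exists h.
suff : (#|A| <= (q - 1) ^ 2)%N by rewrite leqNgt lA.
have [T TE] : exists T, T = setX A A by exists (setX A A).
have c1 : (q ^ N * #|A| ^ 2 <=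
    (q - 1) * \sum_(u : V) #|[set p in T | dot (p.1 - p.2) u == 0%R]|)%N.
  have -> : (q ^ N)%N = #|V| by rewrite card_mx mul1n.
  rewrite -sum_nat_const big_distrr /=; apply: leq_sum => u _.
  have /negbT := bad u; rewrite negb_forall => /existsP[t].
  by rewrite negb_exists_in TE => /forall_inP ht; exact: pencil_collision ht.
have diag : #|[set p in T | p.1 == p.2]| = #|A|.
  rewrite -(card_imset _ (f := fun h : V => (h, h))) => [|h h' [] //].
  apply: eq_card => -[h h']; rewrite inE; apply/andP/imsetP.
    case=> hT /eqP /= e; rewrite -e; exists h => //.
    by move: hT; rewrite TE in_setX => /andP[].
  by case=> k kA [-> ->]; rewrite TE in_setX kA eqxx.
(* The same sum counted by pairs: a diagonal pair agrees for all [q ^ N] vectors [u], any other pair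
   for one q-th of them. *)
have c2 : (q * \sum_(u : V) #|[set p in T | dot (p.1 - p.2) u == 0%R]| =
    q ^ N * (q * #|A| + (#|A| ^ 2 - #|A|)))%N.
  have cardE (X : finType) (B : {set X}) (P : pred X) :
      #|[set p in B | P p]| = (\sum_(p in B) P p)%N.
    rewrite -sum1dep_card [LHS]big_mkcondr /=.
    by apply: eq_bigr => p _; case: (P p).
  under eq_bigr => u _ do rewrite cardE.
  rewrite exchange_big /=.
  have inner (p : V * V) : (\sum_(u : V) (dot (p.1 - p.2) u == 0%R) =
      #|[set u : V | dot (p.1 - p.2) u == 0%R]|)%N.
    rewrite -sum1dep_card [RHS]big_mkcond.
    by apply: eq_bigr => u _; case: (_ == 0).
  under eq_bigr => p _ do rewrite inner.
  rewrite big_distrr /= (bigID (fun p : V * V => p.1 == p.2)) /= mulnDr; congr (_ + _)%N.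
    transitivity (\sum_(p in T | p.1 == p.2) (q * q ^ N))%N.
      apply: eq_bigr => p /andP[pT /eqP e]; congr (_ * _)%N.
      have -> : (q ^ N)%N = #|V| by rewrite card_mx mul1n.
      by apply: eq_card => u; rewrite !inE e subrr /dot mul0mx mxE eqxx.
    by rewrite sum_nat_cond_const diag mulnCA mulnA mulnC.
  transitivity (\sum_(p in T | p.1 != p.2) (q ^ N))%N.
    by apply: eq_bigr => p /andP[pT e]; rewrite (@card_orthogonal (p.1 - p.2)) ?subr_eq0.
  rewrite sum_nat_cond_const mulnC; congr (_ * _)%N.
  have <- : #|T| = (#|A| ^ 2)%N by rewrite TE cardsX expnS expn1.
  rewrite -diag -(cardsID [set p | p.1 == p.2] T).
  have -> : T :&: [set p | p.1 == p.2] = [set p in T | p.1 == p.2].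
    by apply/setP => p; rewrite !inE.
  by rewrite addKn; apply: eq_card => p; rewrite !inE andbC.
have q0 : (0 < q ^ N)%N by rewrite expn_gt0 (ltnW (q_gt1 F)).
(* After cancellation this says that the square of [#|A|] is at most [(q - 1) ^ 2] times [#|A|]. *)
have : (q * #|A| ^ 2 <= (q - 1) * (q * #|A| + (#|A| ^ 2 - #|A|)))%N.
  rewrite -(leq_pmul2l q0) mulnCA (mulnCA _ (q - 1)%N) -c2 (mulnCA _ q) leq_mul2l.
  by rewrite c1 orbT.
by clear; move: (q_gt1 F); rewrite !expnS expn0; nia.
Qed.

End Pencil.

Lemma wt_line2 S x y : homog S -> y != 0 -> x \notin <[y]>%VS ->
  wt S (<[x]> + <[y]>) = ((y \in S) + #|[set s : F | (x + s *: y)%R \in S]|)%N.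
Proof.
move=> hS y0 xy.
rewrite (@wt_affine S (<[x]> + <[y]>)%VS <[y]>%VS x) ?addvSr //.
- rewrite wt_line //; congr (_ + _)%N.
  have inj : injective (fun s => s *: y).
    move=> a b /eqP; rewrite -subr_eq0 -scalerBl scaler_eq0 (negPf y0) orbF.
    by rewrite subr_eq0 => /eqP.
  rewrite -(card_imset _ inj); apply: eq_card => h; rewrite inE.
  apply/andP/imsetP => [[/vlineP[s ->] xs]|[s]]; first by exists s; rewrite ?inE.
  by rewrite inE => xs ->; rewrite memvZ ?memv_line.
- by rewrite addvC dim_addline.
- by rewrite memvE addvSl.
Qed.

(** [L] is the kernel on [H] of the functional given by [full_direction]. The hyperplanes on [L]
    other than [H] are its level sets in the affine part, and every level is attained. *)
Lemma full_pencil S U H : homog S -> (H <= U)%VS -> \dim U = (\dim H).+1 ->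
  wt S H = 0%N -> ((q - 1) ^ 2 < wt S U)%N ->
  exists L, [/\ (L <= H)%VS, \dim H = (\dim L).+1 &
    forall H', cover L U H' -> H' != H -> (0 < wt S H')%N].
Proof.
move=> hS HU dU ext lU.
have [x0 x0U x0H] : exists2 x, x \in U & x \notin H.
  apply/subvPn; apply/negP => /dimvS; lia.
rewrite (wt_affine hS HU dU x0U x0H) ext add0n in lU.
have [u hu] := full_direction lU.
pose f : 'Hom(V, 'M[F]_1) := linfun (mulmxr u^T).
have fE x : f x = (dot x u)%:M by rewrite lfunE /= {1}[_ *m _]mx11_scalar.
exists (H :&: lker f)%VS.
have dK : \dim H = (\dim (H :&: lker f)).+1.
  rewrite -(limg_ker_dim f H); suff -> : \dim (f @: H) = 1%N by rewrite addn1.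
  apply/eqP; rewrite eqn_leq; apply/andP; split.
    by apply: leq_trans (dimvS (subvf _)) _; rewrite dimvf /dim /= muln1.
  rewrite lt0n dimv_eq0 -subv0; apply/subvPn; exists (f 0 + 1%:M).
    have [h] := hu 1; rewrite inE => /andP[hH _] e.
    by rewrite linear0 add0r -e -fE memv_img.
  by rewrite linear0 add0r memv0 oner_eq0.
split=> //; first exact: capvSl.
move=> H' cH' H'H; have [LH' H'U dH'] := coverP _ _ _ cH'.
have [y yH' yH] : exists2 y, y \in H' & y \notin H.
  apply/subvPn; apply: contraNN H'H => H'H.
  by rewrite eqEdim H'H dH' dK leqnn.
have [a [h [a0 hH e]]] := affine_decomp HU dU x0U x0H (subvP H'U _ yH') yH.
have [h' h'A dh'] := hu (dot h u).
move: h'A; rewrite inE => /andP[h'H xS]; apply/wt_gt0P => //.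
exists (x0 + h') => //.
have -> : x0 + h' = a^-1 *: y + (h' - h) by rewrite e scalerA mulVf // scale1r addrACA subrr addr0.
rewrite rpredD ?rpredZ // (subvP LH') // memv_cap rpredB //= memv_ker fE.
by rewrite dotDl dotNl dh' subrr raddf0.
Qed.

(** A subspace missing [S] is enlarged one dimension at a time: if all its covers met [S], each
    would contribute at least the known bound for its dimension, and together they would exceed the
    weight of [S]. *)
Lemma external_subspace S U r : homog S -> evenset S U -> \dim U = r.+4 ->
  (forall i W, (i <= r)%N -> (W <= U)%VS -> \dim W = i.+3 -> (0 < wt S W)%N ->
     ((q + 2) * q ^ i <= wt S W)%N) ->
  (wt S U <= (q + 2) * q ^ r.+1)%N ->
  forall j, (j <= r.+3)%N -> exists L, [/\ (L <= U)%VS, \dim L = j & wt S L = 0%N].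
Proof.
move=> hS e dU lb ub; elim=> [|j IH] lj.
  exists 0%VS; rewrite sub0v dimv0; split=> //; apply/eqP; rewrite -leqn0 leqNgt.
  by apply/negP => /(wt_gt0P _ hS)[x xS]; rewrite memv0 (negPf (homog_neq0 hS xS)).
have [L [LU dL wL]] := IH (ltnW lj).
have [W' /andP[/coverP[LW' W'U dW'] /eqP wW']|none] := pickP (fun W' => cover L U W' && (wt S W' == 0%N)).
  by exists W'; rewrite dW' dL; split.
have pos W' : cover L U W' -> (0 < wt S W')%N.
  by move=> c; have := none W'; rewrite c /= lt0n => ->.
(* The least weight of a cover that meets [S]: 1 for a point, 2 for a line, and the inductive bound
   from planes on. *)
pose b := if j is i.+2 then ((q + 2) * q ^ i)%N else j.+1.
have {}pos W' : cover L U W' -> (b <= wt S W')%N.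
  move=> c; have p := pos _ c; case/coverP: c => LW' W'U dW'; rewrite dL in dW'.
  rewrite /b; case: j {IH b} lj dL dW' => [|[|i]] lj dL dW' //.
    have /(wt_gt0P _ hS)[x xS xW] := p; exact: even_line_ge2 e W'U dW' xS xW.
  by apply: lb => //; lia.
have := wt_cover hS LU; rewrite wL muln0 addn0 add0n => wU.
have le : (ncov L U * b <= wt S U)%N.
  rewrite wU /ncov -sum_nat_const (eq_bigl (cover L U)); last by move=> W'; rewrite inE.
  exact: leq_sum.
have nc : (ncov L U * (q - 1) = q ^ (r.+4 - j) - 1)%N by apply: ncov_codim => //; lia.
have q1 := q_gt1 F.
have X1 : (0 < q ^ r)%N by rewrite expn_gt0 (ltnW q1).
have : (ncov L U * (q - 1) * b <= (q + 2) * q ^ r.+1 * (q - 1))%N.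
  rewrite mulnAC leq_mul2r; apply/orP; right; exact: leq_trans le ub.
rewrite nc {nc le wU pos none}; rewrite /b; case: j {b IH} lj dL => [|[|i]] lj dL.
- rewrite subn0 !expnS; move: (q ^ r)%N X1 => X X1.
  by clear -q1 X1; move: #|F| q1 => [|[|p]] // _; nia.
- rewrite subn1 /= !expnS; move: (q ^ r)%N X1 => X X1.
  by clear -q1 X1; move: #|F| q1 => [|[|p]] // _; nia.
have -> : (r.+4 - i.+2)%N = ((r - i) + 2)%N by lia.
have -> : (q ^ r.+1 = q ^ (r - i) * q * q ^ i)%N.
  by rewrite -expnSr -expnD; congr expn; lia.
have Y0 : (0 < q ^ (r - i))%N by rewrite expn_gt0 (ltnW q1).
rewrite expnD; move: (q ^ (r - i))%N Y0 => Y Y0; have: (0 < q ^ i)%N by rewrite expn_gt0 (ltnW q1).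
move: (q ^ i)%N => Z Z0.
have -> : ((Y * q ^ 2 - 1) * ((q + 2) * Z) = (q + 2) * Z * (Y * q ^ 2 - 1))%N by rewrite mulnC.
have -> : ((q + 2) * (Y * q * Z) * (q - 1) = (q + 2) * Z * (Y * q * (q - 1)))%N by nia.
rewrite leq_pmul2l ?muln_gt0 ?addn_gt0 ?orbT // expnS expn1.
by clear -q1 Y0; move: #|F| q1 => [|[|p]] // _; nia.
Qed.

(** Besides an external hyperplane, the pencil on [L] has [q] members, all meeting [S]; the bound
    for them gives the weight, and if none attained it the total would be too large. *)
Lemma lower_step S U r : homog S -> evenset S U -> \dim U = r.+4 ->
  (forall i W, (i <= r)%N -> (W <= U)%VS -> \dim W = i.+3 -> (0 < wt S W)%N ->
     ((q + 2) * q ^ i <= wt S W)%N) ->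
  (0 < wt S U <= (q + 2) * q ^ r.+1)%N ->
  wt S U = ((q + 2) * q ^ r.+1)%N /\
  exists H, [/\ (H <= U)%VS, \dim H = r.+3 & wt S H = ((q + 2) * q ^ r)%N].
Proof.
move=> hS e dU lb /andP[p ub].
have [H [HU dH wH]] := external_subspace hS e dU lb ub (leqnn _).
have q1 := q_gt1 F.
have big : ((q - 1) ^ 2 < wt S U)%N.
  have /(wt_gt0P _ hS)[x xS xU] := p.
  have := wt_ge_lines hS e xS xU.
  have : (ncov <[x]> U * (q - 1) = q ^ r.+3 - 1)%N.
    by apply: ncov_codim; rewrite -?memvE // dim_vline (homog_neq0 hS xS).
  have : (0 < q ^ r)%N by rewrite expn_gt0 (ltnW q1).
  rewrite !expnS expn0; move: (q ^ r)%N => X X1.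
  have : (q * (q * (q * 1)) <= q * (q * (q * X)))%N by rewrite !leq_mul2l X1 !orbT.
  move: (q * (q * (q * X)))%N => Z; clear -q1; move: #|F| q1 => [|[|p]] // _.
  by move: (ncov _ _) => n; nia.
have [|L [LH dL full]] := full_pencil hS HU _ wH big; first by rewrite dU dH.
have LU := subv_trans LH HU.
have wL : wt S L = 0%N by apply/eqP; rewrite -leqn0 -wH wtS.
have cH : cover L U H by apply/coverP.
have := wt_cover hS LU; rewrite wL muln0 addn0 add0n (bigD1 H) //= wH add0n => wU.
have n1 : #|[pred H' | cover L U H' && (H' != H)]| = q.
  have := @ncov_codim2 _ _ L U LU; rewrite dU -dH dL => /(_ erefl).
  rewrite /ncov (cardD1 H) inE cH /= => -[<-].
  by apply: eq_card => W; rewrite !inE andbC.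
have ge : forall H', cover L U H' && (H' != H) -> ((q + 2) * q ^ r <= wt S H')%N.
  move=> H' /andP[c n]; apply: lb (full _ c n) => //; first by case/coverP: c.
  by case/coverP: c => _ _ ->; rewrite -dL dH.
have wge : ((q + 2) * q ^ r.+1 <= wt S U)%N.
  rewrite wU expnS mulnCA -[X in (X * _)%N]n1 -sum_nat_const; exact: leq_sum.
split; first by apply/eqP; rewrite eqn_leq ub wge.
have [H' /andP[c /eqP w]|none] :=
    pickP (fun H' => (cover L U H' && (H' != H)) && (wt S H' == (q + 2) * q ^ r)%N).
  exists H'; split=> //; first by case/andP: c => /coverP[].
  by case/andP: c => /coverP[_ _ ->] _; rewrite -dL dH.
have : (\sum_(H' | cover L U H' && (H' != H)) ((q + 2) * q ^ r).+1 <= wt S U)%N.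
  rewrite wU; apply: leq_sum => H' c; rewrite ltn_neqAle ge // andbT eq_sym.
  by have := none H'; rewrite c /= => ->.
rewrite sum_nat_const n1 mulnS; move: ub; rewrite expnS mulnCA; lia.
Qed.

Theorem wt_lower S U r : homog S -> evenset S U -> \dim U = r.+3 ->
  (0 < wt S U)%N -> ((q + 2) * q ^ r <= wt S U)%N.
Proof.
elim/ltn_ind: r U => -[|r] IH U hS e dU p.
  by rewrite expn0 muln1; exact: wt_plane_ge.
case: (leqP ((q + 2) * q ^ r.+1) (wt S U)) => // lt; have ub := ltnW lt.
have lb i W : (i <= r)%N -> (W <= U)%VS -> \dim W = i.+3 -> (0 < wt S W)%N ->
    ((q + 2) * q ^ i <= wt S W)%N.
  by move=> li WU dW; apply: IH => //; exact: evensetS e.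
have p2 : (0 < wt S U <= (q + 2) * q ^ r.+1)%N by rewrite p.
by have [w] := lower_step hS e dU lb p2; rewrite w ltnn in lt.
Qed.

Theorem min_hyperplane S U r : homog S -> evenset S U -> \dim U = r.+4 ->
  wt S U = ((q + 2) * q ^ r.+1)%N ->
  exists H, [/\ (H <= U)%VS, \dim H = r.+3 & wt S H = ((q + 2) * q ^ r)%N].
Proof.
move=> hS e dU w; have [] // := lower_step hS e dU (r := r).
  by move=> i W _ WU dW; apply: wt_lower => //; exact: evensetS e.
by rewrite w leqnn andbT muln_gt0 expn_gt0 (ltnW (q_gt1 F)) addn_gt0 orbT.
Qed.

End LowerBound.

(** * The radical of a minimum set *)

Section Radical.
Variables (F : finFieldType) (N : nat).
Local Notation V := 'rV[F]_N.
Local Notation q := #|F|.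
Implicit Types (S : {set V}) (U W H L P A B : {vspace V}) (x y v : V).

Lemma span_closed (A : pred V) : A 0 ->
  (forall a x y, A x -> A y -> A (a *: x + y)) ->
  forall v, (v \in <<enum A>>%VS) = A v.
Proof.
move=> A0 Alin v; apply/idP/idP => [|Av]; last by apply: memv_span; rewrite mem_enum.
move=> /coord_span ->.
elim/big_ind: _ => // [x y Ax Ay|i _]; first by rewrite -[x]scale1r; exact: Alin.
have : (enum A)`_i \in enum A by apply: mem_nth; rewrite -cardE ltn_ord.
rewrite mem_enum => Ai; rewrite -[_ *: _]addr0; exact: Alin.
Qed.

(** The span only serves to obtain a [{vspace V}]: by homogeneity multiples of a period are periods,
    so [radP] finds nothing added. *)
Definition rad S U : {vspace V} :=
  <<enum [pred v | (v \in U) && [forall x in U, (x + v \in S) == (x \in S)]]>>.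

Lemma radP S U v : homog S ->
  reflect (v \in U /\ forall x, x \in U -> (x + v \in S) = (x \in S)) (v \in rad S U).
Proof.
move=> hS; rewrite span_closed /=.
- apply: (iffP andP) => -[vU h]; split=> //; first by move=> x xU; have /forall_inP/(_ _ xU)/eqP := h.
  by apply/forall_inP => x xU; rewrite h.
- by rewrite mem0v; apply/forall_inP => x _; rewrite addr0.
move=> a x y /andP[xU /forall_inP hx] /andP[yU /forall_inP hy].
rewrite rpredD ?rpredZ //=; apply/forall_inP => z zU.
rewrite addrA (eqP (hy _ _)) ?rpredD ?rpredZ //.
have [->|a0] := eqVneq a 0; first by rewrite scale0r addr0.
have -> : z + a *: x = a *: (a^-1 *: z + x) by rewrite scalerDr scalerKV.
by rewrite homogZ // (eqP (hx _ _)) ?rpredZ // homogZ ?invr_neq0.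
Qed.

Lemma rad_sub S U : homog S -> (rad S U <= U)%VS.
Proof. by move=> hS; apply/subvP => v /(radP _ _ hS)[]. Qed.

Lemma rad_notin S U v : homog S -> v \in rad S U -> v \notin S.
Proof. by move=> hS /(radP _ _ hS)[_ /(_ 0)]; rewrite mem0v add0r (negPf (proj1 hS)) => ->. Qed.

Lemma radD S U x v : homog S -> v \in rad S U -> x \in U -> (x + v \in S) = (x \in S).
Proof. by move=> hS /(radP _ _ hS)[_]; exact. Qed.

Lemma rad_cap S U W v : homog S -> (W <= U)%VS -> v \in rad S U -> v \in W ->
  v \in rad S W.
Proof.
move=> hS WU vr vW; apply/radP => //; split=> // x xW.
by rewrite (radD hS vr) // (subvP WU).
Qed.

(** Add [B] to a complement of [A + B] in [U]. *)
Lemma complement_through A B U : (A <= U)%VS -> (B <= U)%VS -> (A :&: B = 0)%VS ->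
  exists H, [/\ (B <= H)%VS, (H <= U)%VS, (H :&: A = 0)%VS, (H + A = U)%VS &
    \dim U = (\dim H + \dim A)%N].
Proof.
move=> AU BU AB; pose C := (U :\: (A + B))%VS.
have CU : (C <= U)%VS by rewrite diffvSl.
have CAB : (C :&: (A + B) = 0)%VS by rewrite capv_diff.
have dAB : \dim (A + B) = (\dim A + \dim B)%N by rewrite dimv_disjoint_sum.
have sumU : (C + (A + B) = U)%VS.
  by rewrite addv_diff; apply/addv_idPl; rewrite subv_add AU BU.
have dU : \dim U = (\dim C + (\dim A + \dim B))%N.
  by rewrite -{1}sumU dimv_disjoint_sum // dAB.
have CB : (C :&: B = 0)%VS.
  by apply/eqP; rewrite -subv0 -CAB capvS // addvSr.
have dCB : \dim (C + B) = (\dim C + \dim B)%N by rewrite dimv_disjoint_sum.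
exists (C + B)%VS; split.
- exact: addvSr.
- by rewrite subv_add CU BU.
- have := dimv_sum_cap (C + B) A.
  have -> : (C + B + A = U)%VS by rewrite -addvA [(B + A)%VS]addvC.
  by rewrite dU dCB => h; apply/eqP; rewrite -dimv_eq0; apply/eqP; lia.
- by rewrite -addvA [(B + A)%VS]addvC.
- by rewrite dU dCB; lia.
Qed.

Lemma wt_complement_rad S U R H : homog S -> (R <= rad S U)%VS ->
  (H :&: R = 0)%VS -> (H + R = U)%VS -> wt S U = (q ^ \dim R * wt S H)%N.
Proof.
move=> hS Rr HR sU; apply: wt_cntM => //.
rewrite -card_vs -cardsE /cnt -cardsX.
have RU : (R <= U)%VS by rewrite -sU addvSr.
have HU : (H <= U)%VS by rewrite -sU addvSl.
rewrite -(card_in_imset (f := fun p : V * V => p.2 + p.1)); last first.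
  move=> [r h] [r' h']; rewrite !inE /= => /andP[rR /andP[_ hH]] /andP[rR' /andP[_ hH']] e.
  have e' : h - h' = r' - r by apply/eqP; rewrite subr_eq addrAC eq_sym subr_eq addrC -e.
  have : h - h' \in (H :&: R)%VS by rewrite memv_cap rpredB //= e' rpredB.
  rewrite HR memv0 => h0; move: e'; rewrite (eqP h0) => /esym/eqP.
  by rewrite subr_eq0 => /eqP ->; rewrite -[h](subrK h') (eqP h0) add0r.
apply: eq_card => x; rewrite inE; apply/andP/imsetP.
  rewrite -sU => -[xS /memv_addP[h hH [r rR e]]]; exists (r, h) => //=.
  by rewrite !inE rR hH andbT /= -(radD hS (subvP Rr _ rR)) -?e // (subvP HU).
case=> -[r h]; rewrite !inE /= => /andP[rR /andP[hS' hH]] ->.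
have hU := subvP HU _ hH.
by rewrite (radD hS (subvP Rr _ rR)) // hS' rpredD // (subvP RU).
Qed.

Lemma min_wt_gt0 (r : nat) : (0 < (q + 2) * q ^ r)%N.
Proof. by rewrite muln_gt0 expn_gt0 (ltnW (q_gt1 F)) addn_gt0 orbT. Qed.

(** A radical of dimension above [r] would make [q ^ r.+1] divide the weight, hence q divide 2. *)
Lemma dim_rad_le S U r : (2 < q)%N -> homog S -> wt S U = ((q + 2) * q ^ r)%N ->
  (\dim (rad S U) <= r)%N.
Proof.
move=> q2 hS w; rewrite leqNgt; apply/negP => lr.
have [|H [_ _ HR sU _]] := complement_through (rad_sub U hS) (sub0v U).
  exact: capv0.
have := wt_complement_rad hS (subvv _) HR sU; rewrite w => e.
have : (q ^ r.+1 %| (q + 2) * q ^ r)%N by rewrite e dvdn_mulr // dvdn_exp2l.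
rewrite expnS dvdn_pmul2r ?expn_gt0 ?(ltnW (q_gt1 F)) //.
by rewrite dvdn_addr // => /dvdn_leq -/(_ isT); rewrite leqNgt q2.
Qed.

Lemma wt_complement_line S U H v (m r : nat) : homog S -> v != 0 -> v \in rad S U ->
  (H :&: <[v]> = 0)%VS -> (H + <[v]> = U)%VS -> wt S U = (m * q ^ r.+1)%N ->
  wt S H = (m * q ^ r)%N.
Proof.
move=> hS v0 vr Hv sU w; have := wt_complement_rad hS _ Hv sU.
rewrite -memvE dim_vline v0 expn1 w => /(_ vr).
by rewrite expnS mulnCA => /eqP; rewrite eqn_pmul2l ?(ltnW (q_gt1 F)) // => /eqP.
Qed.

Lemma line_complement U v : v \in U -> v != 0 ->
  exists H, [/\ (H <= U)%VS, (H :&: <[v]> = 0)%VS, (H + <[v]> = U)%VS &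
    \dim U = (\dim H).+1].
Proof.
move=> vU v0; have [||H [_ HU Hv sU dU]] := @complement_through <[v]>%VS 0%VS U _ (sub0v U).
- by rewrite -memvE.
- exact: capv0.
by exists H; split=> //; rewrite dU dim_vline v0 addn1.
Qed.

Lemma capv_line0 H v : v != 0 -> (H :&: <[v]> = 0)%VS -> v \notin H.
Proof.
move=> v0 e; apply: contra v0 => vH.
by rewrite -memv0 -e memv_cap vH memv_line.
Qed.

Lemma notin_capv_line H v : v \notin H -> (H :&: <[v]> = 0)%VS.
Proof.
move=> vH; apply/eqP; rewrite -subv0; apply/subvP => y; rewrite memv_cap memv0.
case/andP=> yW /vlineP[a ya]; rewrite ya in yW *.
have [->|a0] := eqVneq a 0; first by rewrite scale0r.
by move: vH; rewrite -[v](scalerK a0) rpredZ.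
Qed.

(** For a complement [H] of [v], the weight of [H] is that of [U] divided by q, every radical vector
    of [H] is radical for [U = H + <[v]>], and [v] contributes one more dimension. *)
Lemma rad_grow S U r v : homog S -> \dim U = r.+4 -> v != 0 -> v \in rad S U ->
  (forall H, (H <= U)%VS -> \dim H = r.+3 -> wt S U = (q * wt S H)%N ->
    (r <= \dim (rad S H))%N) ->
  (r < \dim (rad S U))%N.
Proof.
move=> hS dU v0 vr IH; have vU : v \in U by have [] := radP _ _ hS vr.
have [H [HU Hv sU dH]] := line_complement vU v0.
have vH := capv_line0 v0 Hv.
have sub : (rad S H + <[v]> <= rad S U)%VS.
  rewrite subv_add -memvE vr andbT; apply/subvP => w wr.
  have wH : w \in H by have [] := radP _ _ hS wr.
  apply/radP => //; split; first exact: subvP wH.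
  rewrite -sU => x /memv_addP[h hH [_ /vlineP[a ->] ->]].
  have avr : a *: v \in rad S U by rewrite rpredZ.
  rewrite addrAC (radD hS avr) ?(radD hS wr) ?(radD hS avr) // ?(subvP HU) //.
  by rewrite rpredD // (subvP HU).
apply: leq_trans (dimvS sub).
rewrite dimv_disjoint_sum ?dim_vline ?v0 ?addn1.
  rewrite ltnS; apply: IH => //; first by move: dH; rewrite dU => -[].
  by rewrite (wt_complement_rad hS _ Hv sU) -?memvE // dim_vline v0 expn1.
by apply/eqP; rewrite -subv0 -Hv capvS // rad_sub.
Qed.

(** The weights of the q + 1 hyperplanes through [W] sum to exactly q + 1 times their lower bound,
    so all the bounds are tight. *)
Lemma all_covers_min S W U r : homog S -> evenset S U -> \dim U = r.+4.+1 ->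
  wt S U = ((q + 2) * q ^ r.+2)%N -> (W <= U)%VS -> \dim W = r.+3 ->
  wt S W = ((q + 2) * q ^ r)%N ->
  forall H, cover W U H -> wt S H = ((q + 2) * q ^ r.+1)%N.
Proof.
move=> hS e dU wU WU dW wW.
have ge H : cover W U H -> ((q + 2) * q ^ r.+1 <= wt S H)%N.
  case/coverP=> WH HU dH; apply: wt_lower => //; first exact: evensetS e.
    by rewrite dH dW.
  by apply: leq_trans (wtS S WH); rewrite wW min_wt_gt0.
have := wt_cover hS WU; rewrite ncov_codim2 ?dU ?dW // wU wW => sw H cH.
have n1 : #|[pred H | cover W U H]| = q.+1.
  by rewrite -(@ncov_codim2 _ _ W U WU) ?dU ?dW // /ncov; apply: eq_card => X; rewrite !inE.
apply: (sum_eq_const ge) cH; rewrite n1.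
by move: sw; rewrite !expnS; move: (q ^ r)%N (\sum_(H | _) _)%N => Z T; nia.
Qed.

(** The [q] other lines through a point of [L] already account for [q] further points. *)
Lemma hyperoval_line_le S U L : homog S -> evenset S U -> \dim U = 3%N ->
  wt S U = (q + 2)%N -> (L <= U)%VS -> \dim L = 2%N -> (wt S L <= 2)%N.
Proof.
move=> hS e dU wU LU dL; have [->//|p] := posnP (wt S L).
have /(wt_gt0P _ hS)[x xS xL] := p.
have x0 := homog_neq0 hS xS; have xU := subvP LU _ xL.
have xU' : (<[x]> <= U)%VS by rewrite -memvE.
have cL : cover <[x]> U L by apply/coverP; rewrite -memvE dim_vline x0.
have [|n1] := wt_cover_but hS xU' cL (k := q).
  by rewrite ncov_codim2 // dim_vline x0.
rewrite wt_line // xS wU.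
have := @sum_ge_const _ (fun i => cover <[x]> U i && (i != L)) (wt S) 2; rewrite n1.
move: (\sum_(i | _) _)%N => T h eT; have {}h : (q * 2 <= T)%N.
  apply: h => M /andP[/coverP[xM MU dM] _].
  by apply: even_line_ge2 e MU _ xS _ => //; rewrite ?memvE // dM dim_vline x0.
by move: h eT; move: #|F| => Q; clear; lia.
Qed.

Lemma dim_span2 x y : y != 0 -> x \notin <[y]>%VS -> \dim (<[x]> + <[y]>) = 2%N.
Proof. by move=> y0 xy; rewrite addvC dim_addline // dim_vline y0. Qed.

Lemma line_through L v : \dim L = 2%N -> v \in L -> v != 0 ->
  exists2 x, x \notin <[v]>%VS & L = (<[x]> + <[v]>)%VS.
Proof.
move=> dL vL v0; have [|x xL xv] := @exists_notin _ _ <[v]> L; first by rewrite dim_vline v0 dL.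
by exists x => //; apply/esym/eqP; rewrite eqEdim subv_add -!memvE xL vL dL dim_span2.
Qed.

(* A [q]-secant line forces every plane through it to carry exactly [2q] points,
   so that each other line through one of its points is a 2-secant; what is left
   of the set in such a plane is then aligned with the hole of the secant. *)
Lemma secant_rad S U L : homog S -> evenset S U -> \dim U = 4%N ->
  wt S U = ((q + 2) * q)%N -> (L <= U)%VS -> \dim L = 2%N -> wt S L = q ->
  exists2 v, v != 0 & v \in rad S U.
Proof.
move=> hS e dU wU LU dL wL.
have q1 := q_gt1 F.
have [v vL [v0 vS]] : exists2 v, v \in L & v != 0 /\ v \notin S.
  have [v /andP[vL /andP[v0 vS]]|none] := pickP [pred v | [&& v \in L, v != 0 & v \notin S]].
    by exists v.
  have := cnt_wt L hS; rewrite wL.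
  have -> : cnt S L = (#|L| - 1)%N.
    rewrite (cardD1 0) mem0v add1n subn1 /=; apply: eq_card => x; rewrite !inE.
    have := none x; rewrite /=; case: (x \in L); rewrite ?andbF ?andbT //=.
    by have [->|_] := eqVneq x 0; [rewrite (negPf (proj1 hS))|case: (x \in S)].
  by rewrite card_vs dL expnS expn1; nia.
have LS x : x \in L -> x \notin <[v]>%VS -> x \in S.
  move=> xL xv; have Le : (<[x]> + <[v]> = L)%VS.
    by apply/eqP; rewrite eqEdim subv_add -!memvE xL vL dL dim_span2.
  have := wt_line2 hS v0 xv; rewrite Le wL (negPf vS) add0n => ec.
  have : [set s : F | x + s *: v \in S] == [set: F] by rewrite eqEcard subsetT cardsT -ec leqnn.
  by move/eqP/setP/(_ 0); rewrite !inE scale0r addr0.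
have wP pi : cover L U pi -> (2 * q <= wt S pi)%N /\
    forall p y, p \in L -> p \in S -> y \in pi -> y \notin L -> wt S pi = (2 * q)%N ->
      wt S (<[y]> + <[p]>) = 2%N.
  case/coverP=> Lpi piU dpi; rewrite dL in dpi.
  have epi : evenset S pi by exact: evensetS e.
  have main p : p \in L -> p \in S -> (2 * q <= wt S pi)%N /\
      forall y, y \in pi -> y \notin L -> wt S pi = (2 * q)%N -> wt S (<[y]> + <[p]>) = 2%N.
    move=> pL pS; have p0 := homog_neq0 hS pS; have ppi := subvP Lpi _ pL.
    have ppi' : (<[p]> <= pi)%VS by rewrite -memvE.
    have cL : cover <[p]> pi L by apply/coverP; rewrite -memvE dim_vline p0.
    have [|n1] := wt_cover_but hS ppi' cL (k := q).
      by rewrite ncov_codim2 // dim_vline p0.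
    rewrite wt_line // pS wL => sw.
    have ge2 M : cover <[p]> pi M && (M != L) -> (2 <= wt S M)%N.
      case/andP=> /coverP[pM Mpi dM] _.
      by apply: even_line_ge2 epi Mpi _ pS _ => //; rewrite ?memvE // dM dim_vline p0.
    split.
      move: (sum_ge_const ge2) sw; rewrite n1; move: (\sum_(i | _) _)%N => T.
      by move: #|F| => Q; clear; lia.
    move=> y ypi yL wpi.
    have yp : y \notin <[p]>%VS.
      by apply: contra yL => /vlineP[a ->]; rewrite rpredZ.
    have cM : cover <[p]> pi (<[y]> + <[p]>)%VS && ((<[y]> + <[p]>)%VS != L).
      rewrite addvC cover_line //=; apply: contra yL => /eqP <-.
      by rewrite memvE addvSr.
    apply: (sum_eq_const ge2) cM; rewrite n1; move: sw; rewrite wpi.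
    by move: (\sum_(i | _) _)%N => T; move: #|F| => Q; clear; lia.
  have /(wt_gt0P _ hS)[p pS pL] : (0 < wt S L)%N by rewrite wL; lia.
  split=> [|p' y p'L p'S]; first by case: (main p pL pS).
  by case: (main p' p'L p'S) => _; exact.
have wpi pi : cover L U pi -> wt S pi = (2 * q)%N.
  move=> cpi; apply/eqP; rewrite eqn_leq (wP _ cpi).1 andbT.
  have [|n1] := wt_cover_but hS LU cpi (k := q); first by rewrite ncov_codim2 // dU dL.
  rewrite wU wL.
  have ge M : cover L U M && (M != pi) -> (2 * q <= wt S M)%N by case/andP=> /wP[].
  move: (sum_ge_const ge); rewrite n1; move: (\sum_(i | _) _)%N => T.
  by move: #|F| => Q; clear; lia.
exists v => //.
have step (w : V) y : w \in <[v]>%VS -> y \in U -> y \in S -> y + w \in S.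
  move=> wv yU yS; have [yL|yL] := boolP (y \in L).
    have wL' : w \in L by apply: subvP wv; rewrite -memvE.
    apply: LS; first by rewrite rpredD.
    apply/negP => /vlineP[a ea]; have : y \in <[v]>%VS.
      by rewrite -[y](addrK w) ea rpredB // memvZ // memv_line.
    case/vlineP=> b eb; have := homog_neq0 hS yS; move: yS.
    by rewrite eb scaler_eq0 negb_or => bS /andP[b0 _]; rewrite homogZ // (negPf vS) in bS.
  set pi := (L + <[y]>)%VS; have cpi : cover L U pi by exact: cover_line.
  have ypi : y \in pi by rewrite memvE addvSr.
  have [Lpi _ dpi] := coverP _ _ _ cpi.
  have := wt_affine hS Lpi dpi ypi yL.
  rewrite wpi // wL mul2n -addnn => /addnI/esym cA.
  (* For [h] off [<[v]>], [y + h] would be a third point on the 2-secant through [y] and [h]. The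
     [q] vectors counted in [cA] thus fill [<[v]>]. *)
  have sub : [set h in L | y + h \in S] \subset [set h in <[v]>%VS].
    apply/subsetP => h; rewrite !inE => /andP[hL hy]; apply/negPn/negP => hv.
    have hS' := LS _ hL hv; have h0 := homog_neq0 hS hS'.
    have yh : y \notin <[h]>%VS by apply: contra yL => /vlineP[a ->]; rewrite rpredZ.
    have := (wP _ cpi).2 _ _ hL hS' ypi yL (wpi _ cpi).
    rewrite wt_line2 // hS' => -[].
    rewrite (cardD1 0) inE scale0r addr0 yS (cardD1 1) !inE scale1r hy oner_eq0.
    by [].
  have : [set h in L | y + h \in S] == [set h in <[v]>%VS].
    rewrite eqEcard sub cA cardsE card_vs dim_vline v0 expn1; exact: leqnn.
  by move/eqP/setP/(_ w); rewrite !inE wv => /andP[].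
apply/radP => //; split; first exact: subvP vL.
move=> x xU; apply/idP/idP; last by apply: step => //; exact: memv_line.
move=> h; rewrite -[x](addrK v); apply: step => //; last by rewrite rpredD // (subvP LU).
by rewrite memvN memv_line.
Qed.

(** When [y] is in [S], the line through [x] and [y] is a q-secant and [x + a *: y] is its only
    hole. *)
Definition good_line S x y := exists2 a, a != 0 & forall s, (x + s *: y \in S) = (s != a).

Lemma good_lineZ S x y b : b != 0 -> good_line S x (b *: y) -> good_line S x y.
Proof.
move=> b0 [a a0 ha]; exists (a * b) => [|s]; first by rewrite mulf_neq0.
rewrite -{1}[s](divfK b0) -scalerA ha; congr negb.
by rewrite -(inj_eq (mulIf b0)) divfK.
Qed.

(** * Minimum sets in PG(4,q): a radical vector of one solid is radical for the whole set *)

Section DimFive.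
Variables (S : {set V}) (U H0 : {vspace V}) (v0 : V).
Hypotheses (q2 : (2 < q)%N) (hS : homog S) (e : evenset S U) (dU : \dim U = 5%N).
Hypotheses (wU : wt S U = ((q + 2) * q ^ 2)%N).
Hypotheses (HU : (H0 <= U)%VS) (dH : \dim H0 = 4%N) (wH : wt S H0 = ((q + 2) * q ^ 1)%N).
Hypotheses (v00 : v0 != 0) (v0r : v0 \in rad S H0).
Hypothesis IH : forall H, (H <= U)%VS -> \dim H = 4%N -> wt S H = ((q + 2) * q ^ 1)%N ->
  (0 < \dim (rad S H))%N.

Let v0H : v0 \in H0. Proof. by have [] := radP _ _ hS v0r. Qed.

Lemma S_notin_v0 y : y \in S -> y \notin <[v0]>%VS.
Proof. by apply: notin_line => //; exact: rad_notin v0r. Qed.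

(** The planes of the solid [H0] not through the vertex [v0]; they meet [S] in hyperovals. *)
Definition compl W := [&& (W <= H0)%VS, \dim W == 3%N & v0 \notin W].

Lemma compl_wt W : compl W -> wt S W = (q + 2)%N.
Proof.
case/and3P=> WH /eqP dW vW; rewrite -[RHS]muln1 -(expn0 q).
apply: (wt_complement_line hS v00 v0r (notin_capv_line vW)) => //.
by apply/eqP; rewrite eqEdim subv_add WH -memvE v0H dim_addline // dW dH.
Qed.

Lemma compl_exists B : (B <= H0)%VS -> v0 \notin B ->
  exists2 W, compl W & (B <= W)%VS.
Proof.
move=> BH vB; have [||W [BW WH Wv _ dW]] := @complement_through <[v0]>%VS B H0 _ BH.
- by rewrite -memvE.
- by rewrite capvC notin_capv_line.
exists W => //; rewrite /compl WH (capv_line0 v00 Wv) andbT /=.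
by move: dW; rewrite dH dim_vline v00 addn1 => -[<-].
Qed.

(** The solid on [W] and [x] is again minimum, so it has a radical vector. This is not in [W], where
    [S] is a hyperoval with zero radical, and can be scaled to [x + r], the hole of a q-secant
    through [x] and [r]. A q-secant through [x] and a point [y] of [W] that avoided [x + r] would
    lie in a plane avoiding it, and in such a plane [S] is a hyperoval. *)
Lemma compl_rad W x : compl W -> x \in U -> x \notin H0 -> x \in S ->
  exists r, [/\ r \in W, r \in S, good_line S x r &
    forall y, y \in W -> y \in S -> good_line S x y -> exists2 a, a != 0 & r = a *: y].
Proof.
move=> cW xU xH xS; have [WH /eqP dW vW] := and3P cW.
have WU := subv_trans WH HU; have xW : x \notin W by apply: contra xH; exact: subvP.
have cX := cover_line WU xU xW.
set X := (W + <[x]>)%VS in cX; have [WX XU dX] := coverP _ _ _ cX.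
have wX : wt S X = ((q + 2) * q ^ 1)%N.
  by apply: (all_covers_min hS e dU wU WU dW _ cX); rewrite compl_wt // muln1.
have eX : evenset S X by exact: evensetS e.
rewrite dW in dX.
have [v vr vn] : exists2 v, v \in rad S X & v != 0.
  have := IH XU dX wX; rewrite lt0n dimv_eq0 -vpick0 => n0.
  by exists (vpick (rad S X)) => //; exact: memv_pick.
have vW' : v \notin W.
  apply/negP => vinW; have : (0 < \dim (rad S W))%N.
    rewrite lt0n dimv_eq0; apply/negP => /eqP r0.
    by have := rad_cap hS WX vr vinW; rewrite r0 memv0 (negPf vn).
  by rewrite ltnNge (dim_rad_le q2 hS (r := 0)) // compl_wt // muln1.
have vX : v \in X by have [] := radP _ _ hS vr.
have [r rW xr] : exists2 r, r \in W & x + r \in rad S X.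
  case/memv_addP: vX => w wW [_ /vlineP[b ->] ev].
  have b0 : b != 0 by apply: contraNneq vW' => b0; rewrite ev b0 scale0r addr0.
  exists (b^-1 *: w); first by rewrite rpredZ.
  by rewrite -[x](scalerK b0) -scalerDr rpredZ // addrC -ev.
have xX : x \in X by rewrite memvE addvSr.
have rX := subvP WX _ rW.
have line s t : (s *: r + t *: (x + r) \in S) = (s *: r \in S).
  by rewrite (radD (v := t *: (x + r)) hS (memvZ _ xr)) // rpredZ.
have rS : r \in S.
  have := line (-1) 1; rewrite scale1r scaleN1r addrC addrK xS => /esym.
  by rewrite -scaleN1r homogZ // oppr_eq0 oner_eq0.
have gr : good_line S x r.
  exists 1; rewrite ?oner_eq0 // => s.
  have -> : x + s *: r = (s - 1) *: r + 1 *: (x + r).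
    by rewrite scale1r scalerBl scale1r addrCA subrK.
  rewrite line; have [->|s1] := eqVneq s 1.
    by rewrite subrr scale0r (negPf (proj1 hS)).
  by rewrite homogZ // subr_eq0.
exists r; split=> // y yW yS [a a0 ha].
have y0 := homog_neq0 hS yS.
have xy : x \notin <[y]>%VS by apply: contra xW => /vlineP[b ->]; rewrite rpredZ.
have [xrL|xrL] := boolP (x + r \in (<[x]> + <[y]>)%VS).
  case/memv_addP: xrL => _ /vlineP[b ->] [_ /vlineP[c ->] ec].
  have b1 : b = 1.
    apply/eqP; rewrite -subr_eq0; apply: contraNT xW => d.
    rewrite -[x](scalerK d) rpredZ //.
    have -> : (b - 1) *: x = r - c *: y.
      by rewrite scalerBl scale1r; apply/eqP; rewrite subr_eq addrAC eq_sym subr_eq addrC ec.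
    by rewrite rpredB // rpredZ.
  have rc : r = c *: y by move: ec; rewrite b1 scale1r => /addrI.
  exists c => //; apply: contraTneq (homog_neq0 hS rS) => c0.
  by rewrite rc c0 scale0r eqxx.
have xr0 : x + r != 0 by apply: contraNneq xrL => ->; rewrite mem0v.
have yX := subvP WX _ yW.
have [|||W'' [LW W''X Wxr sX dW'']] := @complement_through <[x + r]>%VS (<[x]> + <[y]>)%VS X.
- by rewrite -memvE rpredD.
- by rewrite subv_add -!memvE xX.
- by rewrite capvC notin_capv_line.
have wW'' : wt S W'' = ((q + 2) * q ^ 0)%N.
  exact: (wt_complement_line hS xr0 xr Wxr sX).
have dW3 : \dim W'' = 3%N by move: dW''; rewrite dX dim_vline xr0 addn1 => -[].
have eW : evenset S W'' by exact: evensetS eX.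
rewrite muln1 in wW''.
have := hyperoval_line_le hS eW dW3 wW'' LW (dim_span2 y0 xy).
rewrite wt_line2 // yS.
have -> : [set s | x + s *: y \in S] = [set~ a] by apply/setP => s; rewrite !inE ha.
by rewrite cardsC1 add1n prednK ?(ltnW (q_gt1 F)) // leqNgt q2.
Qed.

(** A plane through [y] off [v0] supplies a q-secant from [x] to some [r']. If [v0] is not on the
    line of [r] and [r'], a plane off [v0] through both and the uniqueness in [compl_rad] make them
    proportional, which leaves [t = 0]. Otherwise [r'] is on the line of [r] and [v0], which meets
    the plane only in [y]. *)
Lemma good_pencil x r t : x \in U -> x \notin H0 -> x \in S -> r \in H0 -> r \in S ->
  good_line S x r -> good_line S x (r + t *: v0).
Proof.
move=> xU xH xS rH rS gr; have rv := S_notin_v0 rS.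
set y := r + t *: v0.
have yH : y \in H0 by rewrite rpredD ?rpredZ.
have vy z : z \in H0 -> z \notin <[v0]>%VS -> v0 \notin <[z]>%VS.
  move=> zH zv; apply: contra zv => /vlineP[b eb].
  have b0 : b != 0 by apply: contraNneq v00 => b0; rewrite eb b0 scale0r.
  by rewrite -[z](scalerK b0) -eb rpredZ // memv_line.
have yv : y \notin <[v0]>%VS.
  apply: contra rv => yv; rewrite -[r](addrK (t *: v0)) rpredB //.
  by rewrite rpredZ // memv_line.
have [W cW yW] : exists2 W, compl W & y \in W.
  have [||W cW sW] := @compl_exists <[y]>%VS; rewrite -?memvE //; first exact: vy.
  by exists W => //; rewrite memvE.
have [r' [r'W r'S gr' _]] := compl_rad cW xU xH xS.
have [WH _ vW] := and3P cW.
have r'H := subvP WH _ r'W; have r'0 := homog_neq0 hS r'S.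
have [vr|vr] := boolP (v0 \in (<[r]> + <[r']>)%VS); last first.
  have [|W2 cW2 sW2] := compl_exists _ vr; first by rewrite subv_add -!memvE rH.
  have [s [sW sS gs us]] := compl_rad cW2 xU xH xS.
  have [a a0 ea] := us _ (subvP sW2 _ (subvP (addvSl _ _) _ (memv_line r))) rS gr.
  have [b b0 eb] := us _ (subvP sW2 _ (subvP (addvSr _ _) _ (memv_line r'))) r'S gr'.
  have rW : r \in W by rewrite -[r](scalerK a0) -ea eb !rpredZ.
  have : t *: v0 \in W by rewrite -[t *: v0](addKr r) addrC rpredB.
  have [t0 _|t0] := eqVneq t 0; first by rewrite /y t0 scale0r addr0.
  by move=> tv; move: vW; rewrite -[v0](scalerK t0) rpredZ.
case/memv_addP: vr => _ /vlineP[al ->] [_ /vlineP[be ->] ev].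
have be0 : be != 0.
  by apply: contra (vy _ rH rv) => /eqP b0; rewrite ev b0 scale0r addr0 memvZ // memv_line.
have al0 : al != 0.
  by apply: contra (vy _ r'H (S_notin_v0 r'S)) => /eqP b0; rewrite ev b0 scale0r add0r memvZ // memv_line.
pose a := - (al / be); have a0 : a != 0 by rewrite oppr_eq0 mulf_neq0 ?invr_eq0.
have er' : r' = a *: r + be^-1 *: v0.
  rewrite ev scalerDr !scalerA mulVf // scale1r addrA -scalerDl.
  by rewrite /a mulrC addNr scale0r add0r.
have ez : r' - a *: y = (be^-1 - a * t) *: v0.
  by rewrite er' /y scalerDr scalerA scalerBl opprD addrACA subrr add0r.
have z0 : be^-1 - a * t = 0.
  apply/eqP; apply: contraNT vW => d.
  by rewrite -[v0](scalerK d) -ez rpredZ // rpredB // rpredZ.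
move: ez; rewrite z0 scale0r => /eqP; rewrite subr_eq0 => /eqP r'y.
by apply: (good_lineZ a0); rewrite -r'y.
Qed.

(* If [x + v0] were not in [S], all other points of the lines through it in the
   plane of [x], [r] and [v0] would be, and these lines would miss a zero. *)
Lemma shift_in x : x \in U -> x \notin H0 -> x \in S -> x + v0 \in S.
Proof.
move=> xU xH xS.
have [|W cW _] := @compl_exists 0%VS (sub0v _); first by rewrite memv0.
have [r [rW rS gr _]] := compl_rad cW xU xH xS.
have [WH _ _] := and3P cW; have rH := subvP WH _ rW.
apply/negPn/negP => xv.
have rtS t : r + t *: v0 \in S.
  by rewrite (radD (v := t *: v0) hS (memvZ _ v0r)).
have rtH t : r + t *: v0 \in H0 by rewrite rpredD ?rpredZ.
have all t s : s != 0 -> x + v0 + s *: (r + t *: v0) \in S.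
  move=> s0; set y := r + t *: v0.
  (* If the line through [x + v0] and [y] has a further point [x'] of [S], then [x'] also lies on
     the good line from [x] to some [y'] on the line of [r] and [v0]. That line is good seen from
     [x'], and moving [y'] back to [y] by [good_pencil] makes the original line good. Otherwise [y]
     is its only point of [S], against evenness. *)
  have [s' /andP[s'0 s'S]|none] := pickP [pred s | (s != 0) && (x + v0 + s *: y \in S)].
    set x' := x + v0 + s' *: y in s'S.
    pose y' := r + (t + s'^-1) *: v0.
    have ex' : x' = x + s' *: y'.
      rewrite /x' /y' /y -addrA; congr (_ + _).
      by rewrite !scalerDr !scalerA mulrDr divff // scalerDl scale1r addrC -addrA.
    have y'H : y' \in H0 by exact: rtH.
    have x'U : x' \in U by rewrite ex' rpredD // rpredZ // (subvP HU).
    have x'H : x' \notin H0.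
      apply: contra xH => x'H; have -> : x = x' - s' *: y' by rewrite ex' addrK.
      by rewrite rpredB // rpredZ.
    have gy' : good_line S x' y'.
      have [a a0 ha] := good_pencil (t + s'^-1) xU xH xS rH rS gr.
      exists (a - s') => [|u].
        by rewrite subr_eq0 eq_sym -ha -/y' -ex'.
      by rewrite ex' -addrA -scalerDl ha; congr negb; rewrite addrC [RHS]eq_sym subr_eq eq_sym.
    have gy : good_line S x' y.
      have -> : y = y' + (- s'^-1) *: v0.
        by rewrite /y /y' scalerDl addrA scaleNr addrK.
      exact: (good_pencil (- s'^-1) x'U x'H s'S y'H (rtS _) gy').
    have [a a0 ha] := gy.
    have xvE u : x + v0 + u *: y = x' + (u - s') *: y.
      by rewrite /x' -[RHS]addrA -scalerDl [s' + _]addrC subrK.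
    rewrite xvE ha; have := xvE 0; rewrite scale0r addr0 => e0.
    move: xv; rewrite e0 ha negbK => /eqP <-.
    by rewrite (inj_eq (addIr _)).
  have y0 : y != 0 by exact: homog_neq0 hS (rtS t).
  have xy : x + v0 \notin <[y]>%VS.
    apply: contra xH => xy; rewrite -[x](addrK v0) rpredB //.
    by apply: subvP xy; rewrite -memvE; exact: rtH.
  have LU : (<[x + v0]> + <[y]> <= U)%VS.
    by rewrite subv_add -!memvE rpredD ?(subvP HU _ v0H) // (subvP HU _ (rtH t)).
  have := e LU (dim_span2 y0 xy); rewrite wt_line2 // rtS.
  have -> : [set s | x + v0 + s *: y \in S] = set0.
    apply/setP => u; rewrite !inE; have [->|u0] := eqVneq u 0.
      by rewrite scale0r addr0 (negPf xv).
    by have := none u; rewrite /= u0.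
  by rewrite cards0.
(* The hole of the line through [x] and [r] lies on one of the lines just treated, so it would be in
   [S]. *)
have [a a0 ha] := gr.
have := all (- a^-1) _ a0.
have -> : x + v0 + a *: (r + (- a^-1) *: v0) = x + a *: r.
  by rewrite scalerDr scalerA mulrN divff // scaleN1r addrACA addrN addr0.
by rewrite ha eqxx.
Qed.

End DimFive.

Lemma dim5_rad S U H0 v0 : (2 < q)%N -> homog S -> evenset S U -> \dim U = 5%N ->
  wt S U = ((q + 2) * q ^ 2)%N -> (H0 <= U)%VS -> \dim H0 = 4%N ->
  wt S H0 = ((q + 2) * q ^ 1)%N -> v0 != 0 -> v0 \in rad S H0 ->
  (forall H, (H <= U)%VS -> \dim H = 4%N -> wt S H = ((q + 2) * q ^ 1)%N ->
     (0 < \dim (rad S H))%N) ->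
  v0 \in rad S U.
Proof.
move=> q2 hS e dU wU HU dH wH v00 v0r IH.
have v0H : v0 \in H0 by have [] := radP _ _ hS v0r.
apply/radP => //; split; first exact: subvP v0H.
move=> x xU; have [xH|xH] := boolP (x \in H0); first exact: radD v0r xH.
have xvU : x + v0 \in U by rewrite rpredD // (subvP HU).
apply/idP/idP => [xvS|]; last exact: (shift_in q2 hS e dU wU HU dH wH v00 v0r IH).
rewrite -[x](addrK v0).
apply: (shift_in (v0 := - v0) q2 hS e dU wU HU dH wH _ _ IH) => //; rewrite ?oppr_eq0 ?rpredN //.
by apply: contra xH => h; rewrite -[x](addrK v0) rpredB.
Qed.

(* The hypothesis is the case [r = 1], the only one that depends on the value of [q]. *)
Theorem min_rad S U r : (2 < q)%N ->
  (forall U', (U' <= U)%VS -> \dim U' = 4%N -> wt S U' = ((q + 2) * q)%N ->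
     exists2 v, v != 0 & v \in rad S U') ->
  homog S -> evenset S U -> \dim U = r.+3 -> wt S U = ((q + 2) * q ^ r)%N ->
  \dim (rad S U) = r.
Proof.
move=> q2 base hS e dU wU; apply/eqP; rewrite eqn_leq (dim_rad_le q2 hS wU) /=.
elim/ltn_ind: r U base e dU wU => -[//|r] IH U base e dU wU.
have IHs s W : (s <= r)%N -> (W <= U)%VS -> \dim W = s.+3 ->
    wt S W = ((q + 2) * q ^ s)%N -> (s <= \dim (rad S W))%N.
  move=> sr WU dW wW; apply: (IH s) => //; last exact: evensetS e.
  by move=> U' U'W; apply: base; exact: subv_trans WU.
have grow v : v != 0 -> v \in rad S U -> (r < \dim (rad S U))%N.
  move=> v0 vr; apply: rad_grow v0 vr _ => // H HU dH; rewrite wU expnS mulnCA => /eqP.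
  rewrite eqn_pmul2l ?(ltnW (q_gt1 F)) // eq_sym => /eqP wH; exact: IHs wH.
case: r => [|r] in IH IHs dU wU grow *.
  by have [v v0 vr] := base U (subvv _) dU wU; exact: grow v0 vr.
have [H0 [HU dH wH]] := min_hyperplane hS e dU wU.
have [v0 vr v00] : exists2 v, v \in rad S H0 & v != 0.
  have := IHs _ _ (leqnn _) HU dH wH => /(leq_trans (ltn0Sn r)).
  rewrite lt0n dimv_eq0 -vpick0 => n0.
  by exists (vpick (rad S H0)) => //; exact: memv_pick.
have vH : v0 \in H0 by have [] := radP _ _ hS vr.
case: r => [|r] in IH IHs dU wU grow dH wH *.
  apply: (grow v0) => //; apply: (dim5_rad q2 hS e dU wU HU dH wH v00 vr).
  by move=> H HU' dH' wH'; exact: (IHs 1%N H).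
have [W [WH Wv sH dW]] := line_complement vH v00.
have WU := subv_trans WH HU.
have wW := wt_complement_line hS v00 vr Wv sH wH.
have {}dW : \dim W = r.+1.+3 by move: dW; rewrite dH => -[].
have rW := IHs _ _ (leqnSn _) WU dW wW.
(* The radical of [H] is larger by one than the radical of [W] can be, so it meets the hyperplane
   [W] of [H] in a subspace of the full dimension of [rad S W]. *)
have subR H : cover W U H -> (rad S W <= rad S H)%VS.
  move=> cH; have [WH' HU' dH'] := coverP _ _ _ cH; rewrite dW in dH'.
  have wH' := all_covers_min hS e dU wU WU dW wW cH.
  have rH := IHs _ _ (leqnn _) HU' dH' wH'.
  have sub : (rad S H :&: W <= rad S W)%VS.
    by apply/subvP => v; rewrite memv_cap => /andP[vh vw]; exact: (rad_cap hS WH' vh vw).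
  suff -> : rad S W = (rad S H :&: W)%VS by exact: capvSl.
  apply/esym/eqP; rewrite eqEdim sub /=.
  have := dimv_sum_cap (rad S H) W.
  have : (\dim (rad S H + W) <= \dim H)%N by apply: dimvS; rewrite subv_add rad_sub.
  have := dim_rad_le q2 hS wW.
  by rewrite dH' dW; lia.
have [v vrW vn] : exists2 v, v \in rad S W & v != 0.
  move: rW => /(leq_trans (ltn0Sn r)).
  rewrite lt0n dimv_eq0 -vpick0 => n0.
  by exists (vpick (rad S W)) => //; exact: memv_pick.
apply: (grow v) => //; have vW : v \in W by have [] := radP _ _ hS vrW.
apply/radP => //; split; first exact: subvP vW.
move=> x xU; have [xW|xW] := boolP (x \in W); first exact: radD vrW xW.
have cX := cover_line WU xU xW.
by rewrite (radD hS (subvP (subR _ cX) _ vrW)) // memvE addvSr.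
Qed.

End Radical.

(** * Solids for q = 4 and q = 8 *)

Lemma pigeonhole3 (I J : finType) (B : {set I}) (C : {set J}) (f : I -> J) :
  (forall i, i \in B -> f i \in C) -> (#|C| * 2 < #|B|)%N ->
  exists2 j, j \in C & (2 < #|[set i in B | f i == j]|)%N.
Proof.
move=> fC lt.
have [j /andP[jC gt]|none] := pickP [pred j | (j \in C) && (2 < #|[set i in B | f i == j]|)%N].
  by exists j.
suff : (#|B| <= #|C| * 2)%N by rewrite leqNgt lt.
rewrite -sum1_card (partition_big f (mem C)) //= -sum_nat_const; apply: leq_sum => j jC.
rewrite sum1dep_card leqNgt; have := none j; rewrite /= jC /= => h.
by rewrite h.
Qed.

Section SecantLines.
Variables (F : finFieldType) (N : nat).
Local Notation V := 'rV[F]_N.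
Local Notation q := #|F|.
Implicit Types (S : {set V}) (U W H L M P A pi al be ga : {vspace V}) (x y v : V).

Lemma cover_card W U k : ncov W U = k -> #|[pred W' | cover W U W']| = k.
Proof. by move=> <-; apply: eq_card => W'; rewrite !inE. Qed.

Lemma wt_le_line S L : homog S -> \dim L = 2%N -> (wt S L <= q + 1)%N.
Proof.
move=> hS dL; have q1 := q_gt1 F.
have le : (wt S L * (q - 1) <= q ^ 2 - 1)%N.
  rewrite -cnt_wt // -dL -card_vs (cardD1 0) mem0v addKn; apply: subset_leq_card.
  apply/subsetP => x; rewrite !inE => /andP[xS xL]; rewrite xL andbT.
  exact: homog_neq0 hS xS.
rewrite -(leq_pmul2r (m := q - 1)) ?subn_gt0 //; apply: leq_trans le _.
by clear -q1; move: #|F| q1 => Q; rewrite expnS expn1; nia.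
Qed.

(** If the 21 lines through [x] were all 2-secants, there would be 22 points instead of 24. A line
    with more than 2 points has exactly 4, so it is a q-secant. *)
Lemma secant_rad4 S U : q = 4%N -> homog S -> evenset S U -> \dim U = 4%N ->
  wt S U = ((q + 2) * q)%N -> exists2 v, v != 0 & v \in rad S U.
Proof.
move=> q4 hS e dU wU.
have /(wt_gt0P _ hS)[x xS xU] : (0 < wt S U)%N by rewrite wU q4.
have x0 := homog_neq0 hS xS; have xU' : (<[x]> <= U)%VS by rewrite -memvE.
have dx : \dim <[x]> = 1%N by rewrite dim_vline x0.
have n21 : ncov <[x]> U = 21%N by rewrite ncov_codim3 ?dU ?dx // q4.
have [L /andP[/coverP[xL LU dL] lt]|none] := pickP [pred L | cover <[x]> U L && (2 < wt S L)%N].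
  rewrite dx in dL; apply: (secant_rad hS e dU wU LU dL).
  have := wt_le_line hS dL; have := e L LU dL; rewrite q4; move: lt.
  by move: (wt S L) => [|[|[|[|[|[|]]]]]].
have := wt_cover hS xU'; rewrite n21 wt_line // xS wU q4.
have le L : cover <[x]> U L -> (wt S L <= 2)%N.
  by move=> c; have := none L; rewrite /= c /= => h; rewrite leqNgt h.
have : (\sum_(L | cover <[x]> U L) wt S L <= 21 * 2)%N.
  rewrite -(cover_card n21) -sum_nat_const; exact: leq_sum.
by move: (\sum_(i | _) _)%N => T; clear; lia.
Qed.

(** * Solids over the field with 8 elements: excluding sets without 8-secants *)

Section Eight.
Variables (S : {set V}) (U : {vspace V}).
Hypotheses (q8 : q = 8%N) (hS : homog S) (e : evenset S U) (dU : \dim U = 4%N).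
Hypothesis wU : wt S U = 80%N.
Hypothesis no8 : forall L, (L <= U)%VS -> \dim L = 2%N -> wt S L != 8%N.

Let dimpt x : x \in S -> \dim <[x]> = 1%N.
Proof. by move=> xS; rewrite dim_vline (homog_neq0 hS xS). Qed.

Let cover_pt x pi L : x \in S -> cover <[x]> pi L = [&& x \in L, (L <= pi)%VS & \dim L == 2%N].
Proof. by move=> xS; rewrite /cover /= -memvE dimpt. Qed.

Let ncov_pi x pi : x \in S -> x \in pi -> \dim pi = 3%N -> ncov <[x]> pi = 9%N.
Proof. by move=> xS xpi d; rewrite ncov_codim2 -?memvE ?dimpt // q8. Qed.

Let ncov_line L : (L <= U)%VS -> \dim L = 2%N -> ncov L U = 9%N.
Proof. by move=> LU d; rewrite ncov_codim2 ?dU ?d // q8. Qed.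

Let ge2 x L : x \in S -> x \in L -> (L <= U)%VS -> \dim L = 2%N -> (2 <= wt S L)%N.
Proof. by move=> xS xL LU dL; apply: even_line_ge2 e LU dL xS xL. Qed.

Lemma two_secant_step x y : x \in S -> y \in S -> x \notin <[y]>%VS ->
  wt S (<[x]> + <[y]>) = 2%N -> x + y \notin S.
Proof.
move=> xS yS xy; rewrite wt_line2 ?(homog_neq0 hS yS) // yS => -[c1].
apply/negP => h; have : (1 < #|[set s : F | (x + s *: y)%R \in S]|)%N.
  apply/card_gt1P; exists 0, 1; rewrite !inE scale0r addr0 scale1r xS h eq_sym oner_eq0.
  by [].
by rewrite -[#|_|]add0n c1.
Qed.

(** The 8 other lines of the plane through a point of [L] each bring a new point. In case of
    equality they are all 2-secants, so the sum of representatives of two points on such a line is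
    not in [S]. *)
Lemma plane_ge L pi : (L <= pi)%VS -> (pi <= U)%VS -> \dim L = 2%N -> \dim pi = 3%N ->
  (0 < wt S L)%N -> (wt S L + 8 <= wt S pi)%N /\
  (wt S pi = (wt S L + 8)%N -> forall x y, x \in S -> x \in L -> y \in S -> y \in pi ->
     y \notin L -> y + x \notin S).
Proof.
move=> Lpi piU dL dpi p.
have main x : x \in S -> x \in L -> (wt S L + 8 <= wt S pi)%N /\
  (wt S pi = (wt S L + 8)%N -> forall y, y \in S -> y \in pi ->
     y \notin L -> y + x \notin S).
  move=> xS xL; have xpi := subvP Lpi _ xL.
  have xpi' : (<[x]> <= pi)%VS by rewrite -memvE.
  have cL : cover <[x]> pi L by rewrite cover_pt // xL Lpi dL.
  have [n1] := wt_cover_but hS xpi' cL (ncov_pi xS xpi dpi).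
  rewrite wt_line ?(homog_neq0 hS xS) // xS muln1 => sw.
  have ge M : cover <[x]> pi M && (M != L) -> (2 <= wt S M)%N.
    rewrite cover_pt // => /andP[/and3P[xM Mpi /eqP dM] _].
    exact: ge2 xS xM (subv_trans Mpi piU) dM.
  split.
    by move: (sum_ge_const ge) sw; rewrite n1; move: (\sum_(i | _) _)%N => T; clear; lia.
  move=> wpi y yS ypi yL.
  have yx : y \notin <[x]>%VS by apply: contra yL => /vlineP[a ->]; rewrite rpredZ.
  apply: two_secant_step => //.
  have cM : cover <[x]> pi (<[y]> + <[x]>)%VS && ((<[y]> + <[x]>)%VS != L).
    rewrite addvC cover_line //=; apply: contra yL => /eqP <-.
    by rewrite memvE addvSr.
  apply: (sum_eq_const ge) cM; rewrite n1; move: sw; rewrite wpi.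
  by move: (\sum_(i | _) _)%N => T; clear; lia.
have /(wt_gt0P _ hS)[x0 x0S x0L] := p.
by split=> [|h x y xS xL]; [case: (main _ x0S x0L)|apply: (main x xS xL).2].
Qed.

(** The nine planes on a 6-secant weigh 128 in total, so one of them weighs 14. Its 8 points off [L]
    give a set [B] of vectors of [L] whose differences all point to the 3 holes of [L]. Three of the
    7 nonzero elements point to the same hole [P]. If all of [B] is in [P], there is an 8-secant.
    Otherwise, for [z] in [B] off [P] and two elements [u], [u'] in [P], both [z - u] and [z - u']
    must point to the hole other than [P] and [<[z]>], and then so does [u' - u], which lies in
    [P]. *)
Lemma no_six L : (L <= U)%VS -> \dim L = 2%N -> wt S L != 6%N.
Proof.
move=> LU dL; apply/eqP => w6.
have [pi /andP[cpi /eqP w14]|none] := pickP [pred pi | cover L U pi && (wt S pi == 14%N)]; last first.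
  have ge pi : cover L U pi -> (15 <= wt S pi)%N.
    move=> c; have [Lpi piU dpi] := coverP _ _ _ c; rewrite dL in dpi.
    have := (plane_ge Lpi piU dL dpi _).1; rewrite w6 => /(_ isT).
    by rewrite leq_eqVlt => /orP[/eqP w|//]; have := none pi; rewrite /= c -w.
  have := wt_cover hS LU; rewrite ncov_line // wU w6.
  have := sum_ge_const ge; rewrite (cover_card (ncov_line LU dL)).
  by move: (\sum_(i | _) _)%N => T; clear; lia.
have [Lpi piU dpi] := coverP _ _ _ cpi; have dpi3 := dpi; rewrite dL in dpi3.
have [|_ step] := plane_ge Lpi piU dL dpi3; first by rewrite w6.
have {}step x y : x \in S -> x \in L -> y \in S -> y \in pi -> y \notin L -> y + x \notin S.
  by apply: step; rewrite w6.
have [|y yS [ypi yL]] := @wt_lt_exists _ _ S L pi hS; first by rewrite w14 w6.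
have := wt_affine hS Lpi dpi ypi yL; rewrite w14 w6.
set B := [set h in L | y + h \in S] => /esym/eqP; rewrite -[14%N]/(6 + 8)%N eqn_add2l => /eqP cB.
have B0 : 0 \in B by rewrite inE mem0v addr0.
have BL h : h \in B -> h \in L by rewrite inE => /andP[].
have diff h h' : h \in B -> h' \in B -> h' - h \notin S.
  rewrite !inE => /andP[hL hS'] /andP[h'L h'S]; apply/negP => d.
  have := step (h' - h) (y + h) d (rpredB h'L hL) hS'.
  rewrite addrACA subrr addr0 h'S.
  have -> : y + h \in pi by rewrite rpredD // (subvP Lpi).
  have -> : y + h \notin L by apply: contra yL => yh; rewrite -[y](addrK h) rpredB.
  by move=> /(_ isT isT).
pose hole := [set P : {vspace V} | [&& cover 0 L P & vpick P \notin S]].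
have chole : #|hole| = 3%N.
  have n9 : ncov 0 L = 9%N by rewrite ncov_codim2 ?sub0v ?dimv0 ?dL // q8.
  have := n9; rewrite /ncov -(cardsID [set P | vpick P \in S]).
  have -> : #|[set W' | cover 0 L W'] :&: [set P | vpick P \in S]| = 6%N.
    rewrite -[RHS]w6 /wt; apply: eq_card => P.
    by rewrite !inE /cover /= sub0v dimv0 /= [(P <= L)%VS && _]andbC -andbA.
  rewrite -[9%N]/(6 + 3)%N => /eqP; rewrite eqn_add2l => /eqP <-.
  by apply: eq_card => P; rewrite !inE andbC.
have holeP h : h \in L -> h != 0 -> h \notin S -> <[h]>%VS \in hole.
  move=> hL h0 hnS; rewrite inE; apply/andP; split.
    by apply/coverP; rewrite sub0v -memvE hL dimv0 dim_vline h0.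
  have /vlineP[a ea] := memv_pick <[h]>%VS.
  rewrite ea; have [->|a0] := eqVneq a 0; first by rewrite scale0r (proj1 hS).
  by rewrite homogZ.
have Bhole h : h \in B :\ 0 -> <[h]>%VS \in hole.
  rewrite in_setD1 => /andP[h0 hB]; apply: holeP => //; first exact: BL.
  by have := diff 0 h B0 hB; rewrite subr0.
have [|P Ph gt] := pigeonhole3 Bhole.
  by rewrite chole -ltnS (leq_trans _ (_ : 8 <= _)%N) // -cB (cardsD1 0) B0.
set BP := [set i in B :\ 0 | _] in gt.
have BPP u : u \in BP -> [/\ u \in B, u != 0 & <[u]>%VS = P].
  by rewrite inE in_setD1 => /andP[/andP[u0 uB] /eqP].
have dP : \dim P = 1%N by move: Ph; rewrite inE => /andP[/coverP[_ _ ->] _]; rewrite dimv0.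
have eqP1 (z : V) (Q : {vspace V}) : \dim Q = 1%N -> z != 0 -> z \in Q -> <[z]>%VS = Q.
  by move=> dQ z0 zQ; apply/eqP; rewrite eqEdim -memvE zQ dim_vline z0 dQ.
have [z /andP[zB zP]|allP] := pickP [pred z | (z \in B) && (z \notin P)]; last first.
  have sub : B \subset [set z in P].
    by apply/subsetP => z zB; rewrite inE; have := allP z; rewrite /= zB /= => /negbFE.
  have eBP : B = [set z in P].
    by apply/eqP; rewrite eqEcard sub cardsE card_vs dP cB q8.
  have [u uBP] : exists u, u \in BP by apply/set0Pn; rewrite -card_gt0 (leq_trans _ gt).
  have [uB u0 uP] := BPP _ uBP.
  have uS : u \notin S by have := diff 0 u B0 uB; rewrite subr0.
  have yu : y \notin <[u]>%VS by apply: contra yL => /vlineP[a ->]; rewrite rpredZ // BL.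
  have := @no8 (<[y]> + <[u]>)%VS.
  rewrite wt_line2 // dim_span2 // (negPf uS) add0n subv_add -!memvE (subvP piU) // (subvP LU) ?BL //.
  have -> : [set s : F | y + s *: u \in S] = [set: F].
    apply/setP => s; rewrite !inE.
    have : s *: u \in B by rewrite eBP inE -uP memvZ // memv_line.
    by rewrite inE => /andP[].
  by rewrite cardsT q8 => /(_ isT erefl).
have z0 : z != 0 by apply: contraNneq zP => ->; rewrite mem0v.
have zS : z \notin S by have := diff 0 z B0 zB; rewrite subr0.
have [u [u' [uBP u'BP uu']]] : exists u u', [/\ u \in BP, u' \in BP & u != u'].
  by have /card_gt1P[u [u' [? ? ?]]] := ltnW gt; exists u, u'.
have third u1 : u1 \in BP -> [/\ z - u1 != 0, <[z - u1]>%VS \in hole,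
    <[z - u1]>%VS != P & <[z - u1]>%VS != <[z]>%VS].
  move=> /BPP[u1B u10 u1P].
  have d0 : z - u1 != 0.
    by rewrite subr_eq0; apply: contraNneq zP => ->; rewrite -u1P memv_line.
  split=> //.
  - by apply: holeP; rewrite ?rpredB ?BL // diff.
  - apply: contra zP => /eqP zu; rewrite -[z](subrK u1) rpredD //.
      by rewrite -zu memv_line.
    by rewrite -u1P memv_line.
  apply: contra zP => /eqP zu; have u1z : u1 \in <[z]>%VS.
    have -> : u1 = z - (z - u1) by rewrite subKr.
    by rewrite rpredB ?memv_line // -zu memv_line.
  by rewrite -u1P (eqP1 u1 <[z]>%VS) ?memv_line // dim_vline z0.
have [du hu nu1 nu2] := third _ uBP; have [du' hu' nu'1 nu'2] := third _ u'BP.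
have hz : <[z]>%VS \in hole by apply: holeP => //; exact: BL.
have zneP : <[z]>%VS != P by apply: contra zP => /eqP <-; exact: memv_line.
have eR : <[z - u]>%VS = <[z - u']>%VS.
  apply/eqP/negPn/negP => ne.
  have : (3 < #|hole|)%N.
    have un : uniq [:: P; <[z]>%VS; <[z - u]>%VS; <[z - u']>%VS].
      rewrite /= !inE !negb_or (eq_sym P) zneP (eq_sym P) nu1 (eq_sym P) nu'1.
      by rewrite (eq_sym _ <[z - u]>%VS) nu2 (eq_sym <[z]>%VS) nu'2 ne.
    have := uniq_leq_size un (_ : {subset _ <= enum hole}); rewrite -cardE; apply.
    by move=> Q; rewrite mem_enum !inE => /or4P[] /eqP ->; [move: Ph|move: hz|move: hu|move: hu']; rewrite inE.
  by rewrite chole.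
have uuR : u' - u \in <[z - u]>%VS.
  have -> : u' - u = (z - u) - (z - u') by rewrite opprB [RHS]addrC addrA subrK.
  by rewrite rpredB ?memv_line // eR memv_line.
have uuP : u' - u \in P.
  by have [_ _ <-] := BPP _ uBP; rewrite rpredB ?memv_line //; have [_ _ ->] := BPP _ uBP; have [_ _ <-] := BPP _ u'BP; rewrite memv_line.
have d0 : u' - u != 0 by rewrite subr_eq0 eq_sym.
move: nu1; rewrite -(eqP1 _ _ dP d0 uuP) (eqP1 _ <[z - u]>%VS _ d0 uuR) ?eqxx //.
by rewrite dim_vline du.
Qed.

Lemma wt_lines L : (L <= U)%VS -> \dim L = 2%N -> [\/ wt S L = 0%N, wt S L = 2%N | wt S L = 4%N].
Proof.
move=> LU dL; have := wt_le_line hS dL; have := e LU dL; have := no8 LU dL.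
have := no_six LU dL; rewrite q8.
by move: (wt S L) => [|[|[|[|[|[|[|[|[|[|]]]]]]]]]] // _ _ _ _; [constructor 1|constructor 2|constructor 3].
Qed.

Definition foursecants x pi := [set L | cover <[x]> pi L && (wt S L == 4%N)].

Lemma foursecantsP x pi L : x \in S ->
  reflect [/\ x \in L, (L <= pi)%VS, \dim L = 2%N & wt S L = 4%N] (L \in foursecants x pi).
Proof.
by move=> xS; rewrite inE cover_pt // -!andbA; apply: (iffP and4P) => -[? ? /eqP ? /eqP].
Qed.

Lemma wt_foursecants x W n : x \in S -> x \in W -> (W <= U)%VS -> ncov <[x]> W = n ->
  (wt S W + n = 1 + (n * 2 + 2 * #|foursecants x W|))%N.
Proof.
move=> xS xW WU nW; have xW' : (<[x]> <= W)%VS by rewrite -memvE.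
have := wt_cover hS xW'; rewrite nW wt_line ?(homog_neq0 hS xS) // xS muln1 => ->.
congr (_ + _)%N.
have -> : (\sum_(L | cover <[x]> W L) wt S L =
   \sum_(L | cover <[x]> W L) (2 + 2 * (wt S L == 4%N)))%N.
  apply: eq_bigr => L; rewrite cover_pt // => /and3P[xL LW /eqP dL].
  have := ge2 xS xL (subv_trans LW WU) dL.
  by case: (wt_lines (subv_trans LW WU) dL) => ->.
rewrite big_split /= sum_nat_const (cover_card nW) -big_distrr /=; congr (_ + 2 * _)%N.
rewrite -sum1_card [LHS]big_mkcond [RHS]big_mkcond /=; apply: eq_bigr => L _.
by rewrite inE; case: (cover _ _ _) => //=; case: eqP.
Qed.

Lemma wt_plane x pi : x \in S -> x \in pi -> (pi <= U)%VS -> \dim pi = 3%N ->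
  wt S pi = (10 + 2 * #|foursecants x pi|)%N.
Proof.
move=> xS xpi piU dpi; have := wt_foursecants xS xpi piU (ncov_pi xS xpi dpi).
by move: #|_| => T; clear; lia.
Qed.

(** The 73 lines through [x] carry one or three further points: 80 = 1 + 73 + 2 * 3. *)
Lemma card_foursecants x : x \in S -> x \in U -> #|foursecants x U| = 3%N.
Proof.
move=> xS xU; have n73 : ncov <[x]> U = 73%N.
  by rewrite ncov_codim3 -?memvE // ?dU ?dimpt // q8.
have := wt_foursecants xS xU (subvv _) n73; rewrite wU.
by move: #|_| => T; clear; lia.
Qed.

Lemma foursecantsS x pi : (pi <= U)%VS -> foursecants x pi \subset foursecants x U.
Proof.
move=> piU; apply/subsetP => L; rewrite !inE => /andP[/coverP[xL Lpi dL] ->].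
by rewrite andbT; apply/coverP; split=> //; exact: subv_trans piU.
Qed.

Let plane pi := (pi <= U)%VS && (\dim pi == 3%N).

(** There are 3 * 2 ordered pairs of distinct 4-secants through [x], and each pair spans one
    plane. *)
Lemma plane_pairs x : x \in S -> x \in U ->
  (\sum_(pi | plane pi && (x \in pi)) #|foursecants x pi| * (#|foursecants x pi| - 1) = 6)%N.
Proof.
move=> xS xU; pose T := foursecants x U; pose D := [set p in setX T T | p.1 != p.2].
have diag (I : finType) (B : {set I}) :
    #|[set p in setX B B | p.1 != p.2]| = (#|B| * (#|B| - 1))%N.
  rewrite -[LHS](addnK #|B|) mulnBr muln1 -cardsX.
  congr subn; rewrite -(cardsID [set p | p.1 == p.2] (setX B B)) addnC; congr (_ + _)%N.
    rewrite -(card_imset _ (f := fun i : I => (i, i))) => [|i j [] //].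
    apply: eq_card => -[i j]; rewrite !inE /=; apply/imsetP/idP.
      by case=> k kB [-> ->]; rewrite kB eqxx.
    by case/andP=> /andP[iB _] /eqP <-; exists i.
  by apply: eq_card => p; rewrite !inE andbC.
have cD : #|D| = 6%N by rewrite /D diag card_foursecants.
rewrite -cD -sum1_card.
have span (p : {vspace V} * {vspace V}) : p \in D -> plane (p.1 + p.2)%VS && (x \in (p.1 + p.2)%VS).
  case: p => L M; rewrite !inE /= => /andP[/andP[/andP[/coverP[xL LU dL] _] /andP[/coverP[xM MU dM] _]] LM].
  rewrite dimpt // in dL dM; rewrite -memvE in xL; rewrite -memvE in xM.
  rewrite /plane subv_add LU MU /= memvE (subv_trans _ (addvSl _ _)) -?memvE // andbT.
  have := dimv_sum_cap L M; rewrite dL dM.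
  have : (0 < \dim (L :&: M))%N.
    rewrite lt0n dimv_eq0; apply/negP => /eqP h0; have := homog_neq0 hS xS.
    by rewrite -memv0 -h0 memv_cap xL xM.
  have : (\dim (L :&: M) < 2)%N.
    rewrite ltnNge; apply: contra LM => h.
    have eL : (L :&: M)%VS = L by apply/eqP; rewrite eqEdim capvSl dL.
    by rewrite eqEdim dL dM -eL capvSr.
  by move: (\dim _) (\dim _) => a b; case: eqP => // ? ? ? ?; lia.
rewrite (partition_big (fun p : {vspace V} * {vspace V} => (p.1 + p.2)%VS)
  (fun pi => plane pi && (x \in pi))) /=; last exact: span.
apply: eq_bigr => pi /andP[/andP[piU /eqP dpi] xpi].
rewrite -diag -sum1_card; apply: eq_bigl => -[L M]; rewrite !inE /=.
have sub X : cover <[x]> pi X = cover <[x]> U X && (X <= pi)%VS.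
  by rewrite !cover_pt //; case: (boolP (X <= pi)%VS) => h; rewrite ?(subv_trans h piU) ?andbT ?andbF //= andbF.
rewrite !sub; apply/idP/idP.
  case/andP=> /andP[/andP[/andP[cL Lpi] wL] /andP[/andP[cM Mpi] wM]] LM.
  rewrite cL wL cM wM LM /=.
  have LMD : (L, M) \in D by rewrite !inE /= cL wL cM wM LM.
  have := span _ LMD => /andP[/andP[_ /eqP d] _].
  by rewrite /= in d; rewrite eqEdim subv_add Lpi Mpi d dpi.
case/andP=> /andP[/andP[/andP[cL wL] /andP[cM wM]] LM] /eqP <-.
by rewrite cL wL cM wM LM addvSl addvSr.
Qed.

Lemma plane_wts pi : plane pi ->
  wt S pi = 0%N \/ wt S pi \in [:: 10; 12; 14; 16]%N.
Proof.
case/andP=> piU /eqP dpi; have [->|p] := posnP (wt S pi); [by left|right].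
have /(wt_gt0P _ hS)[x xS xpi] := p; rewrite (wt_plane xS xpi piU dpi).
have := subset_leq_card (foursecantsS x piU).
rewrite card_foursecants // ?(subvP piU) //.
by move: #|_| => [|[|[|[|]]]].
Qed.

(** The weight of a plane determines the number [tau] of its 4-secants through each of its points of
    [S]. Summing [plane_pairs] over all points gives 28 a + 96 b = 80 * 6 for the numbers a and b of
    planes of weight 14 and 16, whose only solution is a = 0, b = 5. *)
Lemma plane_counts :
  #|[set pi | plane pi && (wt S pi == 14%N)]| = 0%N /\
  #|[set pi | plane pi && (wt S pi == 16%N)]| = 5%N.
Proof.
pose tau pi := ((wt S pi - 10)./2)%N; pose g pi := (tau pi * (tau pi - 1))%N.
have tauE x pi : x \in S -> x \in pi -> plane pi -> tau pi = #|foursecants x pi|.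
  by move=> xS xpi /andP[piU /eqP dpi]; rewrite /tau (wt_plane xS xpi) // addKn mul2n doubleK.
have sg : (\sum_(pi | plane pi) wt S pi * g pi = 480)%N.
  apply/eqP; rewrite -(eqn_pmul2r (isT : 0 < 7)%N) big_distrl /=; apply/eqP.
  transitivity (\sum_(pi | plane pi) \sum_(x in S | x \in pi) g pi)%N.
    apply: eq_bigr => pi _; rewrite sum_nat_cond_const -/(cnt S pi) cnt_wt // q8.
    by rewrite mulnAC.
  rewrite (exchange_big_dep (fun x => (x \in S) && (x \in U))) /=; last first.
    by move=> pi x /andP[piU _] /andP[-> xpi]; rewrite (subvP piU).
  transitivity (\sum_(x in S | x \in U) 6)%N.
    apply: eq_bigr => x /andP[xS xU]; rewrite -(plane_pairs xS xU).
    apply: eq_big => [pi|pi /andP[pl /andP[_ xpi]]]; first by rewrite xS.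
    by rewrite /g (tauE x).
  by rewrite sum_nat_cond_const -/(cnt S U) cnt_wt // q8 wU.
have : (\sum_(pi | plane pi) wt S pi * g pi =
  28 * #|[set pi | plane pi && (wt S pi == 14%N)]| +
  96 * #|[set pi | plane pi && (wt S pi == 16%N)]|)%N.
  have cE k : #|[set pi | plane pi && (wt S pi == k)]| = (\sum_(pi | plane pi) (wt S pi == k))%N.
    rewrite -sum1dep_card big_mkcond [RHS]big_mkcond; apply: eq_bigr => pi _.
    by case: (plane pi); case: eqP.
  rewrite !cE !big_distrr -big_split /=.
  apply: eq_bigr => pi pl; case: (plane_wts pl) => [h|]; first by rewrite /g /tau h.
  by rewrite !inE => /or4P[] /eqP h; rewrite /g /tau h.
rewrite sg; move: #|_| => a; move: #|_| => b; clear; lia.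
Qed.

Lemma plane_wts' pi : plane pi ->
  [\/ wt S pi = 0%N, wt S pi = 10%N, wt S pi = 12%N | wt S pi = 16%N].
Proof.
move=> pl; case: (plane_wts pl) => [h|]; first by constructor 1.
rewrite !inE => /or4P[] /eqP h; [by constructor 2|by constructor 3| |by constructor 4].
have [/eqP] := plane_counts; rewrite cards_eq0 => /eqP/setP/(_ pi).
by rewrite !inE pl h.
Qed.

Definition full pi := plane pi && (wt S pi == 16%N).

Let sec L := [&& (L <= U)%VS, \dim L == 2%N & wt S L == 4%N].

Lemma full_foursecants x al : full al -> x \in S -> x \in al ->
  foursecants x al = foursecants x U.
Proof.
move=> /andP[/andP[alU /eqP dal] /eqP wal] xS xal; apply/eqP.
rewrite eqEcard foursecantsS // card_foursecants // ?(subvP alU) //.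
by have := wt_plane xS xal alU dal; rewrite wal; move: #|_| => T; clear; lia.
Qed.

(** All three 4-secants through a common point would lie in both planes, hence in the single line
    where they meet. *)
Lemma full_disjoint al be x : full al -> full be -> x \in S -> x \in al -> x \in be ->
  al = be.
Proof.
move=> fa fb xS xa xb; apply/eqP/negPn/negP => ne.
have [/andP[aU /eqP da] _] := andP fa; have [/andP[bU /eqP db] _] := andP fb.
have dc : (\dim (al :&: be) <= 2)%N.
  rewrite leqNgt; apply: contra ne => h.
  have ea : (al :&: be)%VS = al by apply/eqP; rewrite eqEdim capvSl da.
  by rewrite eqEdim da db -ea capvSr.
have : (1 < #|foursecants x U|)%N by rewrite card_foursecants // (subvP aU).
case/card_gt1P=> L [M [LT MT /eqP]]; apply.
have sub X : X \in foursecants x U -> X = (al :&: be)%VS.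
  move=> XT; have := XT; rewrite -(full_foursecants fa xS xa) => /(foursecantsP _ _ xS)[_ Xa dX _].
  have := XT; rewrite -(full_foursecants fb xS xb) => /(foursecantsP _ _ xS)[_ Xb _ _].
  by apply/eqP; rewrite eqEdim subv_cap Xa Xb dX dc.
by rewrite (sub L LT) (sub M MT).
Qed.

(** The nine planes on a 4-secant weigh 112 in total and each weighs 12 or 16, so exactly one weighs
    16. *)
Lemma sec_planes L : sec L -> exists al, [/\ full al, (L <= al)%VS &
  forall pi, cover L U pi -> pi != al -> wt S pi = 12%N].
Proof.
case/and3P=> LU /eqP dL /eqP wL.
have pl pi : cover L U pi -> plane pi.
  by case/coverP=> _ piU dpi; rewrite /plane piU dpi dL.
have ge pi : cover L U pi -> (12 <= wt S pi)%N.
  move=> c; have [Lpi piU dpi] := coverP _ _ _ c; rewrite dL in dpi.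
  by have := (plane_ge Lpi piU dL dpi _).1; rewrite wL; exact.
have n9 := ncov_line LU dL.
have [al /andP[ca /eqP wa]|none] := pickP [pred pi | cover L U pi && (wt S pi == 16%N)].
  exists al; split; first by rewrite /full pl // wa.
    by case/coverP: ca.
  have [n1] := wt_cover_but hS LU ca n9; rewrite wU wL wa => sw pi cpi npi.
  apply: (@sum_eq_const _ (fun W' => cover L U W' && (W' != al)) (wt S) 12).
  - by move=> M /andP[/ge].
  - by rewrite n1; move: sw; move: (\sum_(i | _) _)%N => T; clear; lia.
  by rewrite cpi.
have := wt_cover hS LU; rewrite n9 wU wL.
have : (\sum_(pi | cover L U pi) wt S pi = \sum_(pi | cover L U pi) 12)%N.
  apply: eq_bigr => pi c; have g := ge _ c; have := none pi; rewrite /= c /=.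
  by case: (plane_wts' (pl _ c)) => h; rewrite h // in g *.
by rewrite sum_nat_const (cover_card n9) => ->.
Qed.

Lemma in_full x : x \in S -> x \in U -> exists2 al, full al & x \in al.
Proof.
move=> xS xU; have : (0 < #|foursecants x U|)%N by rewrite card_foursecants.
case/card_gt0P=> L /(foursecantsP _ _ xS)[xL LU dL wL].
have [|al [fa La _]] := @sec_planes L; first by rewrite /sec LU dL wL.
by exists al => //; exact: subvP xL.
Qed.

(** For a hole [v] of [al]: every line of [al] through [v] that meets [S] is a 4-secant. *)
Definition covers_from v al := forall y, y \in S -> y \in al -> wt S (<[y]> + <[v]>) = 4%N.

Lemma dim_cap_ge1 A B W : (A <= W)%VS -> (B <= W)%VS -> (\dim W < \dim A + \dim B)%N ->
  exists2 n, n != 0 & n \in (A :&: B)%VS.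
Proof.
move=> AW BW lt; exists (vpick (A :&: B)); last exact: memv_pick.
rewrite vpick0 -dimv_eq0 -lt0n; have := dimv_sum_cap A B.
have : (\dim (A + B) <= \dim W)%N by apply: dimvS; rewrite subv_add AW BW.
lia.
Qed.

Lemma cap_line al be L n : full al -> full be -> al != be -> sec L -> (L <= al)%VS ->
  n != 0 -> n \in L -> n \in be -> (L :&: be)%VS = <[n]>%VS.
Proof.
move=> fa fb ab /and3P[LU /eqP dL /eqP wL] La n0 nL nb.
apply/esym/eqP; rewrite eqEdim -memvE memv_cap nL nb dim_vline n0 /=.
rewrite leqNgt; apply/negP => d.
have eL : (L :&: be)%VS = L by apply/eqP; rewrite eqEdim capvSl dL.
have /(wt_gt0P _ hS)[x xS xL] : (0 < wt S L)%N by rewrite wL.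
have xb : x \in be by move: xL; rewrite -eL memv_cap => /andP[].
by move: ab; rewrite (full_disjoint fa fb xS (subvP La _ xL) xb) eqxx.
Qed.

Lemma full_meet al be L : full al -> full be -> sec L -> (L <= al)%VS ->
  exists n, [/\ n != 0, n \in L & n \in be].
Proof.
move=> /andP[/andP[aU _] _] /andP[/andP[bU /eqP db] _] /and3P[LU /eqP dL _] La.
have [|n n0] := @dim_cap_ge1 L be U LU bU; first by rewrite dU dL db.
by rewrite memv_cap => /andP[nL nb]; exists n.
Qed.

(** For [y] in [be], the plane on [L] and [y] weighs 12, so it has a 4-secant through [y]. All
    4-secants through [y] lie in [be], so this one meets [L] in the only point of [L] in [be], which
    is [n]. *)
Lemma covers_other al be L n : full al -> full be -> al != be -> sec L -> (L <= al)%VS ->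
  n != 0 -> n \in L -> n \in be -> covers_from n be.
Proof.
move=> fa fb ab sL La n0 nL nb y yS yb.
have [LU /eqP dL /eqP wL] := and3P sL.
have [/andP[aU /eqP da] _] := andP fa; have [/andP[bU /eqP db] _] := andP fb.
have yU := subvP bU _ yb.
have ya : y \notin al.
  by apply: contra ab => ya; rewrite (full_disjoint fa fb yS ya yb).
have yL : y \notin L by apply: contra ya; exact: subvP.
have cpi := cover_line LU yU yL; set pi := (L + <[y]>)%VS in cpi.
have [Lpi piU dpi] := coverP _ _ _ cpi; rewrite dL in dpi.
have ypi : y \in pi by rewrite memvE addvSr.
have [al' [fa' La' w12]] := sec_planes sL.
have ea : al' = al.
  have /(wt_gt0P _ hS)[x xS xL] : (0 < wt S L)%N by rewrite wL.
  exact: full_disjoint fa' fa xS (subvP La' _ xL) (subvP La _ xL).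
have wpi : wt S pi = 12%N.
  by apply: w12 => //; rewrite ea; apply: contra ya => /eqP <-.
have : (0 < #|foursecants y pi|)%N.
  by have := wt_plane yS ypi piU dpi; rewrite wpi; move: #|_| => T; clear; lia.
case/card_gt0P=> M MT; have [yM Mpi dM wM] := foursecantsP _ _ yS MT.
have Mb : (M <= be)%VS.
  have := subsetP (foursecantsS y piU) _ MT; rewrite -(full_foursecants fb yS yb).
  by case/(foursecantsP _ _ yS).
have [|k k0] := @dim_cap_ge1 M L pi Mpi Lpi; first by rewrite dpi dM dL.
rewrite memv_cap => /andP[kM kL].
have nM : n \in M.
  have : n \in (L :&: be)%VS by rewrite memv_cap nL nb.
  rewrite (cap_line fa fb ab sL La k0 kL (subvP Mb _ kM)); apply: subvP.
  by rewrite -memvE.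
suff -> : (<[y]> + <[n]>)%VS = M by [].
apply/eqP; rewrite eqEdim subv_add -!memvE yM nM dM dim_span2 //.
apply: contra yL => /vlineP[a ->]; exact: rpredZ.
Qed.

Lemma hole_notin al be n : full al -> full be -> al != be -> n \in al -> n \in be -> n \notin S.
Proof.
move=> fa fb ab na nb; apply: contra ab => nS.
by rewrite (full_disjoint fa fb nS na nb).
Qed.

(** By [covers_other] there is a 4-secant of [be] through [n], and with it the roles of the two
    planes can be exchanged. *)
Lemma covers_self al be L n : full al -> full be -> al != be -> sec L -> (L <= al)%VS ->
  n != 0 -> n \in L -> n \in be -> covers_from n al.
Proof.
move=> fa fb ab sL La n0 nL nb.
have cb := covers_other fa fb ab sL La n0 nL nb.
have nS := hole_notin fa fb ab (subvP La _ nL) nb.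
have [/andP[bU /eqP db] /eqP wb] := andP fb.
have /(wt_gt0P _ hS)[y yS yb] : (0 < wt S be)%N by rewrite wb.
have yn := notin_line hS nS yS.
have Mb : (<[y]> + <[n]> <= be)%VS by rewrite subv_add -!memvE yb nb.
apply: (@covers_other be al (<[y]> + <[n]>)%VS n) => //.
- by rewrite eq_sym.
- by rewrite /sec (subv_trans Mb bU) dim_span2 // cb.
- by rewrite memvE addvSr.
- exact: subvP La _ nL.
Qed.

(** With two such holes, moving from a point off [L] along the lines to [n] and then to [n'] yields
    4 * 4 points of the plane off [L], while only 16 - 4 exist. *)
Lemma cover_hole_unique al L n n' : full al -> sec L -> (L <= al)%VS ->
  n != 0 -> n' != 0 -> n \in L -> n' \in L -> n \notin S -> n' \notin S ->
  covers_from n al -> covers_from n' al -> n' \in <[n]>%VS.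
Proof.
move=> /andP[/andP[aU /eqP da] /eqP wa] /and3P[LU /eqP dL /eqP wL] La n0 n'0 nL n'L nS n'S cn cn'.
apply/negPn/negP => n'n.
have [|y yS [ya yL]] := @wt_lt_exists _ _ S L al hS; first by rewrite wa wL.
have yh h : h \in L -> (y + h \notin L).
  by move=> hL; apply: contra yL => h'; rewrite -[y](addrK h) rpredB.
have notin h k : h \in L -> k \in L -> y + h \notin <[k]>%VS.
  by move=> hL kL; apply: contra (yh _ hL) => /vlineP[a ->]; rewrite rpredZ.
have card4 h k : h \in L -> k \in L -> k != 0 -> k \notin S -> covers_from k al ->
    y + h \in S -> #|[set s : F | y + h + s *: k \in S]| = 4%N.
  move=> hL kL k0 kS ck yhS; have := ck _ yhS; rewrite wt_line2 ?notin // (negPf kS).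
  by rewrite add0n; apply; rewrite rpredD // (subvP La).
pose A := [set s : F | y + s *: n \in S].
have cA : #|A| = 4%N.
  rewrite -(card4 0 n (mem0v _) nL n0 nS cn); last by rewrite addr0.
  by apply: eq_card => s; rewrite !inE addr0.
pose B := [set h in L | y + h \in S].
have cB : #|B| = 12%N.
  have := wt_affine hS La _ ya yL; rewrite wa wL dL da => /(_ erefl).
  rewrite -[16%N]/(4 + 12)%N => /eqP; rewrite eqn_add2l => /eqP <-.
  by [].
have : (16 <= #|B|)%N.
  have inj : injective (fun p : F * F => p.1 *: n + p.2 *: n').
    move=> [a b] [c d] /= eac.
    have ebd : (b - d) *: n' = (c - a) *: n.
      by rewrite !scalerBl; apply/eqP; rewrite subr_eq addrAC -eac addrAC subrr add0r.
    have bd : b = d.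
      apply/eqP; rewrite -subr_eq0; apply: contraNT n'n => bd.
      by rewrite -[n'](scalerK bd) ebd !rpredZ // memv_line.
    move: eac; rewrite bd => /addIr/eqP.
    by rewrite -subr_eq0 -scalerBl scaler_eq0 (negPf n0) orbF subr_eq0 => /eqP ->.
  pose D := [set p : F * F | (p.1 \in A) && (y + p.1 *: n + p.2 *: n' \in S)].
  have cD : #|D| = 16%N.
    rewrite -sum1_card (partition_big (fun p : F * F => p.1) (mem A)) /=; last first.
      by move=> p; rewrite inE => /andP[].
    transitivity (\sum_(a in A) 4)%N; last by rewrite sum_nat_const cA.
    apply: eq_bigr => a aA; rewrite sum1_card.
    rewrite -(card4 (a *: n) n') ?rpredZ //; last by move: aA; rewrite inE.
    rewrite -(card_imset _ (f := fun b : F => (a, b))) => [|b c [] //].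
    apply: eq_card => -[a' b]; rewrite unfold_in /= inE /=; apply/idP/imsetP.
      by case/andP=> /andP[_ h] /eqP ea; rewrite ea in h *; exists b; rewrite ?inE.
    by case=> c; rewrite inE => h [-> ->]; rewrite aA h eqxx.
  rewrite -cD -(card_imset _ inj); apply: subset_leq_card; apply/subsetP => h.
  case/imsetP=> -[a b]; rewrite !inE /= => /andP[_ h'] ->.
  by rewrite rpredD ?rpredZ // addrA.
by rewrite cB.
Qed.

(* The five planes of weight 16 share a hole [n] through which every line is a
   0- or 4-secant. A line [M] through [n] and a point off these planes then misses
   [S], and all planes through [M] have weight divisible by 12, but 80 is not. *)
Lemma no_foursecants : False.
Proof.
have [_ c5] := plane_counts.
have : (1 < #|[set pi | full pi]|)%N by rewrite c5.
case/card_gt1P=> al [be [fa fb ab]]; rewrite !inE in fa fb.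
have [/andP[aU /eqP da] /eqP wa] := andP fa.
have /(wt_gt0P _ hS)[x xS xa] : (0 < wt S al)%N by rewrite wa.
have : (0 < #|foursecants x U|)%N by rewrite card_foursecants // (subvP aU).
case/card_gt0P=> L; rewrite -(full_foursecants fa xS xa).
case/(foursecantsP _ _ xS)=> xL La dL wL.
have sL : sec L by rewrite /sec (subv_trans La aU) dL wL.
have [n [n0 nL nb]] := full_meet fa fb sL La.
have nS := hole_notin fa fb ab (subvP La _ nL) nb.
have ca := covers_self fa fb ab sL La n0 nL nb.
have cov ga : full ga -> n \in ga /\ covers_from n ga.
  move=> fg; have [->|ag] := eqVneq ga al; first by split=> //; exact: subvP nL.
  rewrite eq_sym in ag; have [n' [n'0 n'L n'g]] := full_meet fa fg sL La.
  have n'S := hole_notin fa fg ag (subvP La _ n'L) n'g.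
  have ca' := covers_self fa fg ag sL La n'0 n'L n'g.
  have nn' := cover_hole_unique fa sL La n'0 n0 n'L nL n'S nS ca' ca.
  have ng : n \in ga by apply: subvP nn'; rewrite -memvE.
  by split=> //; exact: (covers_other fa fg ag sL La n0 nL ng).
(* Five planes do not cover the solid: 5 * 8 ^ 3 < 8 ^ 4. *)
have [X XU Xf] : exists2 X, X \in U & forall ga, full ga -> X \notin ga.
  have [X /andP[XU /forallP h]|none] :=
      pickP [pred X : V | (X \in U) && [forall ga : {vspace V}, full ga ==> (X \notin ga)]].
    by exists X => // ga fg; have := h ga; rewrite fg.
  have : (#|U| <= \sum_(ga | full ga) #|ga|)%N.
    rewrite -sum1_card; under [X in (_ <= X)%N]eq_bigr => ga _ do rewrite -sum1_card.
    rewrite [X in (_ <= X)%N](exchange_big_dep predT) //= big_mkcond /=.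
    apply: leq_sum => X _; case: ifP => // XU.
    have := none X; rewrite /= XU /= => /negbT; rewrite negb_forall => /existsP[ga].
    rewrite negb_imply negbK => /andP[fg Xg].
    by rewrite (bigD1 ga) /= ?fg ?Xg // addnC addn1.
  under eq_bigr => ga /andP[/andP[_ /eqP d] _] do rewrite card_vs d q8.
  rewrite card_vs dU q8 sum_nat_const.
  have -> : #|[pred ga | full ga]| = 5%N by rewrite -c5; apply: eq_card => ga; rewrite !inE.
  by [].
have Xn : X \notin <[n]>%VS.
  apply: contra (Xf _ fa) => /vlineP[a ->]; rewrite rpredZ //; exact: subvP nL.
pose M := (<[X]> + <[n]>)%VS.
have dM : \dim M = 2%N by exact: dim_span2.
have nU : n \in U by apply: subvP aU _ (subvP La _ nL).
have MU : (M <= U)%VS by rewrite subv_add -!memvE XU nU.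
have notn y : y \in S -> y \notin <[n]>%VS := notin_line hS nS (y := y).
have wM : wt S M = 0%N.
  apply/eqP; rewrite -leqn0 leqNgt; apply/negP => /(wt_gt0P _ hS)[y yS yM].
  have [ga fg yg] := in_full yS (subvP MU _ yM).
  have [ng _] := cov _ fg; case/memv_addP: yM => _ /vlineP[a ->] [_ /vlineP[b ->] ey].
  have a0 : a != 0.
    apply: contraNneq (notn _ yS) => a0; rewrite ey a0 scale0r add0r.
    by rewrite memvZ // memv_line.
  move: (Xf _ fg); rewrite -[X](scalerK a0) rpredZ //.
  have -> : a *: X = y - b *: n by rewrite ey addrK.
  by rewrite rpredB // rpredZ.
have wpi pi : cover M U pi -> (12 %| wt S pi)%N.
  move=> c; have [Mpi piU dpi] := coverP _ _ _ c; rewrite dM in dpi.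
  have pl : plane pi by rewrite /plane piU dpi.
  (* The lines through [n] are 0- or 4-secants, so the weight is a multiple of 4, which rules out
     10; weight 16 is ruled out by the choice of [X]. *)
  have four : (4 %| wt S pi)%N.
    have npi : (<[n]> <= pi)%VS by apply: subv_trans (addvSr _ _) Mpi.
    have := wt_cover hS npi; rewrite wt_line // (negPf nS) muln0 addn0 add0n => ->.
    apply: dvdn_sum => K /coverP[nK Kpi dK]; rewrite dim_vline n0 in dK.
    have [->//|p] := posnP (wt S K); have /(wt_gt0P _ hS)[y yS yK] := p.
    have KU := subv_trans Kpi piU.
    have [ga fg yg] := in_full yS (subvP KU _ yK).
    have [_ /(_ y yS yg)] := cov _ fg.
    suff -> : (<[y]> + <[n]>)%VS = K by move=> ->.
    by apply/eqP; rewrite eqEdim subv_add -memvE yK nK dK dim_span2 // notn.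
  case: (plane_wts' pl) => h; rewrite h // in four *.
  have := Xf pi; rewrite /full pl h => /(_ isT)/negP; case.
  by apply: subvP Mpi _ _; rewrite memvE addvSl.
have := wt_cover hS MU; rewrite wU wM muln0 addn0 add0n => e80.
have : (12 %| 80)%N by rewrite e80; apply: dvdn_sum.
by [].
Qed.

End Eight.

Lemma secant_rad8 S U : q = 8%N -> homog S -> evenset S U -> \dim U = 4%N ->
  wt S U = ((q + 2) * q)%N -> exists2 v, v != 0 & v \in rad S U.
Proof.
move=> q8 hS e dU wU.
have [L /and3P[LU /eqP dL /eqP wL]|none] :=
    pickP [pred L | [&& (L <= U)%VS, \dim L == 2%N & wt S L == q]].
  exact: (secant_rad hS e dU wU LU dL wL).
have w80 : wt S U = 80%N by rewrite wU q8.
case: (no_foursecants q8 hS e dU w80) => L LU dL; apply/negP => /eqP wL.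
by have := none L; rewrite /= LU dL wL q8.
Qed.

Theorem min_rad48 S U r : q = 4%N \/ q = 8%N -> homog S -> evenset S U ->
  \dim U = r.+3 -> wt S U = ((q + 2) * q ^ r)%N -> \dim (rad S U) = r.
Proof.
move=> hq hS e dU wU; apply: (min_rad _ _ hS e dU wU) => [|U' U'U dU' wU'].
  by case: hq => ->.
have e' : evenset S U' by exact: evensetS e.
by case: hq => q0; [apply: secant_rad4 | apply: secant_rad8].
Qed.

End SecantLines.

(** * Reduction to sets of even type *)

Section Projection.
Variables (F : finFieldType) (N : nat).
Local Notation V := 'rV[F]_N.
Local Notation q := #|F|.
Implicit Types (S : {set V}) (U W H L M P A : {vspace V}) (x y v : V).
Hypothesis qeven : ~~ odd q.

(** The dual code condition in vector form; [keven 1] is [evenset]. *)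
Definition keven k S U := forall W, (W <= U)%VS -> \dim W = k.+1 -> ~~ odd (wt S W).

Lemma odd_cnt S U : homog S -> odd (cnt S U) = odd (wt S U).
Proof.
move=> hS; rewrite cnt_wt // oddM subn1.
by have := q_gt1 F; case: #|F| qeven => // n; rewrite /= negbK => -> _; rewrite andbT.
Qed.

(** Counting modulo 2 on the lines through a point, whose number is odd because q is even. *)
Lemma even_subspace S A : homog S -> evenset S A -> (2 <= \dim A)%N -> ~~ odd (wt S A).
Proof.
move=> hS e dA; have [x xA x0] : exists2 x, x \in A & x != 0.
  by exists (vpick A); rewrite ?memv_pick // vpick0 -dimv_eq0 -lt0n ltnW.
have xA' : (<[x]> <= A)%VS by rewrite -memvE.
have dx : \dim <[x]> = 1%N by rewrite dim_vline x0.
have nodd : odd (ncov <[x]> A).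
  have := ncov_codim (k := (\dim A - 1)%N) xA'; rewrite dx subnKC ?(ltnW dA) // => /(_ erefl).
  move/(congr1 odd); rewrite oddM !subn1 => h.
  have : odd (q ^ (\dim A).-1).-1.
    have : ~~ odd (q ^ (\dim A).-1) by rewrite oddX (negPf qeven) orbF; case: (\dim A) dA => [|[]].
    have : (0 < q ^ (\dim A).-1)%N by rewrite expn_gt0 (ltnW (q_gt1 F)).
    by case: (q ^ _)%N => //= n _; rewrite negbK.
  by rewrite -h => /andP[].
have := congr1 odd (wt_cover hS xA'); rewrite !oddD oddM nodd andTb.
have -> : odd (\sum_(L | cover <[x]> A L) wt S L) = false.
  apply: (big_ind (fun m => odd m = false)) => // [a b|L /coverP[_ LA dL]].
    by rewrite oddD => -> ->.
  by apply/negbTE/e => //; rewrite dL dx.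
by rewrite addbF; case: (odd (wt S A)); case: (odd _).
Qed.

Lemma wt_restrict S W A : (forall x, x \in S -> x \in W -> x \in A) -> homog S ->
  (A <= W)%VS -> wt S W = wt S A.
Proof.
move=> h hS AW; rewrite -[RHS]mul1n; apply: wt_cntM => //; rewrite mul1n.
apply: eq_card => x; rewrite !inE; case xS: (x \in S) => //=.
by apply/idP/idP => [xW|xA]; [exact: h | exact: subvP xA].
Qed.

(** The dimensions force [W] to meet [A] at least in a line. *)
Lemma keven_of_evenset S U A k : homog S -> (A <= U)%VS -> evenset S A ->
  (forall x, x \in S -> x \in U -> x \in A) -> (\dim U < k + \dim A)%N ->
  keven k S U.
Proof.
move=> hS AU e sub dU W WU dW.
rewrite (@wt_restrict S W (W :&: A)%VS) ?capvSl //; last first.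
  by move=> x xS xW; rewrite memv_cap xW sub // (subvP WU).
apply: even_subspace => //; first by apply: evensetS e; exact: capvSr.
have := dimv_sum_cap W A.
have : (\dim (W + A) <= \dim U)%N by apply: dimvS; rewrite subv_add WU AU.
by rewrite dW; lia.
Qed.

Definition fibre S v x := #|[set t : F | x + t *: v \in S]|.

(* The projection modulo [v], with points counted by parity: it lowers [k] by one
   and does not increase the weight. *)
Definition proj S v : {set V} := [set x | odd (fibre S v x)].

Lemma fibre0 S v : homog S -> v \notin S -> fibre S v 0 = 0%N.
Proof.
move=> hS vS; apply/eqP; rewrite cards_eq0; apply/eqP/setP => t; rewrite !inE add0r.
have [->|t0] := eqVneq t 0; first by rewrite scale0r (negPf (proj1 hS)).
by rewrite homogZ // (negPf vS).
Qed.

Lemma proj_homog S v : homog S -> v \notin S -> homog (proj S v).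
Proof.
move=> hS vS; split=> [|a x a0]; first by rewrite inE fibre0.
rewrite !inE; congr odd; rewrite /fibre.
have inj : injective (fun t : F => a * t) by exact: mulfI.
rewrite -[RHS](card_imset _ inj); apply: eq_card => t; rewrite inE.
apply/idP/imsetP => [h|[s]].
  exists (a^-1 * t); last by rewrite mulVKf.
  by rewrite inE -(homogZ _ hS a0) scalerDr scalerA mulVKf.
by rewrite inE => h ->; rewrite -scalerA -scalerDr homogZ.
Qed.

Lemma cnt_fibres S v W : v \notin W -> cnt S (W + <[v]>) = (\sum_(x in W) fibre S v x)%N.
Proof.
move=> vW; rewrite /cnt -sum1_card.
have inj : {in setX [set x in W] [set: F] &,
    injective (fun p : V * F => p.1 + p.2 *: v)}.
  move=> [x s] [y t]; rewrite !inE !andbT /= => xW yW ee.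
  have st : s = t.
    apply/eqP; rewrite -subr_eq0; apply: contraNT vW => d.
    rewrite -[v](scalerK d) rpredZ //.
    have -> : (s - t) *: v = y - x.
      by rewrite scalerBl; apply/eqP; rewrite subr_eq addrAC -ee addrAC subrr add0r.
    by rewrite rpredB.
  by move: ee; rewrite st => /addIr ->.
under [RHS]eq_bigr => x _ do rewrite /fibre -sum1_card.
rewrite pair_big_dep /= !sum1_card.
rewrite -(card_in_imset (D := [pred p : V * F | (p.1 \in W) && (p.2 \in [set t | p.1 + t *: v \in S])])
  (f := fun p : V * F => p.1 + p.2 *: v)).
  apply: eq_card => x; rewrite inE; apply/andP/imsetP.
    case=> xS /memv_addP[w wW [_ /vlineP[t ->] ew]].
    by exists (w, t) => //; rewrite !inE wW /= -ew.
  case=> -[w t]; rewrite !inE /= => /andP[wW wS] ->; split=> //.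
  by rewrite memv_add // memvZ // memv_line.
by move=> p p'; rewrite !inE => /andP[pW _] /andP[p'W _]; apply: inj; rewrite !inE ?pW ?p'W.
Qed.

Lemma proj_keven S U H v k : homog S -> v \notin S -> v \in U -> (H <= U)%VS -> v \notin H ->
  keven k.+1 S U -> keven k (proj S v) H.
Proof.
move=> hS vS vU HU vH e W WH dW.
have vW : v \notin W by apply: contra vH; exact: subvP.
have := e (W + <[v]>)%VS; rewrite subv_add (subv_trans WH HU) -memvE vU dim_addline // dW.
move=> /(_ isT erefl); rewrite -odd_cnt // cnt_fibres // -odd_cnt; last exact: proj_homog.
rewrite cntE; apply: contra.
have -> : odd (\sum_(x in W) (x \in proj S v))%N = odd (\sum_(x in W) fibre S v x)%N.
  apply: (big_ind2 (fun a b => odd a = odd b)) => // [a b c d ab cd|x _].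
    by rewrite !oddD ab cd.
  by rewrite inE oddb.
by [].
Qed.

(** For [x] in [S] and [v] off [S], the line joining them meets [S] in [x] only. *)
Definition tangent S v x := forall t : F, t != 0 -> x + t *: v \notin S.

(** If every line through [x] had a second point, the number of lines would already exceed the
    weight. Any point other than [x] on a tangent serves as [v]. *)
Lemma tangent_exists S U r x : homog S -> x \in S -> x \in U ->
  (r.+3 < \dim U)%N -> (wt S U <= (q + 2) * q ^ r)%N ->
  exists v, [/\ v \in U, v != 0, v \notin S & tangent S v x].
Proof.
move=> hS xS xU dU le; have x0 := homog_neq0 hS xS.
have xU' : (<[x]> <= U)%VS by rewrite -memvE.
have dx : \dim <[x]> = 1%N by rewrite dim_vline x0.
have [L /andP[cL /eqP wL]|none] := pickP [pred L | cover <[x]> U L && (wt S L == 1%N)].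
  have [xL LU dL] := coverP _ _ _ cL; rewrite dx in dL.
  have [v vL vx] : exists2 v, v \in L & v \notin <[x]>%VS.
    by apply/subvPn; apply/negP => /dimvS; rewrite dL dx.
  have Le : (<[v]> + <[x]> = L)%VS.
    by apply/eqP; rewrite eqEdim subv_add -memvE vL xL dL dim_span2.
  have := wt_line2 hS x0 vx; rewrite Le wL xS => -[/esym/eqP].
  rewrite cards_eq0 => /eqP/setP h.
  have hh t : v + t *: x \notin S by have := h t; rewrite !inE => ->.
  exists v; split.
  - exact: subvP vL.
  - by apply: contraNneq vx => ->; rewrite mem0v.
  - by have := hh 0; rewrite scale0r addr0.
  move=> t t0; have -> : x + t *: v = t *: (v + t^-1 *: x).
    by rewrite scalerDr scalerA divff // scale1r addrC.
  by rewrite homogZ.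
have ge L : cover <[x]> U L -> (2 <= wt S L)%N.
  move=> c; have := none L; rewrite /= c /=.
  have : (0 < wt S L)%N by apply/wt_gt0P => //; exists x => //; case/coverP: c => /subvP->//; rewrite memv_line.
  by case: (wt S L) => [|[]].
have := wt_cover hS xU'; rewrite wt_line // xS muln1.
have := sum_ge_const ge; rewrite (cover_card erefl).
have : (ncov <[x]> U * (q - 1) = q ^ (\dim U - 1) - 1)%N.
  by apply: ncov_codim => //; rewrite dx subnKC // (leq_trans _ dU).
have : (q ^ r.+3 <= q ^ (\dim U - 1))%N by rewrite leq_exp2l ?q_gt1 //; lia.
move: (q ^ (\dim U - 1))%N le => Q; rewrite !expnS.
have : (0 < q ^ r)%N by rewrite expn_gt0 (ltnW (q_gt1 F)).
have q32 : (3 < q)%N \/ q = 2%N.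
  by move: (q_gt1 F) qeven; case: #|F| => [|[|[|[|n]]]] //= _ _; [right | left].
move: q32.
move: (\sum_(i | _) _)%N => T; move: (ncov _ _) (wt _ _) (q ^ r)%N => n w X; move: #|F| => p.
move=> p32 X0 le0 le1 e1 e2 e3; exfalso.
have {T e2 e3} wn : (n + 1 <= w)%N by clear -e2 e3; lia.
have p1 : (1 < p)%N by case: p32 => [/ltnW/ltnW//|->].
have : ((n + 1) * (p - 1) <= (p + 2) * X * (p - 1))%N.
  by rewrite leq_mul2r (leq_trans wn le0) orbT.
rewrite mulnDl e1 mul1n; clear -p1 X0 le1.
have : (p * (p * X) + p * X <= p * (p * (p * X)) + 2 * X)%N by clear le1; nia.
have : (p + 2 <= p * p)%N by clear -p1; nia.
clear -p1 X0 le1; case: p p1 le1 => [|[|p]] // _; nia.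
Qed.

(** The tangent makes one fibre a singleton, so the projection is not empty and the bound for [k]
    applies to it. A fibre with two or more elements strictly loses weight, so equality leaves only
    fibres of size at most 1. *)
Lemma proj_lower S U r k v : homog S -> keven k.+1 S U -> \dim U = (k.+1 + r + 2)%N ->
  (forall S' U', homog S' -> keven k S' U' -> \dim U' = (k + r + 2)%N ->
     (0 < wt S' U')%N -> ((q + 2) * q ^ r <= wt S' U')%N) ->
  v \in U -> v != 0 -> v \notin S ->
  (exists x, [/\ x \in S, x \in U & tangent S v x]) ->
  ((q + 2) * q ^ r <= wt S U)%N /\
  (wt S U = ((q + 2) * q ^ r)%N -> forall y, y \in S -> y \in U -> tangent S v y).
Proof.
move=> hS e dU IH vU v0 vS [x [xS xU tx]].
have q1 : (0 < q - 1)%N by rewrite subn_gt0 q_gt1.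
have [H [HU Hv sU dH]] := line_complement vU v0.
have vH := capv_line0 v0 Hv.
have hp := proj_homog hS vS.
have decomp z : z \in U -> exists2 h, h \in H & exists t, z = h + t *: v.
  by rewrite -sU => /memv_addP[h hH [_ /vlineP[t ->] ->]]; exists h => //; exists t.
have cU : cnt S U = (\sum_(z in H) fibre S v z)%N by rewrite -sU cnt_fibres.
have cP : cnt (proj S v) H = (\sum_(z in H) (odd (fibre S v z)))%N.
  by rewrite cntE; apply: eq_bigr => z _; rewrite inE.
have odd_le m : (odd m <= m)%N by case: m => // m; case: (odd _).
have pos : (0 < wt (proj S v) H)%N.
  apply/wt_gt0P => //; have [h hH [t xh]] := decomp _ xU.
  exists h => //; rewrite inE.
  have -> : fibre S v h = 1%N.
    rewrite /fibre; apply/eqP/cards1P; exists t; apply/setP => s; rewrite !inE.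
    have -> : h + s *: v = x + (s - t) *: v by rewrite xh -addrA -scalerDl [t + _]addrC subrK.
    have [->|st] := eqVneq s t; first by rewrite subrr scale0r addr0 xS.
    by apply/negbTE/tx; rewrite subr_eq0.
  by [].
have lb := IH _ _ hp (proj_keven hS vS vU HU vH e) _ pos.
have {}lb : ((q + 2) * q ^ r <= wt (proj S v) H)%N by apply: lb; lia.
have le : (wt (proj S v) H <= wt S U)%N.
  by rewrite -(leq_pmul2r q1) -!cnt_wt // cU cP; apply: leq_sum => z _.
split; first exact: leq_trans le.
move=> wU y yS yU t t0; apply/negP => yt.
have [h hH [s yh]] := decomp _ yU.
have f2 : (1 < fibre S v h)%N.
  apply/card_gt1P; exists s, (s + t); rewrite !inE scalerDl addrA -yh yS yt.
  by rewrite -subr_eq0 opprD addrA subrr add0r oppr_eq0 t0.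
have : (cnt (proj S v) H < cnt S U)%N.
  rewrite cU cP (bigD1 h) //= [X in (_ < X)%N](bigD1 h) //= -addSn; apply: leq_add.
    by apply: leq_trans f2; case: (odd _).
  by apply: leq_sum => z _.
by rewrite !cnt_wt // ltn_pmul2r // wU ltnNge lb.
Qed.

Theorem kwt_lower k S U r : homog S -> keven k.+1 S U -> \dim U = (k.+1 + r + 2)%N ->
  (0 < wt S U)%N -> ((q + 2) * q ^ r <= wt S U)%N.
Proof.
elim: k S U => [|k IH] S U hS e dU p.
  by apply: wt_lower => //; lia.
case: (leqP ((q + 2) * q ^ r) (wt S U)) => // lt; have le := ltnW lt.
have /(wt_gt0P _ hS)[x xS xU] := p.
have [|v [vU v0 vS tv]] := tangent_exists hS xS xU _ le; first by lia.
have [|] := proj_lower hS e dU IH vU v0 vS; first by exists x.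
by rewrite leqNgt lt.
Qed.

(* The points lying on some secant form, together with the set itself, a cone
   with every point of the set as a vertex, hence a subspace; it is proper since
   a minimum set has tangents. *)
Lemma min_in_hyperplane k S U r : homog S -> keven k.+2 S U ->
  \dim U = (k.+2 + r + 2)%N -> wt S U = ((q + 2) * q ^ r)%N ->
  exists H, [/\ (H <= U)%VS, \dim U = (\dim H).+1 &
    forall x, x \in S -> x \in U -> x \in H].
Proof.
move=> hS e dU wU.
have /(wt_gt0P _ hS)[x xS xU] : (0 < wt S U)%N by rewrite wU min_wt_gt0.
have [||v [vU v0 vS tv]] := @tangent_exists S U r x hS xS xU; rewrite ?wU //; first by lia.
have all_tangent u : u \in U -> u != 0 -> u \notin S ->
    (exists x, [/\ x \in S, x \in U & tangent S u x]) ->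
    forall y, y \in S -> y \in U -> tangent S u y.
  move=> uU u0 uS h.
  by apply: (proj_lower hS e dU _ uU u0 uS h).2 => // S' U'; exact: kwt_lower.
pose T u := [|| u == 0, u \in S |
  [exists y in S, (y \in U) && [exists t : F, (t != 0) && (y + t *: u \in S)]]].
have TS u y : u \in U -> T u -> y \in S -> y \in U -> T (u + y).
  move=> uU Tu yS yU.
  have [|uy0] := eqVneq (u + y) 0; first by rewrite /T => ->; rewrite eqxx.
  have [uyS|uyS] := boolP (u + y \in S); first by rewrite /T uyS orbT.
  have mk z t : z \in S -> z \in U -> t != 0 -> z + t *: (u + y) \in S -> T (u + y).
    move=> zS zU t0 h; rewrite /T; apply/or3P; constructor 3.
    by apply/exists_inP; exists z => //; rewrite zU; apply/existsP; exists t; rewrite t0.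
  case/or3P: Tu => [/eqP u0|uS|ex].
  - by move: uyS; rewrite u0 add0r yS.
  - apply: (mk u (-1)) => //; first by rewrite oppr_eq0 oner_eq0.
    rewrite scaleN1r opprD addrA subrr add0r -scaleN1r homogZ //.
    by rewrite oppr_eq0 oner_eq0.
  have [u0|u0] := eqVneq u 0; first by move: uyS; rewrite u0 add0r yS.
  have [uS|uS] := boolP (u \in S).
    apply: (mk u (-1)) => //; first by rewrite oppr_eq0 oner_eq0.
    rewrite scaleN1r opprD addrA subrr add0r -scaleN1r homogZ //.
    by rewrite oppr_eq0 oner_eq0.
  have [t /andP[t0 ht]|none] := pickP [pred t | (t != 0) && (y + t *: u \in S)].
    have t1 : 1 - t != 0.
      rewrite subr_eq0; apply: contraNneq uyS => t1.
      by move: ht; rewrite -t1 scale1r addrC.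
    apply: (mk (y + t *: u) (- t)) => //.
    - by rewrite rpredD // rpredZ.
    - by rewrite oppr_eq0.
    rewrite scaleNr scalerDr opprD addrA addrK.
    by rewrite -{1}[y]scale1r -scalerBl homogZ.
  (* If [y] were tangent towards [u], equality in the projection bound would make every point
     tangent towards [u], against the secant through [z]. *)
  have ty : tangent S u y.
    by move=> t t0; have := none t; rewrite /= t0 /= => ->.
  case/exists_inP: ex => z zS /andP[zU /existsP[t /andP[t0 zt]]].
  have ex : exists x, [/\ x \in S, x \in U & tangent S u x] by exists y.
  by have := all_tangent u uU u0 uS ex z zS zU t t0; rewrite zt.
pose B := [set y in S | y \in U].
have BU : (<<enum B>> <= U)%VS.
  by apply/span_subvP => y; rewrite mem_enum inE => /andP[].
have spT u : u \in <<enum B>>%VS -> T u.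
  move=> /coord_span ->; apply: (@proj2 (\sum_i coord (enum_tuple B) i u *: (enum B)`_i \in U)).
  apply: (big_rec (fun a => a \in U /\ T a)).
    by rewrite mem0v /T eqxx.
  move=> i a _ [aU Ta].
  have : (enum B)`_i \in enum B by apply: mem_nth; rewrite -cardE ltn_ord.
  rewrite mem_enum inE => /andP[bS bU].
  have [->|c0] := eqVneq (coord (enum_tuple B) i u) 0; first by rewrite scale0r add0r.
  by rewrite rpredD ?rpredZ // addrC; split=> //; apply: TS => //; rewrite ?homogZ ?rpredZ.
have vT : ~~ T v.
  rewrite /T (negPf v0) (negPf vS) /=; apply/negP => /exists_inP[z zS /andP[zU /existsP[t /andP[t0 zt]]]].
  have ex : exists x, [/\ x \in S, x \in U & tangent S v x] by exists x.
  by have := all_tangent v vU v0 vS ex z zS zU t t0; rewrite zt.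
have vsp : v \notin <<enum B>>%VS by apply: contra vT; exact: spT.
have [|||H [BH HU _ _ dH]] := @complement_through F N <[v]>%VS <<enum B>>%VS U.
- by rewrite -memvE.
- exact: BU.
- by rewrite capvC notin_capv_line.
exists H; split=> //; first by rewrite dH dim_vline v0 addn1.
move=> y yS yU; apply: (subvP BH); apply: memv_span.
by rewrite mem_enum inE yS.
Qed.

(** Once [S] lies in a hyperplane [H], adding to a subspace of [H] a vector off [H] brings no new
    points, so the evenness condition descends to [H] with [k] lowered by one. *)
Theorem kmin_in_subspace k S U r : homog S -> keven k.+1 S U ->
  \dim U = (k.+1 + r + 2)%N -> wt S U = ((q + 2) * q ^ r)%N ->
  exists A, [/\ (A <= U)%VS, \dim A = r.+3, evenset S A &
    forall x, x \in S -> x \in U -> x \in A].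
Proof.
elim: k U => [|k IH] U hS e dU wU.
  by exists U; split=> //; lia.
have [H [HU dH sub]] := min_in_hyperplane hS e dU wU.
have wH : wt S H = ((q + 2) * q ^ r)%N by rewrite -wU; apply/esym/wt_restrict.
have eH : keven k.+1 S H.
  move=> W WH dW; have [w wU' wH'] : exists2 w, w \in U & w \notin H.
    by apply/subvPn; apply/negP => /dimvS; rewrite dH ltnn.
  have WU := subv_trans WH HU.
  have wW : w \notin W by apply: contra wH'; exact: subvP.
  rewrite -(@wt_restrict S (W + <[w]>)%VS W) ?addvSl //.
    by apply: e; rewrite ?subv_add ?WU -?memvE // dim_addline // dW.
  move=> x xS xWw; have xH : x \in H.
    by apply: sub => //; apply: subvP xWw; rewrite subv_add WU -memvE.
  case/memv_addP: xWw xH => a aW [_ /vlineP[c ->] ->] acH.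
  have [->|c0] := eqVneq c 0; first by rewrite scale0r addr0.
  move: wH'; rewrite -[w](scalerK c0) rpredZ //.
  by rewrite -[c *: w](addKr a) rpredD // rpredN (subvP WH).
have [|A [AH dA eA sA]] := IH H hS eH _ wH; first by lia.
exists A; split=> //; first exact: subv_trans HU.
by move=> x xS xU; apply: sA => //; exact: sub.
Qed.

End Projection.

(** * Hyperovals through a frame *)

Section Arcs.
Variables (F : finFieldType) (N : nat).
Local Notation V := 'rV[F]_N.
Local Notation q := #|F|.
Implicit Types (S : {set V}) (U W H L M P A : {vspace V}) (x y v : V).

(** With at most 2 points on each of the q + 1 lines through a point, q + 2 points are reached only
    if all these lines are 2-secants. *)
Lemma arc_evenset S U : homog S -> \dim U = 3%N -> wt S U = (q + 2)%N ->
  (forall L, (L <= U)%VS -> \dim L = 2%N -> (wt S L <= 2)%N) -> evenset S U.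
Proof.
move=> hS dU wU le L LU dL.
have [->//|p] := posnP (wt S L); have /(wt_gt0P _ hS)[x xS xL] := p.
have x0 := homog_neq0 hS xS; have xU := subvP LU _ xL.
have xU' : (<[x]> <= U)%VS by rewrite -memvE.
have dx : \dim <[x]> = 1%N by rewrite dim_vline x0.
have cL : cover <[x]> U L by apply/coverP; rewrite -memvE dx.
have [|n1] := wt_cover_but hS xU' cL (k := q); first by rewrite ncov_codim2 // dx.
rewrite wt_line // xS muln1 wU => sw.
have : (\sum_(M | cover <[x]> U M && (M != L)) wt S M <= q * 2)%N.
  rewrite -n1 -sum_nat_const; apply: leq_sum => M /andP[/coverP[_ MU dM] _].
  by apply: le; rewrite // dM dx.
have := le L LU dL; move: p sw; move: (\sum_(i | _) _)%N => T; move: (wt S L) #|F| => w Q.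
by clear; case: w => [|[|[|w]]] // _; lia.
Qed.

Lemma hyperoval_secant S U x y : homog S -> evenset S U -> \dim U = 3%N ->
  wt S U = (q + 2)%N -> x \in S -> x \in U -> y \in U -> y \notin <[x]>%VS ->
  #|[set s : F | y + s *: x \in S]| = 1%N.
Proof.
move=> hS e dU wU xS xU yU yx; have x0 := homog_neq0 hS xS.
have LU : (<[y]> + <[x]> <= U)%VS by rewrite subv_add -!memvE yU xU.
have dL := dim_span2 x0 yx.
have := hyperoval_line_le hS e dU wU LU dL.
have := even_line_ge2 hS e LU dL xS (subvP (addvSr _ _) _ (memv_line x)).
by rewrite wt_line2 // xS; move: #|_| => [|[|]].
Qed.

Lemma hyperoval_no3 S U x y s : homog S -> evenset S U -> \dim U = 3%N ->
  wt S U = (q + 2)%N -> x \in S -> x \in U -> y \in S -> y \in U -> y \notin <[x]>%VS ->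
  s != 0 -> y + s *: x \notin S.
Proof.
move=> hS e dU wU xS xU yS yU yx s0; apply/negP => h.
have := hyperoval_secant hS e dU wU xS xU yU yx.
suff : (1 < #|[set s : F | (y + s *: x)%R \in S]|)%N by move=> + c1; rewrite c1.
apply/card_gt1P; exists 0, s; rewrite !inE scale0r addr0 yS h eq_sym s0.
by [].
Qed.

End Arcs.

Section OPolynomials.
Variable F : finFieldType.
Local Notation q := #|F|.
Implicit Types (f : {ffun F -> F}) (h : {set 'rV[F]_3}).

Definition o0 : 'I_3 := @Ordinal 3 0 isT.
Definition o1 : 'I_3 := @Ordinal 3 1 isT.
Definition o2 : 'I_3 := @Ordinal 3 2 isT.

Definition row3 (x y z : F) : 'rV[F]_3 := \row_(i < 3) [:: x; y; z]`_i.

Lemma row3E (v : 'rV[F]_3) : v = row3 (v 0 o0) (v 0 o1) (v 0 o2).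
Proof.
apply/rowP => -[[|[|[|//]]] i]; rewrite mxE /=; congr (v _ _); exact: val_inj.
Qed.

Lemma row3_inj x y z x' y' z' : row3 x y z = row3 x' y' z' -> [/\ x = x', y = y' & z = z'].
Proof.
by move=> e; have h i := congr1 (fun M : 'rV_3 => M 0 i) e; split; [have := h o0|have := h o1|have := h o2]; rewrite !mxE.
Qed.

Lemma row3D x y z x' y' z' : row3 x y z + row3 x' y' z' = row3 (x + x') (y + y') (z + z').
Proof. by apply/rowP => -[[|[|[|//]]] i]; rewrite !mxE. Qed.

Lemma row3Z a x y z : a *: row3 x y z = row3 (a * x) (a * y) (a * z).
Proof. by apply/rowP => -[[|[|[|//]]] i]; rewrite !mxE. Qed.

Lemma row3_eq0 x y z : (row3 x y z == 0) = [&& x == 0, y == 0 & z == 0].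
Proof.
have -> : 0 = row3 0 0 0 by apply/rowP => -[[|[|[|//]]] i]; rewrite !mxE.
apply/eqP/and3P => [/row3_inj[-> -> ->]|[/eqP-> /eqP-> /eqP->]] //; by rewrite eqxx.
Qed.

Lemma row3_line x y z x' y' z' : row3 x y z \in <[row3 x' y' z']>%VS ->
  exists a, [/\ x = a * x', y = a * y' & z = a * z'].
Proof. by move=> /vlineP[a]; rewrite row3Z => /row3_inj[-> -> ->]; exists a. Qed.

Definition frame h := [&& row3 1 0 0 \in h, row3 0 1 0 \in h, row3 0 0 1 \in h & row3 1 1 1 \in h].

(** The o-polynomials, taken as functions. The last clause says that no three points (1, s, f s) are
    collinear, injectivity that no two of them are collinear with (0, 1, 0). *)
Definition opoly f := [&& f 0 == 0, f 1 == 1, injectiveb f &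
  [forall s, forall t, forall u, [&& s != t, s != u & t != u] ==>
     ((f s - f t) * (s - u) != (f s - f u) * (s - t))]].

(* The points (1, t, f t) together with (0, 1, 0) and (0, 0, 1). *)
Definition hov f : {set 'rV[F]_3} := [set v : 'rV[F]_3 |
  if v 0 o0 != 0 then v 0 o2 == v 0 o0 * f (v 0 o1 / v 0 o0)
  else (v 0 o1 == 0) != (v 0 o2 == 0)].

Lemma mem_hov f x y z : (row3 x y z \in hov f) =
  if x != 0 then z == x * f (y / x) else (y == 0) != (z == 0).
Proof. by rewrite inE !mxE. Qed.

Lemma hov_homog f : homog (hov f).
Proof.
split=> [|a v a0]; first by rewrite inE !mxE eqxx /= eqxx.
rewrite (row3E v) row3Z !mem_hov mulf_eq0 (negPf a0) /=.
case: eqP => [_|_] /=; first by rewrite !mulf_eq0 (negPf a0).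
by rewrite -mulf_div divff // mul1r -mulrA (inj_eq (mulfI a0)).
Qed.

Lemma hov_inj : injective hov.
Proof.
move=> f g fg; apply/ffunP => t; have /setP/(_ (row3 1 t (f t))) := fg.
by rewrite !mem_hov oner_eq0 /= divr1 !mul1r eqxx => /esym/eqP.
Qed.

Lemma opolyP f : reflect [/\ f 0 = 0, f 1 = 1, injective f &
  forall s t u, s != t -> s != u -> t != u -> (f s - f t) * (s - u) != (f s - f u) * (s - t)]
  (opoly f).
Proof.
apply: (iffP and4P) => [[/eqP f0 /eqP f1 /injectiveP fi /forallP arc]|[f0 f1 fi arc]].
  split=> // s t u st su tu.
  by have /forallP/(_ t)/forallP/(_ u)/implyP := arc s; apply; rewrite st su.
split; try exact/eqP; first exact/injectiveP.
by apply/forallP => s; apply/forallP => t; apply/forallP => u; apply/implyP => /and3P[]; exact: arc.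
Qed.

Lemma hov_not_collinear f x y1 y2 c : opoly f -> x \in hov f -> y1 \in hov f ->
  y2 \in hov f -> y2 \notin <[x]>%VS -> c != 0 -> y1 != y2 + c *: x.
Proof.
move=> /opolyP[f0 f1 fi arc].
rewrite (row3E x) (row3E y1) (row3E y2).
move: (x 0 o0) (x 0 o1) (x 0 o2) (y1 0 o0) (y1 0 o1) (y1 0 o2) (y2 0 o0) (y2 0 o1) (y2 0 o2).
move=> {x y1 y2} x0 x1 x2 y0 y1 y2 z0 z1 z2.
rewrite !mem_hov row3Z row3D => xh yh zh zx c0; apply/eqP => /row3_inj[e0 e1 e2].
have colinear a : z0 = a * x0 -> z1 = a * x1 -> z2 = a * x2 -> False.
  by move=> a0 a1 a2; case/negP: zx; apply/vlineP; exists a; rewrite row3Z -a0 -a1 -a2.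
have [x00|x00] := eqVneq x0 0; rewrite ?x00 ?eqxx /= in xh.
  rewrite x00 mulr0 addr0 in e0; rewrite {y0}e0 in yh.
  have [z00|z00] := eqVneq z0 0; rewrite ?z00 ?eqxx /= in yh zh.
    move: xh yh zh; rewrite e1 e2.
    have [x10|x10] := eqVneq x1 0; have [x20|x20] := eqVneq x2 0 => //= _.
      rewrite x10 mulr0 addr0; have [z10|z10] := eqVneq z1 0; have [z20|z20] := eqVneq z2 0 => //=.
        move=> _ _; apply: (colinear (z2 / x2)); rewrite ?x00 ?x10 ?mulr0 //.
        by rewrite divfK.
      by rewrite z20 add0r mulf_eq0 (negPf c0) (negPf x20).
    rewrite x20 mulr0 addr0; have [z10|z10] := eqVneq z1 0; have [z20|z20] := eqVneq z2 0 => //=.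
      by rewrite z10 add0r mulf_eq0 (negPf c0) (negPf x10).
    move=> _ _; apply: (colinear (z1 / x1)); rewrite ?x00 ?x20 ?mulr0 //.
    by rewrite divfK.
  move: yh zh => /eqP y2E /eqP z2E.
  have [x10|x10] := eqVneq x1 0.
    rewrite x10 mulr0 addr0 in e1; rewrite x10 eqxx /= in xh.
    have x20 : c * x2 != 0 by rewrite mulf_neq0 //; move: xh; case: (x2 == 0).
    by case/eqP: x20; apply: (@addrI _ z2); rewrite addr0 -e2 y2E e1 -z2E.
  have x20 : x2 = 0 by apply/eqP; move: xh; rewrite (negPf x10); case: (x2 == 0).
  move: e2; rewrite x20 mulr0 addr0 y2E z2E => /(mulfI z00)/fi.
  move=> /(mulIf (_ : z0^-1 != 0)); rewrite invr_eq0 => /(_ z00).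
  by rewrite e1 -[RHS]addr0 => /addrI/eqP; rewrite mulf_eq0 (negPf c0) (negPf x10).
move/eqP: xh => xE.
have [z00|z00] := eqVneq z0 0; rewrite ?z00 ?eqxx /= in zh.
  have y00 : y0 != 0 by rewrite e0 z00 add0r mulf_neq0.
  rewrite y00 in yh; move/eqP: yh; rewrite e2 e1 {1}e0 z00 add0r xE.
  have [z10|z10] := eqVneq z1 0.
    have z20 : z2 != 0 by move: zh; rewrite z10 eqxx /=; case: (z2 == 0).
    rewrite e0 z00 z10 !add0r -mulf_div divff // mul1r -mulrA -[RHS]add0r => /addIr.
    by apply/eqP.
  have z20 : z2 = 0 by apply/eqP; move: zh; rewrite (negPf z10); case: (z2 == 0).
  rewrite z20 add0r mulrA => /(mulfI (mulf_neq0 c0 x00))/fi.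
  rewrite e0 z00 add0r mulrDl -mulf_div divff // mul1r -[LHS]add0r => /addIr/esym/eqP.
  by rewrite mulf_eq0 (negPf z10) invr_eq0 mulf_eq0 (negPf c0) (negPf x00).
move/eqP: zh => zE.
have [y00|y00] := eqVneq y0 0; rewrite ?y00 ?eqxx /= in yh.
  have z0E : z0 = - (c * x0) by apply/eqP; rewrite -addr_eq0 -e0 y00.
  have z1E : z1 = y1 - c * x1 by rewrite e1 addrK.
  have z2E : z2 = y2 - c * x2 by rewrite e2 addrK.
  have cx0 : c * x0 != 0 by rewrite mulf_neq0.
  have z10E : z1 / z0 = x1 / x0 - y1 / (c * x0).
    by rewrite z1E z0E; field; rewrite x00 c0 oppr_eq0.
  have [y10|y10] := eqVneq y1 0.
    have y20 : y2 != 0 by move: yh; rewrite y10 eqxx /=; case: (y2 == 0).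
    move: zE; rewrite z10E y10 mul0r subr0 z2E z0E xE => /eqP.
    rewrite mulNr -mulrA -[X in _ == X]add0r (inj_eq (addIr _)); exact/negP.
  have y20 : y2 = 0 by apply/eqP; move: yh; rewrite (negPf y10); case: (y2 == 0).
  have ncx0 : - (c * x0) != 0 by rewrite oppr_eq0.
  move: zE; rewrite z2E y20 sub0r xE z0E mulrA -[- (c * x0 * _)]mulNr => /(mulfI ncx0)/fi.
  rewrite -z0E z10E -{1}[x1 / x0]subr0 => /addrI/oppr_inj/esym/eqP.
  by rewrite mulf_eq0 (negPf y10) invr_eq0 (negPf cx0).
move/eqP: yh => yE.
(* All three points are finite. With [s], [t], [u] as their parameters, [k1] and [k2] say that the
   chords from [s] to [t] and to [u] are parallel, which [arc] forbids. *)
pose s := x1 / x0; pose t := y1 / y0; pose u := z1 / z0.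
have x1E : x1 = x0 * s by rewrite /s mulrC divfK.
have y1E : y1 = y0 * t by rewrite /t mulrC divfK.
have z1E : z1 = z0 * u by rewrite /u mulrC divfK.
have su : s != u.
  apply/eqP => su; apply: (colinear (z0 / x0)); first by rewrite divfK.
    by rewrite z1E -su x1E mulrA divfK.
  by rewrite zE -/u -su xE mulrA divfK.
have k1 : y0 * (t - s) = z0 * (u - s).
  have := e1; rewrite x1E y1E z1E e0 => h.
  have -> : (z0 + c * x0) * (t - s) = (z0 + c * x0) * t - (z0 + c * x0) * s by rewrite mulrBr.
  by rewrite h; ring.
have k2 : y0 * (f t - f s) = z0 * (f u - f s).
  have := e2; rewrite xE yE zE -/s -/t -/u e0 => h.
  have -> : (z0 + c * x0) * (f t - f s) = (z0 + c * x0) * f t - (z0 + c * x0) * f s by rewrite mulrBr.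
  by rewrite h; ring.
have ts : t != s.
  apply: contra su => /eqP ts; move: k1; rewrite ts subrr mulr0 => /esym/eqP.
  by rewrite mulf_eq0 (negPf z00) subr_eq0 eq_sym.
have tu : t != u.
  apply: contra su => /eqP tu; move: k1; rewrite tu => /eqP.
  rewrite -subr_eq0 -mulrBl e0 addrAC subrr add0r mulf_eq0 mulf_eq0 (negPf c0) (negPf x00) /=.
  by rewrite subr_eq0 eq_sym.
have := arc s t u; rewrite eq_sym ts su tu => /(_ isT isT isT)/eqP; apply.
apply: (mulfI (mulf_neq0 y00 z00)).
have -> : y0 * z0 * ((f s - f t) * (s - u)) = (y0 * (f t - f s)) * (z0 * (u - s)) by ring.
have -> : y0 * z0 * ((f s - f u) * (s - t)) = (z0 * (f u - f s)) * (y0 * (t - s)) by ring.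
by rewrite k1 k2.
Qed.

(** Every line through (0, 0, 1) carries exactly one further point. *)
Lemma hov_wt f : wt (hov f) fullv = (q + 2)%N.
Proof.
have hh := hov_homog f; pose p := row3 0 0 1.
have ph : p \in hov f by rewrite mem_hov !eqxx /= oner_eq0.
have p0 := homog_neq0 hh ph; have dp : \dim <[p]> = 1%N by rewrite dim_vline p0.
have d3 : \dim {:'rV[F]_3} = 3%N by rewrite dimvf /dim /= mul1n.
have n1 : ncov <[p]> fullv = q.+1 by rewrite ncov_codim2 ?subvf // dp d3.
have := wt_cover hh (subvf <[p]>%VS); rewrite n1 wt_line // ph muln1.
have -> : (\sum_(L | cover <[p]> fullv L) wt (hov f) L = q.+1 * 2)%N.
  rewrite -(cover_card n1) -sum_nat_const; apply: eq_bigr => L cL.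
  have [pL _ dL] := coverP _ _ _ cL.
  have [y yL yp] : exists2 y, y \in L & y \notin <[p]>%VS.
    by apply/subvPn; apply/negP => /dimvS; rewrite dL ltnn.
  rewrite (cover_eq cL yL yp) addvC wt_line2 // ph; congr (1 + _)%N.
  move: yp; rewrite (row3E y) => yp; move: (y 0 o0) (y 0 o1) (y 0 o2) yp => a b c abc.
  have [a0|a0] := eqVneq a 0.
    have b0 : b != 0.
      apply: contra abc => /eqP b0; apply/vlineP; exists c; by rewrite row3Z a0 b0 !mulr0 mulr1.
    apply/eqP/cards1P; exists (- c); apply/setP => s; rewrite in_set in_set1 /p row3Z row3D.
    rewrite mem_hov a0 !mulr0 !addr0 eqxx /= (negPf b0) mulr1.
    by rewrite -[RHS]subr_eq0 opprK addrC; case: (s + c == 0).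
  apply/eqP/cards1P; exists (a * f (b / a) - c); apply/setP => s.
  rewrite in_set in_set1 /p row3Z row3D mem_hov !mulr0 !addr0 a0 mulr1.
  by rewrite [RHS]eq_sym subr_eq eq_sym addrC.
by move: (wt _ _) #|F| => w Q; clear; lia.
Qed.

Lemma hov_hyperoval f : opoly f ->
  [/\ homog (hov f), evenset (hov f) fullv, wt (hov f) fullv = (q + 2)%N & frame (hov f)].
Proof.
move=> of_; have hh := hov_homog f; have w := hov_wt f.
have d3 : \dim {:'rV[F]_3} = 3%N by rewrite dimvf /dim /= mul1n.
split=> //; last first.
  have [f0 f1 _ _] := opolyP _ of_.
  by rewrite /frame !mem_hov !eqxx oner_eq0 /= mul0r divr1 f0 f1 mulr0 mulr1 !eqxx.
apply: arc_evenset => // L _ dL; rewrite leqNgt; apply/negP => w3.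
have /(wt_gt0P _ hh)[x xS xL] : (0 < wt (hov f) L)%N by exact: ltn_trans w3.
have x0 := homog_neq0 hh xS.
have [y yx eL] := line_through dL xL x0.
move: w3; rewrite eL wt_line2 // xS add1n ltnS => /card_gt1P[s [t [sT tT st]]].
rewrite !inE in sT tT.
have := @hov_not_collinear f x (y + s *: x) (y + t *: x) (s - t) of_ xS.
rewrite ![_ \in hov f]inE sT tT => /(_ isT isT).
have -> : y + t *: x \notin <[x]>%VS.
  apply: contra yx => h; rewrite -[y](addrK (t *: x)) rpredB //.
  by rewrite rpredZ // memv_line.
rewrite subr_eq0 st => /(_ isT isT); rewrite -addrA -scalerDl [t + _]addrC subrK eqxx.
by [].
Qed.

Lemma frame_hov h : homog h -> evenset h fullv -> wt h fullv = (q + 2)%N -> frame h ->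
  exists2 f, opoly f & h = hov f.
Proof.
move=> hh e w /and4P[e0 e1 e2 e3].
have d3 : \dim {:'rV[F]_3} = 3%N by rewrite dimvf /dim /= mul1n.
have sec x y := @hyperoval_secant F 3 h fullv x y hh e d3 w.
have no3 x y s := @hyperoval_no3 F 3 h fullv x y s hh e d3 w.
have nl a b c x y z : (forall k, a = k * x -> b = k * y -> c = k * z -> False) ->
    row3 a b c \notin <[row3 x y z]>%VS.
  by move=> k; apply/negP => /row3_line[m [? ? ?]]; exact: (k m).
have ex t : exists u, [set s | row3 1 t s \in h] = [set u].
  have tn : row3 1 t 0 \notin <[(row3 0 0 1)%R]>%VS.
    by apply: nl => k /eqP; rewrite mulr0 oner_eq0.
  have /eqP/cards1P[u eu] := sec (row3 0 0 1) (row3 1 t 0) e2 (memvf _) (memvf _) tn.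
  exists u; rewrite -eu; apply/setP => s; rewrite !inE row3Z row3D.
  by rewrite !mulr0 !addr0 mulr1 add0r.
(* By [ex] there is exactly one such [u], so the default value is never taken. *)
pose f : {ffun F -> F} := [ffun t => odflt 0 [pick u | row3 1 t u \in h]].
have fE t u : (row3 1 t u \in h) = (u == f t).
  rewrite ffunE; have [v /setP vP] := ex t.
  have hv w' : (row3 1 t w' \in h) = (w' == v) by have := vP w'; rewrite !inE.
  by case: pickP => [w'|/(_ v)]; rewrite hv ?eqxx // => /eqP ->.
have hE : h = hov f.
  apply/setP => v; rewrite (row3E v) mem_hov.
  move: (v 0 o0) (v 0 o1) (v 0 o2) => x y z.
  have [->|x0] := eqVneq x 0; last first.
    have -> : row3 x y z = x *: row3 1 (y / x) (z / x).
      by rewrite row3Z mulr1 !mulrA ![x * _]mulrC !mulfK.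
    by rewrite homogZ // fE -(inj_eq (mulfI x0)) mulrCA divff // mulr1.
  have [->|y0] := eqVneq y 0; have [->|z0] := eqVneq z 0 => /=.
  - by apply: negbTE; have -> : row3 0 0 0 = 0; [apply/eqP; rewrite row3_eq0 eqxx|exact: (proj1 hh)].
  - by rewrite -[z]mulr1 -(mulr0 z) -row3Z homogZ.
  - by rewrite -[y]mulr1 -(mulr0 y) -row3Z homogZ.
  apply: negbTE; have -> : row3 0 y z = y *: row3 0 1 0 + z *: row3 0 0 1.
    by rewrite !row3Z row3D !mulr0 !mulr1 !addr0 add0r.
  apply: no3 => //; rewrite ?memvf ?homogZ //; apply/negP; rewrite row3Z => /row3_line[k].
  by case=> _ /eqP; rewrite !mulr0 mulr1 (negPf y0).
exists f => //; apply/opolyP; split.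
- by apply/esym/eqP; rewrite -fE.
- by apply/esym/eqP; rewrite -fE.
- move=> s t fst; apply/eqP; rewrite -subr_eq0; apply/negP => /negP st.
  have := no3 (row3 0 1 0) (row3 1 t (f t)) (s - t) e1 (memvf _) _ (memvf _).
  rewrite fE eqxx row3Z row3D !mulr0 !addr0 mulr1 [t + _]addrC subrK -fst fE eqxx.
  have -> : row3 1 t (f s) \notin <[(row3 0 1 0)%R]>%VS.
    by apply: nl => k /eqP; rewrite mulr0 oner_eq0.
  by move/(_ isT isT st).
move=> s t u st su tu; apply/eqP => arc.
have st' : s - t != 0 by rewrite subr_eq0.
have su' : s - u != 0 by rewrite subr_eq0.
(* The weight for which the affine combination of the points at [s] and [t] has parameter [u]; the
   equality [arc] then makes it the point at [u]. *)
pose b := (s - u) / (s - t).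
have b1 : 1 - b != 0.
  rewrite subr_eq0; apply: contra tu => /eqP /(congr1 ( *%R^~ (s - t))).
  by rewrite mul1r /b divfK // => /addrI/oppr_inj ->.
have b0 : b != 0 by rewrite mulf_neq0 ?invr_eq0.
have := no3 ((1 - b) *: row3 1 s (f s)) (b *: row3 1 t (f t)) 1.
rewrite !homogZ // !fE !eqxx !memvf => /(_ isT isT isT isT); rewrite oner_eq0 scale1r.
have -> : b *: row3 1 t (f t) \notin <[((1 - b) *: row3 1 s (f s))%R]>%VS.
  rewrite !row3Z; apply: nl => k; rewrite !mulr1 => k1 /eqP; rewrite mulrA -k1.
  by rewrite (inj_eq (mulfI b0)) eq_sym (negPf st).
move=> /(_ isT isT)/negP; apply.
rewrite !row3Z row3D !mulr1 [b + _]addrC subrK.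
have -> : b * t + (1 - b) * s = u by rewrite /b; field.
rewrite fE; apply/eqP/(mulfI st').
have -> : (s - t) * (b * f t + (1 - b) * f s) = (s - t) * f s - (f s - f t) * (s - u).
  by rewrite /b; field.
by rewrite arc; ring.
Qed.

End OPolynomials.

(** * The hyperovals of PG(2,4) and PG(2,8) *)

(* The field with p + 1 elements (p prime) is coded by 0, ..., p: the code 0
   stands for 0 and the code i + 1 for a^i, where a is a generator of the
   multiplicative group; [z] lists the Zech logarithms, 1 + a^i = a^(z_i). *)
Section CodedArithmetic.
Variables (p : nat) (z : seq nat).
Local Open Scope nat_scope.

Definition mulc c d := if c is i.+1 then if d is j.+1 then ((i + j) %% p).+1 else 0 else 0.

Definition addc c d :=
  if c is i.+1 then if d is j.+1 then
    if i == j then 0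
    else if i < j then mulc c (nth 0 z (j - i)).+1 else mulc d (nth 0 z (i - j)).+1
  else c else d.

Definition invc c := if c is i.+1 then ((p - i) %% p).+1 else 0.

Definition arcc s fs t ft u fu :=
  mulc (addc fs ft) (addc s u) != mulc (addc fs fu) (addc s t).

(** The test for a table of values [l] to be continued by [v]. The second clause forces the entries
    at the codes 0 and 1 to be 0 and 1. *)
Definition okc l v :=
  [&& v \notin l, (1 < size l) || (v == size l) &
   all (fun t => all (fun u => arcc (size l) v t (nth 0 l t) u (nth 0 l u)) (iota 0 t))
     (iota 0 (size l))].

Fixpoint gen n :=
  if n is m.+1 then flatten [seq [seq rcons l v | v <- iota 0 p.+1 & okc l v] | l <- gen m]
  else [:: [::]].

(** The complete test, evaluated on the output of [gen]: what is proved about [gen] is only that it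
    misses no table. *)
Definition opolyc T :=
  [&& size T == p.+1, all (fun c => c < p.+1) T, nth 0 T 0 == 0, nth 0 T 1 == 1, uniq T &
   all (fun s => all (fun t => all (fun u => [&& s != t, s != u & t != u] ==>
     arcc s (nth 0 T s) t (nth 0 T t) u (nth 0 T u)) (iota 0 p.+1)) (iota 0 p.+1)) (iota 0 p.+1)].

Definition dotc x y w M j :=
  addc (addc (mulc x (nth 0 M j)) (mulc y (nth 0 M (3 + j)))) (mulc w (nth 0 M (6 + j))).

Definition memc T x y w :=
  if x != 0 then w == mulc x (nth 0 T (mulc y (invc x))) else (y == 0) != (w == 0).

Definition movec T M x y w := memc T (dotc x y w M 0) (dotc x y w M 1) (dotc x y w M 2).

Definition inverse_mxc M M' :=
  all (fun i => all (fun j =>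
    dotc (nth 0 M (3 * i)) (nth 0 M (3 * i + 1)) (nth 0 M (3 * i + 2)) M' j == (i == j))
    (iota 0 3)) (iota 0 3).

(** Only the forward inclusion is tested, on one representative of each point; equality follows from
    equal cardinalities. *)
Definition transportc T0 (d : seq nat * seq nat * seq nat) :=
  let: (T, M, M') := d in
  [&& all (fun c => c < p.+1) M, all (fun c => c < p.+1) M', inverse_mxc M M',
   movec T0 M 0 1 0, movec T0 M 0 0 1 &
   all (fun t => movec T0 M 1 t (nth 0 T t)) (iota 0 p.+1)].

Lemma mem_gen n T : size T = n -> (forall i, i < n -> nth 0 T i < p.+1) ->
  (forall i, i < n -> okc (take i T) (nth 0 T i)) -> T \in gen n.
Proof.
elim: n T => [|n IH] T; first by move=> /size0nil -> _ _; rewrite inE.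
case/lastP: T => // T v; rewrite size_rcons => -[sT] bd ok.
have nthT i : i < n -> nth 0 (rcons T v) i = nth 0 T i by move=> lt; rewrite nth_rcons sT lt.
have ev : nth 0 (rcons T v) n = v by rewrite nth_rcons sT ltnn eqxx.
have takeT i : i <= n -> take i (rcons T v) = take i T.
  by move=> le; rewrite -cats1 take_cat sT; case: ltngtP le => // -> _; rewrite subnn take0 cats0 take_oversize ?sT.
apply/flatten_mapP; exists T.
  apply: IH => // i lt; first by rewrite -nthT // bd // ltnW.
  by rewrite -nthT // -takeT ?(ltnW lt) // ok // ltnW.
apply/mapP; exists v => //; rewrite mem_filter mem_iota /= add0n.
have := ok n (ltnSn n); rewrite ev takeT // take_oversize ?sT // => ->.
by rewrite -ev bd.
Qed.

Lemma mulc_lt c d : 0 < p -> mulc c d < p.+1.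
Proof. by move=> p0; case: c d => [|i] [|j] //=; rewrite ltnS ltn_mod. Qed.

Lemma addc_lt c d : 0 < p -> c < p.+1 -> d < p.+1 -> addc c d < p.+1.
Proof.
move=> p0; rewrite /addc; case: c d => [|i] [|j] // ci dj; case: eqP => // _.
by case: ifP => _; exact: mulc_lt.
Qed.

Lemma dotc_lt x y w M j : 0 < p -> dotc x y w M j < p.+1.
Proof. by move=> p0; rewrite !addc_lt ?mulc_lt. Qed.

End CodedArithmetic.

(** * From codes to field elements *)

Section Decoding.
Variables (F : finFieldType) (p : nat) (z : seq nat) (a : F).
Hypotheses (p_pr : prime p) (cF : #|F| = p.+1) (ch2 : forall x : F, x + x = 0).
Hypotheses (a0 : a != 0) (a1 : a != 1).
Hypothesis zechP : forall i, (0 < i < p)%N -> 1 + a ^+ i = a ^+ (nth 0%N z i).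

Let p0 : (0 < p)%N := prime_gt0 p_pr.

Definition dec c := if c is i.+1 then a ^+ i else 0.

Let ap : a ^+ p = 1.
Proof. by apply: (mulfI a0); rewrite -exprS -cF finfield.expf_card mulr1. Qed.

Let amod i : a ^+ (i %% p) = a ^+ i.
Proof. by rewrite [in RHS](divn_eq i p) exprD mulnC exprM ap expr1n mul1r. Qed.

Lemma dec_mul c d : dec (mulc p c d) = dec c * dec d.
Proof. by case: c d => [|i] [|j] /=; rewrite ?mul0r ?mulr0 // amod exprD. Qed.

Lemma dec_add c d : (c < p.+1)%N -> (d < p.+1)%N -> dec (addc p z c d) = dec c + dec d.
Proof.
case: c d => [|i] [|j] /=; rewrite ?add0r ?addr0 // !ltnS => ip jp.
case: eqP => [->|ij]; first by rewrite /= ch2.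
case: ltngtP ij => // lt _; rewrite /= amod exprD -zechP ?subn_gt0 ?lt //=.
- by rewrite mulrDr mulr1 -exprD subnKC // ltnW.
- by apply: leq_ltn_trans (leq_subr _ _) jp.
- by rewrite mulrDr mulr1 -exprD subnKC 1?addrC // ltnW.
by apply: leq_ltn_trans (leq_subr _ _) ip.
Qed.

Lemma dec_inv c : (c < p.+1)%N -> dec (invc p c) = (dec c)^-1.
Proof.
case: c => [|i] /=; rewrite ?invr0 // ltnS => ip.
apply: (mulfI (expf_neq0 i a0)); rewrite divff ?expf_neq0 // amod -exprD subnKC ?ap //.
exact: ltnW.
Qed.

(** Since [p] is prime, every field element other than 0 and 1 generates the multiplicative
    group. *)
Lemma dec_inj c d : (c < p.+1)%N -> (d < p.+1)%N -> dec c = dec d -> c = d.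
Proof.
have key i j : (i < j)%N -> (j < p)%N -> a ^+ i != a ^+ j.
  move=> ij jp; apply: contra a1 => /eqP e.
  have ji : a ^+ (j - i) = 1.
    by apply: (mulfI (expf_neq0 i a0)); rewrite -exprD subnKC 1?ltnW // mulr1.
  have cp : coprime (j - i) p.
    rewrite coprime_sym prime_coprime // gtnNdvd ?subn_gt0 //.
    exact: leq_ltn_trans (leq_subr _ _) jp.
  have [|km kn e1 _] := @egcdnP (j - i) p; first by rewrite subn_gt0.
  have := congr1 (fun m => a ^+ m) e1; rewrite /= mulnC exprM ji expr1n (eqP cp).
  by rewrite exprD mulnC exprM ap expr1n mul1r expr1 => <-.
case: c d => [|i] [|j] //=; rewrite ?ltnS => ip jp.
- by move/esym/eqP; rewrite (negPf (expf_neq0 _ a0)).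
- by move/eqP; rewrite (negPf (expf_neq0 _ a0)).
move=> eij; congr _.+1; case: (ltngtP i j) => // lt.
- by have := key _ _ lt jp; rewrite eij eqxx.
by have := key _ _ lt ip; rewrite eij eqxx.
Qed.

Definition enc (x : F) := index x [seq dec c | c <- iota 0 p.+1].

Lemma dec_uniq : uniq [seq dec c | c <- iota 0 p.+1].
Proof.
rewrite map_inj_in_uniq ?iota_uniq // => c d; rewrite !mem_iota !add0n => /andP[_ cl] /andP[_ dl].
exact: dec_inj.
Qed.

Lemma dec_full x : x \in [seq dec c | c <- iota 0 p.+1].
Proof.
have : #|[seq dec c | c <- iota 0 p.+1]| = #|F|.
  by rewrite (card_uniqP dec_uniq) size_map size_iota cF.
by move/subset_cardP => /(_ (subset_predT _)) ->.
Qed.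

Lemma enc_lt x : (enc x < p.+1)%N.
Proof. by have := dec_full x; rewrite -index_mem size_map size_iota. Qed.

Lemma encK x : dec (enc x) = x.
Proof.
by rewrite -{2}(nth_index 0 (dec_full x)) (nth_map 0%N) ?size_iota ?enc_lt // nth_iota ?enc_lt.
Qed.

Lemma decK c : (c < p.+1)%N -> enc (dec c) = c.
Proof. by move=> lt; apply: dec_inj; rewrite ?enc_lt ?encK. Qed.

Lemma dec_eq c d : (c < p.+1)%N -> (d < p.+1)%N -> (dec c == dec d) = (c == d).
Proof. by move=> cl dl; apply/eqP/eqP => [|->//]; exact: dec_inj. Qed.

Let sub_add (x y : F) : x - y = x + y.
Proof. by apply/eqP; rewrite subr_eq -addrA ch2 addr0. Qed.

Lemma dec_arc s fs t ft u fu : all (fun c => c < p.+1)%N [:: s; fs; t; ft; u; fu] ->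
  arcc p z s fs t ft u fu =
  ((dec fs - dec ft) * (dec s - dec u) != (dec fs - dec fu) * (dec s - dec t)).
Proof.
case/and5P=> sl fsl tl ftl /and3P[ul ful _]; rewrite /arcc !sub_add -!dec_add // -!dec_mul.
by rewrite dec_eq ?mulc_lt.
Qed.

Definition untab T : {ffun F -> F} := [ffun x => dec (nth 0%N T (enc x))].

Definition tab (f : {ffun F -> F}) := [seq enc (f (dec c)) | c <- iota 0 p.+1].

Lemma nth_tab f c : (c < p.+1)%N -> nth 0%N (tab f) c = enc (f (dec c)).
Proof. by move=> lt; rewrite (nth_map 0%N) ?size_iota // nth_iota. Qed.

Lemma tabK f : untab (tab f) = f.
Proof. by apply/ffunP => x; rewrite ffunE nth_tab ?enc_lt // !encK. Qed.

Lemma opolyc_nth T c : opolyc p z T -> (nth 0 T c < p.+1)%N.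
Proof.
case/and3P=> _ /allP h _; have [lt|ge] := ltnP c (size T); first exact/h/mem_nth.
by rewrite nth_default.
Qed.

Lemma untabE T c : (c < p.+1)%N -> untab T (dec c) = dec (nth 0%N T c).
Proof. by move=> cl; rewrite ffunE decK. Qed.

Lemma untab_inj T T' : opolyc p z T -> opolyc p z T' -> untab T = untab T' -> T = T'.
Proof.
move=> oT oT' e; have [/eqP sT _] := andP oT; have [/eqP sT' _] := andP oT'.
apply: (@eq_from_nth _ 0%N) => [|i]; first by rewrite sT sT'.
rewrite sT => lt; apply: dec_inj; rewrite ?opolyc_nth //.
by rewrite -!untabE // e.
Qed.

Lemma opoly_untab T : opolyc p z T -> opoly (untab T).
Proof.
move=> oT; have bd c := opolyc_nth c oT.
have [/eqP sT _ /eqP T0 /eqP T1 /andP[uT /allP arc]] := and5P oT.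
apply/opolyP; split.
- by rewrite -[0]/(dec 0) untabE // T0.
- by rewrite -[1]/(dec 1) untabE ?T1 // ltnS.
- move=> x y; rewrite !ffunE => /(dec_inj (bd _) (bd _))/eqP.
  by rewrite nth_uniq ?sT ?enc_lt // => /eqP/(congr1 dec); rewrite !encK.
move=> s t u; rewrite -[s]encK -[t]encK -[u]encK.
move: (enc s) (enc t) (enc u) (enc_lt s) (enc_lt t) (enc_lt u) => {}s {}t {}u sl tl ul.
rewrite !dec_eq // !untabE // => st su tu.
have mi c : (c < p.+1)%N -> c \in iota 0 p.+1 by rewrite mem_iota.
have /allP/(_ t (mi _ tl))/allP/(_ u (mi _ ul)) := arc s (mi _ sl).
by rewrite st su tu /= dec_arc //= sl tl ul !bd.
Qed.

Lemma opoly_tab f : opoly f -> tab f \in gen p z p.+1.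
Proof.
move=> /opolyP[f0 f1 fi arc]; apply: mem_gen => [|i lt|i lt].
- by rewrite size_map size_iota.
- by rewrite nth_tab // enc_lt.
have st : size (take i (tab f)) = i.
  by rewrite size_take size_map size_iota lt.
have ntk t : (t < i)%N -> nth 0%N (take i (tab f)) t = enc (f (dec t)).
  by move=> ti; rewrite nth_take // nth_tab // (ltn_trans ti).
rewrite /okc st nth_tab //; apply/and3P; split.
- apply/negP => /(nthP 0%N)[t]; rewrite st => ti; rewrite ntk // => /(congr1 dec).
  rewrite !encK => /fi ef; have et := dec_inj (ltn_trans ti lt) lt ef.
  by rewrite et ltnn in ti.
- case: i lt {st ntk} => [|[|i]] lt //=.
    by rewrite f0 -[0]/(dec 0) decK.
  by rewrite expr0 f1 -[1]/(dec 1) decK.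
apply/allP => t; rewrite mem_iota add0n => /= ti; apply/allP => u; rewrite mem_iota add0n => /= ut.
have tl := ltn_trans ti lt; have ul := ltn_trans ut tl; have ui := ltn_trans ut ti.
rewrite !ntk // dec_arc /= ?enc_lt ?lt ?tl ?ul // !encK.
by apply: arc; rewrite dec_eq // ?(gtn_eqF ti) ?(gtn_eqF ui) ?(gtn_eqF ut).
Qed.

Lemma card_opoly : all (opolyc p z) (gen p z p.+1) -> uniq (gen p z p.+1) ->
  #|[set f : {ffun F -> F} | opoly f]| = size (gen p z p.+1).
Proof.
move=> /allP ag ug; have um : uniq [seq untab T | T <- gen p z p.+1].
  by rewrite map_inj_in_uniq // => T T' /ag oT /ag oT'; exact: untab_inj.
rewrite -(size_map untab) -(card_uniqP um); apply: eq_card => f; rewrite inE.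
apply/idP/mapP => [/opoly_tab h|[T /ag oT ->]]; last exact: opoly_untab.
by exists (tab f); rewrite ?tabK.
Qed.

Definition mxc (M : seq nat) : 'M[F]_3 := \matrix_(i < 3, j < 3) dec (nth 0%N M (3 * i + j)).

Lemma row3_mulmx x y w (A : 'M[F]_3) :
  row3 x y w *m A = row3 (x * A o0 o0 + y * A o1 o0 + w * A o2 o0)
    (x * A o0 o1 + y * A o1 o1 + w * A o2 o1) (x * A o0 o2 + y * A o1 o2 + w * A o2 o2).
Proof.
apply/rowP => j; rewrite !mxE !big_ord_recl big_ord0 addr0 !mxE /= addrA.
have -> : ord0 = o0 by exact: val_inj.
have -> : lift o0 ord0 = o1 by exact: val_inj.
have -> : lift o0 (lift ord0 ord0) = o2 by exact: val_inj.
case: j => -[|[|[|//]]] i /=; congr (_ * A _ _ + _ * A _ _ + _ * A _ _); exact: val_inj.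
Qed.

Lemma dotcE x y w M (i : 'I_3) (j : nat) : i = j :> nat -> all (fun c => c < p.+1)%N M ->
  (x < p.+1)%N -> (y < p.+1)%N -> (w < p.+1)%N ->
  dec (dotc p z x y w M j) = dec x * mxc M o0 i + dec y * mxc M o1 i + dec w * mxc M o2 i.
Proof.
move=> <- _ xl yl wl; rewrite /dotc !dec_add ?addc_lt ?mulc_lt // !dec_mul !mxE /=.
by rewrite muln0 add0n muln1.
Qed.

Lemma mulmx_codes x y w M : all (fun c => c < p.+1)%N M ->
  (x < p.+1)%N -> (y < p.+1)%N -> (w < p.+1)%N ->
  row3 (dec x) (dec y) (dec w) *m mxc M =
  row3 (dec (dotc p z x y w M 0)) (dec (dotc p z x y w M 1)) (dec (dotc p z x y w M 2)).
Proof.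
by move=> aM xl yl wl; rewrite row3_mulmx (@dotcE _ _ _ _ o0) // (@dotcE _ _ _ _ o1) // (@dotcE _ _ _ _ o2).
Qed.

Lemma memcE T x y w : opolyc p z T -> (x < p.+1)%N -> (y < p.+1)%N -> (w < p.+1)%N ->
  memc p T x y w = (row3 (dec x) (dec y) (dec w) \in hov (untab T)).
Proof.
move=> oT xl yl wl; rewrite mem_hov /memc.
have eq0 c : (c < p.+1)%N -> (dec c == 0) = (c == 0%N).
  by move=> cl; rewrite -[0]/(dec 0) dec_eq.
rewrite !eq0 //; case: eqP => _ //=.
by rewrite -dec_inv // -dec_mul untabE ?mulc_lt // -dec_mul dec_eq ?mulc_lt.
Qed.

Lemma movecE T M x y w : opolyc p z T -> all (fun c => c < p.+1)%N M ->
  (x < p.+1)%N -> (y < p.+1)%N -> (w < p.+1)%N ->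
  movec p z T M x y w = (row3 (dec x) (dec y) (dec w) *m mxc M \in hov (untab T)).
Proof. by move=> oT aM xl yl wl; rewrite /movec memcE ?dotc_lt // mulmx_codes. Qed.

Lemma inverse_mxcE M M' : all (fun c => c < p.+1)%N M -> all (fun c => c < p.+1)%N M' ->
  inverse_mxc p z M M' -> mxc M \in unitmx.
Proof.
move=> aM aM' /allP h; suff /mulmx1_unit[] : mxc M *m mxc M' = 1%:M by [].
have bd c : (nth 0%N M c < p.+1)%N.
  have [lt|ge] := ltnP c (size M); first exact: (allP aM) (mem_nth _ lt).
  by rewrite nth_default.
apply/matrixP => i j; rewrite !mxE.
have -> : \sum_k mxc M i k * mxc M' k j = dec (dotc p z (nth 0 M (3 * i)) (nth 0 M (3 * i + 1))
    (nth 0 M (3 * i + 2)) M' j).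
  rewrite (@dotcE _ _ _ _ j) // !big_ord_recl big_ord0 addr0 addrA !mxE /= addn0.
  by congr (_ * dec (nth _ _ _) + _ * dec (nth _ _ _) + _ * dec (nth _ _ _)).
have m3 (k : 'I_3) : (k : nat) \in iota 0 3 by rewrite mem_iota add0n /=.
have /allP hj := h _ (m3 i); have /eqP -> := hj _ (m3 j).
by rewrite -val_eqE; case: (_ == _).
Qed.

Lemma transport_hov T0 d : opolyc p z T0 -> opolyc p z d.1.1 -> transportc p z T0 d ->
  exists2 A : 'M[F]_3, A \in unitmx &
    forall y, (y \in hov (untab d.1.1)) = (y *m A \in hov (untab T0)).
Proof.
case: d => [[T M] M'] oT0; rewrite -[_.1.1]/T => oT; set h0 := hov (untab T0) => /and5P[aM aM' inv m1 /andP[m2 /allP mt]].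
have uM := inverse_mxcE aM aM' inv; exists (mxc M) => //.
have hh := hov_homog (untab T); have hh0 : homog h0 by exact: hov_homog.
have p1 : (1 < p.+1)%N by rewrite ltnS.
rewrite movecE // in m1; rewrite movecE // in m2.
have fwd y : y \in hov (untab T) -> y *m mxc M \in h0.
  rewrite (row3E y); move: (y 0 o0) (y 0 o1) (y 0 o2) => x1 x2 x3.
  have [->|x0] := eqVneq x1 0; rewrite mem_hov ?eqxx ?x0 /=.
    have [->|x20] := eqVneq x2 0; have [->|x30] := eqVneq x3 0 => // _.
      by rewrite -[x3]mulr1 -(mulr0 x3) -row3Z -scalemxAl homogZ.
    by rewrite -[x2]mulr1 -(mulr0 x2) -row3Z -scalemxAl homogZ.
  move=> /eqP ->.
  have -> : row3 x1 x2 (x1 * untab T (x2 / x1)) = x1 *: row3 1 (x2 / x1) (untab T (x2 / x1)).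
    by rewrite row3Z mulr1 mulrCA divff // mulr1.
  rewrite -scalemxAl homogZ //; set t := x2 / x1.
  have /mt : enc t \in iota 0 p.+1 by rewrite mem_iota enc_lt.
  by rewrite movecE ?enc_lt ?opolyc_nth // -untabE ?enc_lt // encK.
have inj : injective (mulmx^~ (mxc M) : 'rV_3 -> 'rV_3) by apply: can_inj (mulmxK uM).
have card : #|[set y *m mxc M | y in hov (untab T)]| = #|h0|.
  rewrite card_imset //; have wtc (g : {ffun F -> F}) : #|hov g| = ((#|F| + 2) * (#|F| - 1))%N.
    rewrite -(hov_wt g) -cnt_wt; last exact: hov_homog.
    by apply: eq_card => y; rewrite [RHS]inE memvf andbT.
  by rewrite !wtc.
move=> y; apply/idP/idP => [|h]; first exact: fwd.
have sub : [set y *m mxc M | y in hov (untab T)] \subset h0.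
  by apply/subsetP => _ /imsetP[y' y'h ->]; exact: fwd.
have : [set y *m mxc M | y in hov (untab T)] == h0 by rewrite eqEcard sub card leqnn.
by move/eqP/setP/(_ (y *m mxc M)); rewrite h => /imsetP[y' y'h /inj ->].
Qed.

Lemma opoly_transport (D : seq (seq nat * seq nat * seq nat)) T0 :
  all (opolyc p z) (gen p z p.+1) -> [seq d.1.1 | d <- D] = gen p z p.+1 ->
  T0 \in gen p z p.+1 -> all (transportc p z T0) D ->
  exists2 f0, opoly f0 & forall f, opoly f -> exists2 A : 'M[F]_3, A \in unitmx &
    forall y, (y \in hov f) = (y *m A \in hov f0).
Proof.
move=> /allP ag eD T0g /allP tr; exists (untab T0); first exact: opoly_untab (ag _ T0g).
move=> f of_; have := opoly_tab of_; rewrite -eD => /mapP[d dD ed].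
have dg : d.1.1 \in gen p z p.+1 by rewrite -eD; apply/mapP; exists d.
have [A uA hA] := transport_hov (ag _ T0g) (ag _ dg) (tr _ dD).
by exists A => // y; rewrite -hA -ed tabK.
Qed.

End Decoding.

(* For each hyperoval through the standard frame: its table of values f(0), f(1),
   f(a), ..., and a matrix, with its inverse, carrying it onto a fixed one. *)
Definition tables4 : seq (seq nat * seq nat * seq nat) :=
  [:: ([:: 0; 1; 3; 2], [:: 1; 0; 0; 0; 1; 0; 0; 0; 1], [:: 1; 0; 0; 0; 1; 0; 0; 0; 1])]%N.

Definition tables8 : seq (seq nat * seq nat * seq nat) :=
  [:: ([:: 0; 1; 3; 5; 7; 2; 4; 6], [:: 7; 0; 0; 0; 5; 0; 3; 3; 3], [:: 2; 0; 0; 0; 4; 0; 2; 4; 6]);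
      ([:: 0; 1; 3; 6; 2; 7; 5; 4], [:: 1; 0; 0; 1; 1; 1; 1; 2; 3], [:: 1; 0; 0; 3; 6; 4; 7; 5; 4]);
      ([:: 0; 1; 4; 2; 7; 6; 3; 5], [:: 7; 0; 0; 2; 2; 2; 5; 6; 7], [:: 2; 0; 0; 4; 5; 7; 1; 4; 7]);
      ([:: 0; 1; 4; 7; 5; 3; 2; 6], [:: 3; 0; 0; 4; 4; 4; 5; 6; 7], [:: 6; 0; 0; 1; 3; 7; 5; 2; 7]);
      ([:: 0; 1; 5; 2; 6; 3; 7; 4], [:: 7; 0; 0; 3; 3; 3; 0; 5; 0], [:: 2; 0; 0; 0; 0; 4; 2; 6; 4]);
      ([:: 0; 1; 5; 7; 3; 6; 4; 2], [:: 3; 0; 0; 2; 2; 2; 6; 7; 1], [:: 6; 0; 0; 1; 5; 6; 5; 4; 6]);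
      ([:: 0; 1; 6; 4; 3; 7; 2; 5], [:: 3; 0; 0; 6; 6; 6; 4; 5; 6], [:: 6; 0; 0; 1; 1; 1; 5; 7; 1]);
      ([:: 0; 1; 6; 5; 2; 4; 7; 3], [:: 7; 0; 0; 4; 4; 4; 6; 7; 1], [:: 2; 0; 0; 4; 3; 6; 1; 2; 6]);
      ([:: 0; 1; 7; 4; 6; 2; 5; 3], [:: 7; 0; 0; 5; 5; 5; 4; 5; 6], [:: 2; 0; 0; 4; 2; 1; 1; 1; 1]);
      ([:: 0; 1; 7; 6; 5; 4; 3; 2], [:: 0; 5; 0; 7; 0; 0; 3; 3; 3], [:: 0; 2; 0; 4; 0; 0; 4; 2; 6])]%N.

Section SmallFields.
Variable F : finFieldType.

Let char2 n : #|F| = (2 ^ n)%N -> forall x : F, x + x = 0.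
Proof.
move=> /finfield.card_finPcharP/(_ isT) c2 x.
by rewrite -mulr2n -mulr_natr (pcharf0 c2) mulr0.
Qed.

Let char2_eq : (forall x : F, x + x = 0) -> forall x y : F, x + y = 0 -> x = y.
Proof. by move=> ch2 x y h; rewrite -[x]addr0 -(ch2 y) addrA h add0r. Qed.

Let other_elt : (2 < #|F|)%N -> exists2 a : F, a != 0 & a != 1.
Proof.
move=> lt; have [a /andP[a0 a1]|none] := pickP [pred a : F | (a != 0) && (a != 1)].
  by exists a.
suff : (#|[set: F]| <= #|[set (0 : F)%R; 1%R]|)%N.
  by rewrite cardsT cards2 leqNgt (leq_trans _ lt) // ltnS; case: (_ != _).
apply: subset_leq_card; apply/subsetP => a _; rewrite !inE; have := none a.
by rewrite /= -negb_or => /negbFE.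
Qed.

(** The number of hyperovals through the standard frame for [q = 4] and [q = 8], found by the
    enumeration. *)
Definition frame_number (q : nat) := if q == 4%N then 1%N else 10%N.

Theorem opoly_frames : #|F| = 4%N \/ #|F| = 8%N ->
  #|[set f : {ffun F -> F} | opoly f]| = frame_number #|F| /\
  exists2 f0 : {ffun F -> F}, opoly f0 & forall f, opoly f ->
    exists2 A : 'M[F]_3, A \in unitmx & forall y, (y \in hov f) = (y *m A \in hov f0).
Proof.
case=> cF.
  have ch2 := char2 (cF : _ = 2 ^ 2)%N.
  have [|a a0 a1] := other_elt; first by rewrite cF.
  have a3 : a * a * a = 1.
    by apply: (mulfI a0); rewrite mulr1 -[RHS]finfield.expf_card cF !exprS expr0 mulr1 !mulrA.
  have a2 : 1 + a = a * a.
    have : (a - 1) * (a * a + a + 1) = 0 by rewrite -[RHS](subrr 1) -{3}a3; ring.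
    move/eqP; rewrite mulf_eq0 subr_eq0 (negPf a1) /= => /eqP h.
    by apply: (char2_eq ch2); rewrite -h; ring.
  have zP i : (0 < i < 3)%N -> 1 + a ^+ i = a ^+ (nth 0 [:: 0; 2; 1] i)%N.
    case: i => [|[|[|//]]] // _; rewrite !exprS expr0 !mulr1 //.
    by rewrite -a2 addrA ch2 add0r.
  have p3 : prime 3 by [].
  rewrite cF; split.
    by rewrite (card_opoly p3 cF ch2 a0 a1 zP) //; vm_compute.
  apply: (opoly_transport p3 cF ch2 a0 a1 zP (D := tables4) (T0 := [:: 0; 1; 3; 2]%N)) => //.
have ch2 := char2 (cF : _ = 2 ^ 3)%N.
have [a [a0 a1 a3]] : exists a : F, [/\ a != 0, a != 1 & a * a * a = 1 + a].
  have [|b b0 b1] := other_elt; first by rewrite cF.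
  have b7 : b * b * b * b * b * b * b = 1.
    by apply: (mulfI b0); rewrite mulr1 -[RHS]finfield.expf_card cF !exprS expr0 mulr1 !mulrA.
  (* In characteristic 2 this is the factorisation of b ^ 7 - 1. A root of the last factor is the
     inverse of a root of the middle one, so [b] or its inverse satisfies the equation on which the
     Zech logarithms are based. *)
  have : (b - 1) * ((b * b * b + (1 + b)) * (b * b * b + b * b + 1)) = 0.
    have e : b * b * b * b * b * b * b - 1 = 0 by rewrite b7 subrr.
    rewrite -[RHS]e; set r := LHS; set l := RHS.
    have -> : r = l + (b - 1) * (b * b * b + b * b * b) by rewrite /r /l; ring.
    by rewrite ch2 mulr0 addr0.
  move/eqP; rewrite !mulf_eq0 subr_eq0 (negPf b1) /= => /orP[] /eqP h.
    by exists b; split=> //; exact: (char2_eq ch2).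
  exists b^-1; rewrite invr_eq0; split=> //.
    by rewrite invr_eq1.
  have b3 : b * b * b != 0 by rewrite !mulf_neq0.
  apply: (mulfI b3).
  have -> : b * b * b * (b^-1 * b^-1 * b^-1) = 1 by field.
  have -> : b * b * b * (1 + b^-1) = b * b * b + b * b by field.
  by apply/esym/(char2_eq ch2).
have dbl (x y : F) : x + (x + y) = y by rewrite addrA ch2 add0r.
have zP i : (0 < i < 7)%N -> 1 + a ^+ i = a ^+ (nth 0 [:: 0; 3; 6; 1; 5; 4; 2] i)%N.
  have a4 : a * a * a * a = a + a * a by rewrite a3; ring.
  have a5 : a * a * a * a * a = 1 + a + a * a.
    by rewrite a4 mulrDl a3 addrC.
  have a6 : a * a * a * a * a * a = 1 + a * a.
    rewrite a5 !mulrDl mul1r a3 [1 + a]addrC addrA -[a + _ + a]addrA [a * a + a]addrC.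
    by rewrite addrA ch2 add0r addrC.
  case: i => [|[|[|[|[|[|[|//]]]]]]] // _; rewrite !exprS expr0 !mulr1 !mulrA ?a6 ?a5 ?a4 ?a3 //.
    by rewrite addrA.
  by rewrite -addrA dbl.
have p7 : prime 7 by [].
rewrite cF; split.
  by rewrite (card_opoly p7 cF ch2 a0 a1 zP) //; vm_compute.
(* [T0] is the table of squaring: the common target is a conic with its nucleus. *)
apply: (opoly_transport p7 cF ch2 a0 a1 zP (D := tables8) (T0 := [:: 0; 1; 3; 5; 7; 2; 4; 6]%N)).
all: by vm_compute.
Qed.

End SmallFields.

(** * Cylinders over hyperovals *)

Section Cylinders.
Variables (F : finFieldType) (N : nat).
Local Notation V := 'rV[F]_N.
Local Notation q := #|F|.
Implicit Types (S : {set V}) (U W L P A R C : {vspace V}) (x v d : V) (y : 'rV[F]_3) (h : {set 'rV[F]_3}).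
Implicit Types (u : V * V * V).

Definition lin3 u (y : 'rV[F]_3) : V := y 0 o0 *: u.1.1 + y 0 o1 *: u.1.2 + y 0 o2 *: u.2.

Definition indep R u :=
  [&& u.2 \notin R, u.1.2 \notin (R + <[u.2]>)%VS & u.1.1 \notin (R + <[u.2]> + <[u.1.2]>)%VS].

Definition span3 R u := (R + <[u.2]> + <[u.1.2]> + <[u.1.1]>)%VS.

(** The cone over [h], drawn in the coordinates [u], with vertex [R] removed. *)
Definition cyl R u h : {set V} := [set x | [exists y in h, x - lin3 u y \in R]].

Lemma lin3D u y y' : lin3 u (y + y') = lin3 u y + lin3 u y'.
Proof. by rewrite /lin3 !mxE !scalerDl [RHS]addrACA [X in _ = X + _]addrACA. Qed.

Lemma lin3Z u a y : lin3 u (a *: y) = a *: lin3 u y.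
Proof. by rewrite /lin3 !mxE !scalerDr !scalerA. Qed.

Lemma lin3B u y y' : lin3 u (y - y') = lin3 u y - lin3 u y'.
Proof. by rewrite -scaleN1r lin3D lin3Z scaleN1r. Qed.

Lemma lin3_row3 u a b c : lin3 u (row3 a b c) = a *: u.1.1 + b *: u.1.2 + c *: u.2.
Proof. by rewrite /lin3 !mxE. Qed.

Lemma dim_span3 R u : indep R u -> \dim (span3 R u) = (\dim R).+3.
Proof. by case/and3P=> h2 h1 h0; rewrite /span3 !dim_addline. Qed.

Lemma lin3_rev u y d :
  lin3 u y + d = d + y 0 o2 *: u.2 + y 0 o1 *: u.1.2 + y 0 o0 *: u.1.1.
Proof.
rewrite /lin3 [LHS]addrC -[RHS]addrA -[RHS]addrA; congr (_ + _).
by rewrite [LHS]addrC; congr (_ + _); rewrite addrC.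
Qed.

Lemma mem_span3 R u x : x \in span3 R u -> exists y d, d \in R /\ x = lin3 u y + d.
Proof.
case/memv_addP=> _ /memv_addP[_ /memv_addP[d dR [_ /vlineP[c ->] ->]] [_ /vlineP[b ->] ->]].
case=> _ /vlineP[a ->] ->; exists (row3 a b c), d; split=> //.
by rewrite lin3_rev !mxE.
Qed.

Lemma span3_mem R u y d : d \in R -> lin3 u y + d \in span3 R u.
Proof.
move=> dR; rewrite lin3_rev.
by rewrite !memv_add ?memvZ ?memv_line.
Qed.

Lemma lin3_in R u y : indep R u -> lin3 u y \in R -> y = 0.
Proof.
case/and3P=> h2 h1 h0; rewrite (row3E y) lin3_row3.
move: (y 0 o0) (y 0 o1) (y 0 o2) => a b c hR.
have a0 : a = 0.
  apply/eqP; apply: contraNT h0 => an; rewrite -[u.1.1](scalerK an) rpredZ //.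
  have -> : a *: u.1.1 = (a *: u.1.1 + b *: u.1.2 + c *: u.2) + (- c) *: u.2 + (- b) *: u.1.2.
    by rewrite !scaleNr addrK addrK.
  by rewrite !memv_add ?memvZ ?memv_line.
move: hR; rewrite a0 scale0r add0r => hR; have b0 : b = 0.
  apply/eqP; apply: contraNT h1 => bn; rewrite -[u.1.2](scalerK bn) rpredZ //.
  have -> : b *: u.1.2 = (b *: u.1.2 + c *: u.2) + (- c) *: u.2 by rewrite scaleNr addrK.
  by rewrite memv_add ?memvZ ?memv_line.
move: hR; rewrite b0 scale0r add0r => hR; have c0 : c = 0.
  by apply/eqP; apply: contraNT h2 => cn; rewrite -[u.2](scalerK cn) rpredZ.
by rewrite c0; apply/eqP; rewrite row3_eq0 !eqxx.
Qed.

Section Cyl.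
Variables (R : {vspace V}) (u : V * V * V) (h : {set 'rV[F]_3}).
Hypotheses (iu : indep R u) (hh : homog h).

Lemma cylE y d : d \in R -> (lin3 u y + d \in cyl R u h) = (y \in h).
Proof.
move=> dR; rewrite inE; apply/exists_inP/idP => [[y' y'h]|yh]; last first.
  by exists y => //; rewrite addrAC subrr add0r.
rewrite addrAC -lin3B => e; suff /eqP : y - y' = 0 by rewrite subr_eq0 => /eqP ->.
by apply: (lin3_in iu); rewrite -[lin3 _ _](addrK d) rpredB.
Qed.

Lemma cyl_lin3 y : (lin3 u y \in cyl R u h) = (y \in h).
Proof. by rewrite -(cylE y (mem0v R)) addr0. Qed.

Lemma cyl_sub x : x \in cyl R u h -> x \in span3 R u.
Proof.
rewrite inE => /exists_inP[y _ e]; rewrite -[x](subrK (lin3 u y)) addrC.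
exact: span3_mem.
Qed.

Lemma cyl_homog : homog (cyl R u h).
Proof.
split=> [|a x a0].
  have -> : 0 = lin3 u 0 :> V by rewrite -(scale0r (0 : 'rV_3)) lin3Z scale0r.
  by rewrite cyl_lin3 (proj1 hh).
have key b z : b != 0 -> z \in cyl R u h -> b *: z \in cyl R u h.
  move=> b0 zc; have [y [d [dR ez]]] := mem_span3 (cyl_sub zc).
  rewrite ez cylE // in zc; rewrite ez scalerDr -lin3Z cylE ?homogZ //.
  exact: rpredZ.
apply/idP/idP; last exact: key.
by move=> hx; rewrite -[x](scalerK a0); apply: key; rewrite ?invr_eq0.
Qed.

Lemma wt_cyl_line x1 x2 y1 y2 d1 d2 : d1 \in R -> d2 \in R -> x1 = lin3 u y1 + d1 ->
  x2 = lin3 u y2 + d2 -> y2 != 0 -> y1 \notin <[y2]>%VS ->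
  wt (cyl R u h) (<[x1]> + <[x2]>) = wt h (<[y1]> + <[y2]>).
Proof.
move=> d1R d2R e1 e2 y20 y12.
have x20 : x2 != 0.
  apply: contra y20 => /eqP x0; apply/eqP/(lin3_in iu).
  by rewrite -[lin3 _ _](addrK d2) -e2 x0 sub0r rpredN.
have x12 : x1 \notin <[x2]>%VS.
  apply: contra y12 => /vlineP[a ea]; apply/vlineP; exists a; apply/eqP.
  rewrite -subr_eq0; apply/eqP/(lin3_in iu); rewrite lin3B lin3Z.
  have -> : lin3 u y1 - a *: lin3 u y2 = a *: d2 - d1.
    have -> : lin3 u y1 = x1 - d1 by rewrite e1 addrK.
    by rewrite ea e2 scalerDr addrAC [_ + a *: d2]addrC addrK.
  by rewrite rpredB // rpredZ.
rewrite !wt_line2 //; last exact: cyl_homog.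
rewrite e2 cylE //; congr (_ + _)%N; apply: eq_card => s; rewrite [LHS]in_set [RHS]in_set.
rewrite e1 scalerDr -lin3Z addrACA -lin3D cylE //.
by rewrite rpredD // rpredZ.
Qed.

Lemma cyl_shift x d : d \in R -> (x + d \in cyl R u h) = (x \in cyl R u h).
Proof.
have key z c : c \in R -> z \in cyl R u h -> z + c \in cyl R u h.
  rewrite !inE => cR /exists_inP[y yh e]; apply/exists_inP; exists y => //.
  by rewrite addrAC rpredD.
move=> dR; apply/idP/idP; last exact: key.
by move=> hx; rewrite -[x](addrK d); apply: key; rewrite ?rpredN.
Qed.

Lemma card_cyl : #|cyl R u h| = (#|h| * q ^ \dim R)%N.
Proof.
rewrite -card_vs -(cardsE (mem R)) -cardsX.
rewrite -(card_in_imset (f := fun p : 'rV[F]_3 * V => lin3 u p.1 + p.2)).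
  apply: eq_card => x; apply/idP/imsetP => [xc|[[y d]]].
    have [y [d [dR ex]]] := mem_span3 (cyl_sub xc).
    by exists (y, d) => //; move: xc; rewrite in_setX ex cylE // inE dR andbT.
  by rewrite in_setX inE /= => /andP[yh dR] ->; rewrite cylE.
move=> [y d] [y' d']; rewrite !in_setX !inE /= => /andP[_ dR] /andP[_ d'R] e.
have /eqP : y - y' = 0.
  apply: (lin3_in iu); rewrite lin3B.
  have -> : lin3 u y - lin3 u y' = d' - d.
    by apply/eqP; rewrite subr_eq addrAC eq_sym subr_eq e addrC.
  by rewrite rpredB.
by rewrite subr_eq0 => /eqP ey; move: e; rewrite ey => /addrI ->.
Qed.

(** A line meeting [R] has 0 or [q] points of the cylinder. Any other line is mapped isomorphically
    onto a line of the plane of [h]. *)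
Lemma cyl_even : ~~ odd q -> evenset h fullv -> evenset (cyl R u h) (span3 R u).
Proof.
move=> qe eh L LA dL.
have hc := cyl_homog.
have [v /andP[vL /andP[v0 vR]]|none] := pickP [pred v | [&& v \in L, v != 0 & v \in R]].
  have [x xv ->] := line_through dL vL v0.
  have -> : wt (cyl R u h) (<[x]> + <[v]>) = ((x \in cyl R u h) * q)%N.
    rewrite wt_line2 //.
    have -> : v \in cyl R u h = false by rewrite -[v]add0r cyl_shift // (negPf (proj1 hc)).
    rewrite add0n; case xc : (x \in cyl R u h).
      rewrite mul1n -cardsT; apply: eq_card => s.
      by rewrite in_set cyl_shift ?rpredZ // xc !inE.
    by rewrite mul0n; apply: eq_card0 => s; rewrite inE cyl_shift ?rpredZ // xc.
  by rewrite oddM (negPf qe) andbF.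
have [x2 x2L x20] : exists2 x2, x2 \in L & x2 != 0.
  by exists (vpick L); rewrite ?memv_pick // vpick0 -dimv_eq0 dL.
have [x1 x12 eL] := line_through dL x2L x20; rewrite eL.
have x1L : x1 \in L by rewrite eL memvE addvSl.
have [y1 [d1 [d1R e1]]] := mem_span3 (subvP LA _ x1L).
have [y2 [d2 [d2R e2]]] := mem_span3 (subvP LA _ x2L).
have y20 : y2 != 0.
  apply/eqP => y0; have := none x2; rewrite /= x2L x20 e2 y0.
  have -> : lin3 u 0 = 0 :> V by rewrite -(scale0r (0 : 'rV_3)) lin3Z scale0r.
  by rewrite add0r d2R.
have y12 : y1 \notin <[y2]>%VS.
  apply/negP => /vlineP[a ea].
  have eR : x1 - a *: x2 = d1 - a *: d2.
    by rewrite e1 e2 ea lin3Z [a *: (_ + d2)]scalerDr opprD addrACA subrr add0r.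
  have dR : x1 - a *: x2 \in R by rewrite eR rpredB // rpredZ.
  have := none (x1 - a *: x2); rewrite /= dR rpredB ?rpredZ //= andbT.
  move=> /negbFE/eqP/eqP; rewrite subr_eq0 => /eqP ex.
  by move: x12; rewrite ex memvZ ?memv_line.
rewrite (wt_cyl_line d1R d2R e1 e2 y20 y12); apply: eh; first exact: subvf.
exact: dim_span2.
Qed.

Lemma cyl_wt : wt (cyl R u h) (span3 R u) = (wt h fullv * q ^ \dim R)%N.
Proof.
have q1 : (0 < q - 1)%N by rewrite subn_gt0 q_gt1.
apply/eqP; rewrite -(eqn_pmul2r q1) -cnt_wt; last exact: cyl_homog.
rewrite mulnAC -cnt_wt //.
have -> : cnt (cyl R u h) (span3 R u) = #|cyl R u h|.
  apply: eq_card => x; rewrite in_set; case xc: (x \in cyl R u h) => //=.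
  exact: cyl_sub.
have -> : cnt h fullv = #|h| by apply: eq_card => x; rewrite in_set memvf andbT.
by rewrite card_cyl.
Qed.

End Cyl.

(** What the reduction leaves of a minimum word with n - k - 1 = [r]; these sets turn out to be the
    hypercylinders. *)
Definition minset S r := homog S /\ exists A : {vspace V},
  [/\ \dim A = r.+3, evenset S A, (forall x, x \in S -> x \in A) &
      wt S A = ((q + 2) * q ^ r)%N].

Lemma cyl_minset R u h : ~~ odd q -> indep R u -> homog h -> evenset h fullv ->
  wt h fullv = (q + 2)%N -> minset (cyl R u h) (\dim R).
Proof.
move=> qe iu hh eh wh; split; first exact: cyl_homog.
exists (span3 R u); split.
- exact: dim_span3.
- exact: cyl_even.
- by move=> x; apply: cyl_sub.
by rewrite cyl_wt // wh.
Qed.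

(** Hence the radical can be taken in the whole space, without reference to a chosen [A]. *)
Lemma rad_full S A x0 : homog S -> (forall x, x \in S -> x \in A) -> x0 \in S ->
  rad S fullv = rad S A.
Proof.
move=> hS sA x0S; apply/vspaceP => v; apply/idP/idP => /(radP _ _ hS)[vA hv]; apply/radP => //.
  split; last by move=> x _; exact: hv (memvf x).
  have : x0 + v \in S by rewrite hv ?memvf.
  by move/sA => h; rewrite -[v](addKr x0) rpredD // rpredN sA.
split; first exact: memvf.
move=> x _; have [xA|xA] := boolP (x \in A); first exact: hv.
apply/idP/idP => /sA h; last by rewrite h in xA.
by case/negP: xA; rewrite -[x](addrK v) rpredB.
Qed.

Hypothesis hq : q = 4%N \/ q = 8%N.

Let qe : ~~ odd q. Proof. by case: hq => ->. Qed.
Let q2 : (2 < q)%N. Proof. by case: hq => ->. Qed.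

Lemma minset_neq0 S r : minset S r -> exists x, x \in S.
Proof.
case=> hS [A [_ _ sA wA]].
have /(wt_gt0P _ hS)[x xS _] : (0 < wt S A)%N by rewrite wA min_wt_gt0.
by exists x.
Qed.

Lemma minset_rad S r : minset S r -> \dim (rad S fullv) = r.
Proof.
move=> mS; have [x xS] := minset_neq0 mS; case: mS => hS [A [dA eA sA wA]].
by rewrite (rad_full hS sA xS) (min_rad48 hq hS eA dA wA).
Qed.

(** In the coordinates [u] modulo the radical, [S] passes through the standard frame. *)
Definition framed S u := [&& indep (rad S fullv) u, u.1.1 \in S, u.1.2 \in S, u.2 \in S &
  u.1.1 + u.1.2 + u.2 \in S].

Lemma minset_card S r : minset S r -> #|S| = ((q + 2) * q ^ r * (q - 1))%N.
Proof.
case=> hS [A [_ _ sA wA]]; rewrite -wA -cnt_wt //; apply: eq_card => x; rewrite in_set.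
by case xS: (x \in S) => //=; rewrite sA.
Qed.

Lemma lin3_free R u y1 y2 : indep R u -> y2 != 0 -> y1 \notin <[y2]>%VS ->
  lin3 u y2 != 0 /\ lin3 u y1 \notin <[lin3 u y2]>%VS.
Proof.
move=> iu y20 y12; split.
  by apply: contra y20 => /eqP x0; apply/eqP/(lin3_in iu); rewrite x0 mem0v.
apply: contra y12 => /vlineP[a ea]; apply/vlineP; exists a; apply/eqP.
by rewrite -subr_eq0; apply/eqP/(lin3_in iu); rewrite lin3B lin3Z ea subrr mem0v.
Qed.

Lemma cyl_even_inv R u h : indep R u -> homog h -> evenset (cyl R u h) (span3 R u) ->
  evenset h fullv.
Proof.
move=> iu hh eA L _ dL; have [y2 y2L y20] : exists2 y, y \in L & y != 0.
  by exists (vpick L); rewrite ?memv_pick // vpick0 -dimv_eq0 dL.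
have [y1 y12 ->] := line_through dL y2L y20.
have z y : lin3 u y = lin3 u y + 0 by rewrite addr0.
have [n0 n1] := lin3_free iu y20 y12.
rewrite -(wt_cyl_line iu hh (mem0v R) (mem0v R) (z y1) (z y2) y20 y12).
have yA y : lin3 u y \in span3 R u by rewrite (z y) span3_mem ?mem0v.
by apply: eA; [rewrite subv_add -!memvE !yA | exact: dim_span2].
Qed.

(** Translations by the radical preserve [S], so [S] is the cylinder over its preimage [h] in
    coordinates, a hyperoval through the standard frame. *)
Lemma framed_cyl S r u : minset S r -> framed S u ->
  exists2 f, opoly f & S = cyl (rad S fullv) u (hov f).
Proof.
move=> mS; have [x xS] := minset_neq0 mS; have dR := minset_rad mS.
have cS := minset_card mS.
case: mS => hS [A [dA eA sA wA]] /and5P[iu u0 u1 u2 us].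
set R := rad S fullv in dR iu *; pose h : {set 'rV[F]_3} := [set y | lin3 u y \in S].
have RA : (R <= A)%VS by rewrite /R (rad_full hS sA xS) rad_sub.
have eAR : span3 R u = A.
  by apply/eqP; rewrite eqEdim !subv_add -!memvE RA !sA // dim_span3 // dR dA leqnn.
have hh : homog h.
  split=> [|a y a0]; last by rewrite !in_set lin3Z homogZ.
  by rewrite in_set -(scale0r (0 : 'rV_3)) lin3Z scale0r (negPf (proj1 hS)).
have eS : S = cyl R u h.
  apply/setP => z; have [zA|zA] := boolP (z \in A); last first.
    by apply/idP/idP => [/sA|/cyl_sub]; rewrite ?eAR (negPf zA).
  rewrite -eAR in zA; have [y [d [dRd ->]]] := mem_span3 zA.
  by rewrite cylE // in_set (radD hS dRd) // memvf.
have wh : wt h fullv = (q + 2)%N.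
  have := cyl_wt iu hh; rewrite -eS eAR wA dR => /eqP.
  by rewrite eqn_pmul2r ?expn_gt0 ?(ltnW (q_gt1 F)) // => /eqP.
have eh : evenset h fullv by apply: (cyl_even_inv iu hh); rewrite -eS eAR.
have fh : frame h.
  by rewrite /frame !in_set !lin3_row3 !scale0r !scale1r !addr0 !add0r u0 u1 u2 us.
have [f of_ ef] := frame_hov hh eh wh fh.
by exists f; rewrite // -ef.
Qed.

Lemma cyl_rad R u f : indep R u -> opoly f -> rad (cyl R u (hov f)) fullv = R.
Proof.
move=> iu /hov_hyperoval[hh eh wh _]; apply/esym/eqP.
rewrite eqEdim (minset_rad (cyl_minset qe iu hh eh wh)) leqnn andbT.
apply/subvP => d dR; apply/radP; first exact: cyl_homog.
by split=> [|x _]; [exact: memvf | exact: cyl_shift].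
Qed.

Lemma cyl_framed R u f : indep R u -> opoly f -> framed (cyl R u (hov f)) u.
Proof.
move=> iu of_; have [hh _ _ /and4P[e0 e1 e2 e3]] := hov_hyperoval of_.
rewrite /framed cyl_rad // iu /=.
rewrite -(cyl_lin3 _ iu) lin3_row3 !scale0r !scale1r !addr0 in e0; rewrite e0.
rewrite -(cyl_lin3 _ iu) lin3_row3 !scale0r !scale1r !addr0 add0r in e1; rewrite e1.
rewrite -(cyl_lin3 _ iu) lin3_row3 !scale0r !scale1r !add0r in e2; rewrite e2.
by rewrite -(cyl_lin3 _ iu) lin3_row3 !scale1r in e3.
Qed.

Lemma cyl_inj R u f g : indep R u -> cyl R u (hov f) = cyl R u (hov g) -> f = g.
Proof.
move=> iu e; apply: hov_inj; apply/setP => y; rewrite -!(cyl_lin3 _ iu).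
by rewrite e.
Qed.

Lemma card_triple (T : finType) (P : pred T) (Q : T -> pred T) (Z : T -> T -> pred T)
    (n1 n2 n3 : nat) :
  #|[set c | P c]| = n3 -> (forall c, P c -> #|[set b | Q c b]| = n2) ->
  (forall c b, P c -> Q c b -> #|[set a | Z c b a]| = n1) ->
  #|[set t : T * T * T | [&& P t.2, Q t.2 t.1.2 & Z t.2 t.1.2 t.1.1]]| = (n3 * n2 * n1)%N.
Proof.
move=> h3 h2 h1; rewrite -sum1dep_card.
rewrite -(pair_big_dep predT (fun p c => [&& P c, Q c p.2 & Z c p.2 p.1]) (fun _ _ => 1%N)) /=.
rewrite (exchange_big_dep P) /=; last by move=> p c _ /andP[].
rewrite -h3 -mulnA -sum_nat_const; under [RHS]eq_bigl => c do rewrite inE.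
apply: eq_bigr => c Pc.
rewrite -(pair_big_dep predT (fun a b => [&& P c, Q c b & Z c b a]) (fun _ _ => 1%N)) /=.
rewrite (exchange_big_dep (Q c)) /=; last by move=> a b _ /and3P[].
rewrite -(h2 c Pc) -sum_nat_const; under [RHS]eq_bigl => b do rewrite inE.
apply: eq_bigr => b Qb; rewrite -(h1 c b Pc Qb) sum1dep_card.
by apply: eq_card => a; rewrite !inE Pc Qb.
Qed.

(** * The number of frames adapted to a minimum set *)

Section FrameCount.
Variables (S : {set V}) (r : nat) (A : {vspace V}).
Hypotheses (mS : minset S r) (dA : \dim A = r.+3) (eA : evenset S A).
Hypotheses (sA : forall x, x \in S -> x \in A) (wA : wt S A = ((q + 2) * q ^ r)%N).
Local Notation R := (rad S fullv).

Let hS : homog S := proj1 mS.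
Let dR : \dim R = r := minset_rad mS.
Let RA : (R <= A)%VS.
Proof. by have [x xS] := minset_neq0 mS; rewrite (rad_full hS sA xS) rad_sub. Qed.
Let S_notin x : x \in S -> x \notin R.
Proof. by move=> xS; apply/negP => /(rad_notin hS); rewrite xS. Qed.

Lemma wt_add_rad C : (C :&: R = 0)%VS -> wt S (C + R) = (q ^ r * wt S C)%N.
Proof.
move=> CR; rewrite -dR; apply: wt_complement_rad => //.
apply/subvP => v vR; apply: (rad_cap hS (subvf _) vR).
by apply: subvP vR; exact: addvSr.
Qed.

Lemma off_rad_line L : (L <= A)%VS -> \dim L = 2%N -> (L :&: R = 0)%VS -> (wt S L <= 2)%N.
Proof.
move=> LA dL LR; have [|C [LC CA CR sCA dC]] := complement_through RA LA.
  by rewrite capvC.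
have wC : wt S C = (q + 2)%N.
  have := wt_add_rad CR; rewrite sCA wA mulnC => /eqP.
  by rewrite eqn_pmul2l ?expn_gt0 ?(ltnW (q_gt1 F)) // => /eqP.
apply: (hyperoval_line_le hS (evensetS CA eA) _ wC LC dL).
by move: dC; rewrite dA dR; lia.
Qed.

Lemma cap_line_rad (x y : V) : x \notin R -> y \notin (R + <[x]>)%VS ->
  ((<[y]> + <[x]>) :&: R = 0)%VS /\ \dim (<[y]> + <[x]>) = 2%N.
Proof.
move=> xR yRx; have x0 : x != 0 by apply: contraNneq xR => ->; rewrite mem0v.
have yx : y \notin <[x]>%VS by apply: contra yRx; apply: subvP; exact: addvSr.
split; last exact: dim_span2.
apply/eqP; rewrite -subv0; apply/subvP => v; rewrite memv_cap memv0.
case/andP=> /memv_addP[_ /vlineP[b ->] [_ /vlineP[c ->] ->]] hR.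
have [b0|b0] := eqVneq b 0.
  rewrite b0 scale0r add0r in hR *; have [->|c0] := eqVneq c 0; first by rewrite scale0r.
  by case/negP: xR; rewrite -[x](scalerK c0) rpredZ.
case/negP: yRx; rewrite -[y](scalerK b0) rpredZ //.
have -> : b *: y = (b *: y + c *: x) + (- c) *: x by rewrite scaleNr addrK.
by rewrite memv_add // memvZ // memv_line.
Qed.

Lemma wt_secant_off_rad (x y : V) : x \in S -> y \in A -> y \notin (R + <[x]>)%VS ->
  wt S (<[y]> + <[x]>) = 2%N.
Proof.
move=> xS yA yRx; have [LR dL] := cap_line_rad (S_notin xS) yRx.
have LA : (<[y]> + <[x]> <= A)%VS by rewrite subv_add -!memvE yA sA.
apply/eqP; rewrite eqn_leq off_rad_line //.
by apply: even_line_ge2 eA LA dL xS _ => //; rewrite memvE addvSr.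
Qed.

Lemma card_in_cnt U : #|[set x in S | x \in U]| = (wt S U * (q - 1))%N.
Proof. by rewrite -cnt_wt. Qed.

Lemma card_frame2 c : c \in S ->
  #|[set b in S | b \notin (R + <[c]>)%VS]| = ((q + 1) * q ^ r * (q - 1))%N.
Proof.
move=> cS; have c0 := homog_neq0 hS cS.
have cR : (<[c]> :&: R = 0)%VS by rewrite capvC notin_capv_line ?S_notin.
have w1 : wt S (R + <[c]>) = (q ^ r)%N by rewrite addvC wt_add_rad // wt_line // cS muln1.
have := minset_card mS; rewrite -(cardsID [set b | b \in (R + <[c]>)%VS]).
have -> : S :&: [set b | b \in (R + <[c]>)%VS] = [set b in S | b \in (R + <[c]>)%VS].
  by apply/setP => b; rewrite !inE.
rewrite card_in_cnt w1.
have -> : S :\: [set b | b \in (R + <[c]>)%VS] = [set b in S | b \notin (R + <[c]>)%VS].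
  by apply/setP => b; rewrite !inE andbC.
move: #|[set _ in _ | _]| (q ^ r)%N => X Y; move: #|F| => Q; clear; move: (Q - 1)%N => P.
by move=> e; nia.
Qed.

(** The point [e = b + c] is neither in [S] nor in the radical, so each [z] of [S] off [W] is joined
    to it by a 2-secant and there is exactly one [t], nonzero, with [e + t *: z] in [S]. For fixed
    [t], scaling by [t] turns these [z] into the vectors [a] sought, so the vectors of [S] off [W]
    are q - 1 times as many. *)
Lemma card_frame3 c b : c \in S -> b \in S -> b \notin (R + <[c]>)%VS ->
  #|[set a in S | (a \notin (R + <[c]> + <[b]>)%VS) && (a + b + c \in S)]| = (q * q ^ r)%N.
Proof.
move=> cS bS bRc; set W := (R + <[c]> + <[b]>)%VS; set e := b + c.
have [LR dL] := cap_line_rad (S_notin cS) bRc.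
have eW : W = ((<[b]> + <[c]>) + R)%VS by rewrite /W addvC -!addvA [(R + _)%VS]addvC.
have wW : wt S W = (q ^ r * 2)%N by rewrite eW wt_add_rad // wt_secant_off_rad // sA.
have eWm : e \in W by rewrite eW; apply: subvP (addvSl _ _) _ _; rewrite memv_add ?memv_line.
have c0 := homog_neq0 hS cS.
have bc : b \notin <[c]>%VS by apply: contra bRc; apply: subvP; exact: addvSr.
have eS : e \notin S.
  have := wt_secant_off_rad cS (sA bS) bRc; rewrite wt_line2 // cS => -[c1].
  apply/negP => h; suff : (1 < #|[set s : F | (b + s *: c)%R \in S]|)%N by rewrite -[#|_|]add0n c1.
  by apply/card_gt1P; exists 0, 1; rewrite !inE scale0r addr0 scale1r bS h eq_sym oner_eq0.
have eR : e \notin R.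
  apply/negP => hR; have : e \in ((<[b]> + <[c]>) :&: R)%VS.
    by rewrite memv_cap hR memv_add ?memv_line.
  rewrite LR memv0 /e addr_eq0 => /eqP eb.
  by move: bc; rewrite eb rpredN memv_line.
pose S' := [set z in S | z \notin W].
have cS' : #|S'| = (q * q ^ r * (q - 1))%N.
  have := minset_card mS; rewrite -(cardsID [set b | b \in W]).
  have -> : S :&: [set b | b \in W] = [set b in S | b \in W] by apply/setP => x; rewrite !inE.
  rewrite card_in_cnt wW.
  have -> : S :\: [set b | b \in W] = S' by apply/setP => x; rewrite !inE andbC.
  move: #|S'| (q ^ r)%N => X Y; move: #|F| => Q; clear; move: (Q - 1)%N => P.
  by move=> e; nia.
set X := [set a in S | _].
have one z : z \in S' -> #|[set t : F | e + t *: z \in S]| = 1%N.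
  rewrite inE => /andP[zS zW]; have z0 := homog_neq0 hS zS.
  have eRz : e \notin (R + <[z]>)%VS.
    apply/negP => /memv_addP[d dR' [_ /vlineP[t ->] et]].
    have [t0|t0] := eqVneq t 0; first by move: eR; rewrite et t0 scale0r addr0 dR'.
    move: zW; rewrite -[z](scalerK t0) rpredZ //.
    have -> : t *: z = e - d by rewrite et [RHS]addrC addKr.
    by rewrite rpredB // /W -addvA; apply: subvP (addvSl _ _) _ dR'.
  have eA' : e \in A by rewrite rpredD // sA.
  have ez : e \notin <[z]>%VS by apply: contra eRz; apply: subvP; exact: addvSr.
  by have := wt_secant_off_rad zS eA' eRz; rewrite wt_line2 // zS => -[].
have q1 : (0 < q - 1)%N by rewrite subn_gt0 q_gt1.
apply/eqP; rewrite -(eqn_pmul2r q1) -cS'; apply/eqP.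
transitivity (\sum_(z in S') \sum_(t : F | t != 0%R) ((e + t *: z)%R \in S))%N; last first.
  rewrite -sum1_card; apply: eq_bigr => z zS'; apply: etrans (one z zS'); rewrite -sum1dep_card.
  rewrite big_mkcond [RHS]big_mkcond /=; apply: eq_bigr => t _.
  have [->|_] := eqVneq t 0; first by rewrite scale0r addr0 (negPf eS).
  by case: (_ \in S).
have -> : (q - 1)%N = #|[pred t : F | t != 0]|.
  by rewrite subn1 -(cardC1 (0 : F)); apply: eq_card => t; rewrite !inE.
rewrite mulnC exchange_big /= -sum_nat_const; apply: eq_bigr => t t0.
have inj : injective (fun z : V => t *: z) by exact: scalerI.
transitivity #|[set z in S' | e + t *: z \in S]|; last first.
  rewrite -sum1dep_card [LHS]big_mkcond [RHS]big_mkcond /=; apply: eq_bigr => z _.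
  by case: (z \in S'); case: (_ \in S).
rewrite -[RHS](card_imset _ inj); apply: eq_card => x; rewrite in_set; apply/idP/imsetP.
  case/andP=> xS /andP[xW xe]; exists (t^-1 *: x); last by rewrite scalerA divff // scale1r.
  rewrite !in_set homogZ ?invr_eq0 // xS scalerA divff // scale1r [e + x]addrC /e addrA xe andbT.
  by apply: contra xW => h; rewrite -[x](scalerKV t0) rpredZ.
case=> z; rewrite !in_set => /andP[/andP[zS zW] ez] ->.
rewrite homogZ // zS -addrA [_ + (b + c)]addrC ez andbT.
by apply: contra zW => h; rewrite -[z](scalerK t0) rpredZ.
Qed.

Lemma card_framed : #|[set u | framed S u]| =
  ((q + 2) * q ^ r * (q - 1) * ((q + 1) * q ^ r * (q - 1)) * (q * q ^ r))%N.
Proof.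
rewrite -(@card_triple _ (fun c => c \in S) (fun c b => (b \in S) && (b \notin (R + <[c]>)%VS))
  (fun c b a => (a \in S) && ((a \notin (R + <[c]> + <[b]>)%VS) && (a + b + c \in S)))
  (q * q ^ r) ((q + 1) * q ^ r * (q - 1)) ((q + 2) * q ^ r * (q - 1))) //.
- apply: eq_card => -[[a b] c]; rewrite !in_set /framed /indep /=.
  case cS: (c \in S); rewrite ?andbF //= S_notin //=.
  by case: (a \in S); case: (b \in S); case: (_ \notin _); case: (_ \notin _).
- by rewrite -(minset_card mS); apply: eq_card => x; rewrite inE.
- by move=> c cS; rewrite -(card_frame2 cS).
by move=> c b cS /andP[bS bR]; rewrite -(card_frame3 cS bS bR).
Qed.

End FrameCount.

(** The number of ordered linearly independent [j]-tuples in a space of dimension [d]. *)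
Definition fr (j d : nat) := (\prod_(i < j) (q ^ d - q ^ i))%N.

Lemma card_notin W U : (W <= U)%VS ->
  #|[set x | (x \in U) && (x \notin W)]| = (q ^ \dim U - q ^ \dim W)%N.
Proof. by move=> WU; rewrite -card_diff // sum1dep_card. Qed.

Lemma card_free_tuples U j :
  #|[set D : j.-tuple V | free D && (<<D>> <= U)%VS]| = fr j (\dim U).
Proof.
elim: j => [|j IH].
  rewrite /fr big_ord0; apply/eqP/cards1P; exists [tuple]; apply/setP => D.
  by rewrite !inE (tuple0 D) eqxx nil_free span_nil sub0v.
rewrite /fr big_ord_recr /= -/(fr j _) -IH -sum1dep_card.
rewrite (reindex (fun p : V * j.-tuple V => [tuple of p.1 :: p.2])) /=; last first.
  exists (fun t : j.+1.-tuple V => (thead t, [tuple of behead t])) => [[x D] _|t _].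
    by congr pair; apply: val_inj.
  by rewrite /= -tuple_eta.
rewrite -(pair_big_dep predT (fun x (D : j.-tuple V) => free (x :: D) && (<<x :: D>> <= U)%VS)
  (fun _ _ => 1%N)) /=.
rewrite (exchange_big_dep (fun D : j.-tuple V => free D && (<<D>> <= U)%VS)) /=; last first.
  move=> x D _; rewrite free_cons span_cons subv_add => /andP[/andP[_ ->] /andP[_ ->]].
  by [].
rewrite -sum_nat_const; under [RHS]eq_bigl => D do rewrite inE.
apply: eq_bigr => D /andP[fD DU].
rewrite sum1dep_card -[j in RHS](size_tuple D) -(eqP fD) -card_notin //.
by apply: eq_card => x; rewrite !inE free_cons span_cons subv_add fD DU -memvE !andbT andbC.
Qed.

Lemma card_indep R : #|[set u | indep R u]| =
  ((q ^ N - q ^ \dim R) * (q ^ N - q ^ (\dim R).+1) * (q ^ N - q ^ (\dim R).+2))%N.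
Proof.
have dV : \dim {:V} = N by rewrite dimvf /dim /= mul1n.
have c W : #|[set x | x \notin W]| = (q ^ N - q ^ \dim W)%N.
  by have := card_notin (subvf W); rewrite dV => <-; apply: eq_card => x; rewrite !inE memvf.
apply: (@card_triple _ (fun c => c \notin R) (fun c b => b \notin (R + <[c]>)%VS)
  (fun c b a => a \notin (R + <[c]> + <[b]>)%VS)) => [|z zR|z b zR bR].
- exact: c.
- by rewrite c dim_addline.
by rewrite c !dim_addline.
Qed.

Definition frames r := [set p : V * V * V * r.-tuple V | free p.2 && indep <<p.2>>%VS p.1].

Lemma card_frames r : #|frames r| =
  (fr r N * ((q ^ N - q ^ r) * (q ^ N - q ^ r.+1) * (q ^ N - q ^ r.+2)))%N.
Proof.
have dV : \dim {:V} = N by rewrite dimvf /dim /= mul1n.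
have := card_free_tuples fullv r; rewrite dV => <-; rewrite -sum1dep_card.
rewrite -(pair_big_dep predT (fun u (D : r.-tuple V) => free D && indep <<D>>%VS u)
  (fun _ _ => 1%N)) /=.
rewrite (exchange_big_dep (fun D : r.-tuple V => free D)) /=; last by move=> u D _ /andP[].
rewrite -sum_nat_const; under [RHS]eq_bigl => D do rewrite inE subvf andbT.
apply: eq_bigr => D fD; rewrite sum1dep_card.
have dD : \dim <<D>> = r by rewrite (eqP fD) size_tuple.
by have := card_indep <<D>>%VS; rewrite dD => <-; apply: eq_card => u; rewrite !inE fD.
Qed.

Definition Mset (r : nat) : {set {set V}} :=
  [set cyl <<p.1.2>>%VS p.1.1 (hov p.2) | p : V * V * V * r.-tuple V * {ffun F -> F} in setX (frames r) [set f | opoly f]].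

Lemma framed_exists S r : minset S r ->
  exists u (D : r.-tuple V), [/\ framed S u, free D & <<D>>%VS = rad S fullv].
Proof.
move=> mS; have dR := minset_rad mS; have [_ [A [dA eA sA wA]]] := mS.
have q0 : (0 < q)%N by rewrite (ltnW (q_gt1 F)).
have /card_gt0P[u uf] : (0 < #|[set u | framed S u]|)%N.
  rewrite (card_framed mS dA eA sA wA) !muln_gt0 !addn_gt0 !expn_gt0 q0 subn_gt0 q_gt1.
  by rewrite !orbT.
have /card_gt0P[D] : (0 < #|[set D : r.-tuple V | free D && (<<D>> <= rad S fullv)%VS]|)%N.
  rewrite card_free_tuples dR prodn_gt0 // => i.
  by rewrite subn_gt0 ltn_exp2l // q_gt1.
rewrite !inE in uf *; case/andP=> fD DR; exists u, D; split=> //.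
by apply/eqP; rewrite eqEdim DR dR (eqP fD) size_tuple leqnn.
Qed.

Lemma MsetP S r : reflect (minset S r) (S \in Mset r).
Proof.
apply: (iffP imsetP) => [[[[u D] f]]|mS].
  rewrite !inE /= => /andP[/andP[fD iu] /hov_hyperoval[hh eh wh _]] ->.
  have dD : \dim <<D>> = r by rewrite (eqP fD) size_tuple.
  by have := cyl_minset qe iu hh eh wh; rewrite dD.
have [u [D [fu fD eD]]] := framed_exists mS.
have [f of_ eS] := framed_cyl mS fu.
exists (u, D, f); rewrite ?eD //= !inE /= fD of_ andbT eD.
by case/and5P: fu.
Qed.

(** A set has as many adapted frames as it has triples in [framed] times bases of its radical. A
    given frame is adapted to exactly one minimum set for each o-polynomial. *)
Theorem count_Mset r :
  (#|Mset r| * ((q + 2) * q ^ r * (q - 1) * ((q + 1) * q ^ r * (q - 1)) * (q * q ^ r) * fr r r) =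
   #|frames r| * frame_number q)%N.
Proof.
pose adapted S (p : V * V * V * r.-tuple V) :=
  [&& free p.2, (<<p.2>> <= rad S fullv)%VS & framed S p.1].
have adE S p : S \in Mset r -> adapted S p -> p \in frames r /\ <<p.2>>%VS = rad S fullv.
  move=> /MsetP mS /and3P[fD DR fu].
  have e : <<p.2>>%VS = rad S fullv.
    by apply/eqP; rewrite eqEdim DR (minset_rad mS) (eqP fD) size_tuple leqnn.
  by split=> //; rewrite inE fD e; case/and5P: fu.
rewrite -sum_nat_const.
transitivity (\sum_(S in Mset r) \sum_(p in frames r | adapted S p) 1)%N.
  apply: eq_bigr => S SM; have mS := MsetP _ _ SM; have [_ [A [dA eA sA wA]]] := mS.
  rewrite -(card_framed mS dA eA sA wA).
  have -> : fr r r = #|[set D : r.-tuple V | free D && (<<D>> <= rad S fullv)%VS]|.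
    by rewrite card_free_tuples (minset_rad mS).
  rewrite -cardsX sum1_card; apply: eq_card => -[u D].
  rewrite in_setX [u \in _]in_set [D \in _]in_set unfold_in; apply/idP/idP.
    case/and3P=> fu fD DR; have ad : adapted S (u, D) by apply/and3P.
    by have [-> _] := adE S _ SM ad.
  by case/andP=> _ /and3P[-> -> ->].
rewrite (exchange_big_dep (mem (frames r))) /=; last by move=> S p _ /andP[].
rewrite -sum_nat_const; apply: eq_bigr => p pf.
have [cN _] := opoly_frames hq; rewrite -cN sum1_card.
have [fD iu] : free p.2 /\ indep <<p.2>>%VS p.1 by move: pf; rewrite inE => /andP[].
rewrite -(card_in_imset (D := [set f : {ffun F -> F} | opoly f])
  (f := fun f => cyl <<p.2>>%VS p.1 (hov f))); last first.
  by move=> f g _ _; exact: cyl_inj.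
apply: eq_card => S; rewrite unfold_in; apply/idP/imsetP.
  case/and3P=> SM _ ad; have [_ eR] := adE _ _ SM ad; case/and3P: ad => _ _ fu.
  have [f of_ eS] := framed_cyl (MsetP _ _ SM) fu.
  by exists f; rewrite ?inE // eR.
case=> f; rewrite inE => of_ ->; apply/and3P; split=> //.
  by apply/imsetP; exists (p, f) => //; rewrite in_setX pf inE.
by rewrite /adapted fD cyl_rad // subvv cyl_framed.
Qed.

Lemma basis_map (b c : N.-tuple V) : free b -> free c ->
  exists2 g : 'End(V), lker g == 0%VS & forall i : 'I_N, g b`_i = c`_i.
Proof.
move=> fb fc; pose g0 (x : V) : V := \sum_(i < N) coord b i x *: c`_i.
have lin : linear g0.
  move=> a x y; rewrite /g0 scaler_sumr -big_split /=; apply: eq_bigr => i _.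
  by rewrite linearP scalerDl scalerA.
pose gl := GRing.isLinear.Build F V V _ g0 lin.
pose gL : {linear V -> V} := HB.pack g0 gl.
have fullb : <<b>>%VS = fullv.
  by apply/eqP; rewrite eqEdim subvf (eqP fb) size_tuple dimvf /dim /= mul1n leqnn.
exists (linfun gL) => [|i].
  rewrite -subv0; apply/subvP => x; rewrite memv_ker lfunE /= memv0 /g0 => /eqP h.
  have /freeP/(_ _ h) h0 := fc.
  have xb : x \in <<b>>%VS by rewrite fullb memvf.
  by rewrite (coord_span xb) big1 // => i _; rewrite h0 scale0r.
rewrite lfunE /= /g0 (bigD1 i) //= big1 ?addr0 => [|j ji].
  by rewrite coord_free // eqxx scale1r.
by rewrite coord_free // eq_sym (negPf ji) scale0r.
Qed.

Lemma free_extend (X : seq V) : free X -> exists Y : seq V, free (X ++ Y) /\ size (X ++ Y) = N.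
Proof.
move=> fX; exists (vbasis (<<X>>^C)%VS).
have fb : free (vbasis (<<X>>^C)%VS) by exact: basis_free (vbasisP _).
have f : free (X ++ vbasis (<<X>>^C)%VS).
  by rewrite cat_free fX fb /= (span_basis (vbasisP _)); apply/directv_addP/capv_compl.
split=> //; rewrite -(eqP f) span_cat (span_basis (vbasisP _)) addv_complf.
by rewrite dimvf /dim /= mul1n.
Qed.

End Cylinders.

(** * The linear group is transitive on minimum sets *)

Section Transitivity.
Variables (F : finFieldType) (N : nat).
Local Notation V := 'rV[F]_N.
Local Notation q := #|F|.
Implicit Types (S : {set V}) (R : {vspace V}) (u v : V * V * V).

Lemma indep_lin3 R v : (forall y, lin3 v y \in R -> y = 0) -> indep R v.
Proof.
move=> hv; have no (a b c : F) : a *: v.1.1 + b *: v.1.2 + c *: v.2 \in R ->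
    [&& a == 0, b == 0 & c == 0].
  by rewrite -lin3_row3 => /hv/eqP; rewrite row3_eq0.
apply/and3P; split; apply/negP.
- by move=> h; have := no 0 0 1; rewrite !scale0r !add0r scale1r oner_eq0 !andbF => /(_ h).
- case/memv_addP=> d dR [_ /vlineP[c ->] e].
  have := no 0 1 (- c); rewrite scale0r add0r scale1r e scaleNr addrK oner_eq0 andbF.
  by move=> /(_ dR).
case/memv_addP=> _ /memv_addP[d dR [_ /vlineP[c ->] ->]] [_ /vlineP[b ->] e].
have := no 1 (- b) (- c); rewrite scale1r e !scaleNr addrK addrK oner_eq0.
by move=> /(_ dR).
Qed.

Lemma free_frame (D : seq V) u : free D -> indep <<D>>%VS u -> free (u.1.1 :: u.1.2 :: u.2 :: D).
Proof.
move=> fD /and3P[h2 h1 h0]; rewrite !free_cons fD !span_cons h2.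
by rewrite [(<[u.2]> + _)%VS]addvC h1 [(<[u.1.2]> + _)%VS]addvC h0.
Qed.

Lemma free_map (X Y : seq V) : free X -> free Y -> size X = size Y ->
  exists2 g : 'End(V), lker g == 0%VS & forall i, (i < size X)%N -> g X`_i = Y`_i.
Proof.
move=> fX fY sXY; have [X' [fX' sX']] := free_extend fX; have [Y' [fY' sY']] := free_extend fY.
have [g g0 gE] := @basis_map F N (Tuple (introT eqP sX')) (Tuple (introT eqP sY')) fX' fY'.
exists g => // i iX; have iN : (i < N)%N by rewrite -sX' size_cat ltn_addr.
by have := gE (Ordinal iN); rewrite /= !nth_cat -sXY iX.
Qed.

(** Both sets are cylinders over hyperovals in adapted frames, and [M] carries the first hyperoval
    to the second. Absorbing [M] into the second frame leaves a linear map between two free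
    families, extended to the whole space. *)
Theorem minset_transitive S1 S2 r : q = 4%N \/ q = 8%N -> minset S1 r -> minset S2 r ->
  exists2 g : 'End(V), lker g == 0%VS & forall x, (g x \in S2) = (x \in S1).
Proof.
move=> hq m1 m2; have [u1 [D1 [fr1 fD1 e1]]] := framed_exists hq m1.
have [u2 [D2 [fr2 fD2 e2]]] := framed_exists hq m2.
have [f1 of1 eS1] := framed_cyl hq m1 fr1; have [f2 of2 eS2] := framed_cyl hq m2 fr2.
have [_ [f0 of0 tr]] := opoly_frames hq.
have [A1 A1u hA1] := tr f1 of1; have [A2 A2u hA2] := tr f2 of2.
pose M := A1 *m invmx A2.
have hM y : (y *m M \in hov f2) = (y \in hov f1).
  by rewrite hA2 hA1 /M !mulmxA mulmxKV.
have Mu : M \in unitmx by rewrite unitmx_mul A1u unitmx_inv.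
pose v := (lin3 u2 (row3 1 0 0 *m M), lin3 u2 (row3 0 1 0 *m M), lin3 u2 (row3 0 0 1 *m M)).
have vE y : lin3 v y = lin3 u2 (y *m M).
  rewrite /lin3 -/(lin3 u2 _) /v /= -!lin3Z -!lin3D !scalemxAl -!mulmxDl !row3Z !row3D.
  by rewrite !mulr0 !mulr1 !addr0 !add0r -row3E.
have i1 : indep <<D1>>%VS u1 by rewrite e1; case/and5P: fr1.
have i2 : indep <<D2>>%VS u2 by rewrite e2; case/and5P: fr2.
have iv : indep <<D2>>%VS v.
  apply: indep_lin3 => y; rewrite vE => /(lin3_in i2) h.
  by rewrite -[y](mulmxK Mu) h mul0mx.
have [|g g0 gE] := free_map (free_frame fD1 i1) (free_frame fD2 iv).
  by rewrite /= !size_tuple.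
exists g => // x.
have g_u y : g (lin3 u1 y) = lin3 v y.
  have h0 : g u1.1.1 = v.1.1 := gE 0%N isT; have h1 : g u1.1.2 = v.1.2 := gE 1%N isT.
  have h2 : g u1.2 = v.2 := gE 2 isT.
  by rewrite /lin3 -h0 -h1 -h2 !linearD !linearZ.
have g_D d : d \in <<D1>>%VS -> g d \in <<D2>>%VS.
  move=> dD; rewrite (coord_span dD) linear_sum; apply: rpred_sum => i _.
  rewrite linearZ rpredZ //.
  have /= -> := gE i.+3; last by rewrite /= size_tuple !ltnS.
  by apply/memv_span/mem_nth; rewrite size_tuple.
have key z : z \in S1 -> g z \in S2.
  rewrite eS1 eS2 -e1 -e2 => zS; have [y [d [dR ez]]] := mem_span3 (cyl_sub zS).
  move: zS; rewrite ez cylE // => yh; rewrite linearD /= g_u vE cylE ?g_D //.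
  by rewrite hM.
have inj : injective g by apply/lker0P.
have eq_im : g @: S1 = S2.
  apply/eqP; rewrite eqEcard card_imset // (minset_card m1) (minset_card m2) leqnn andbT.
  by apply/subsetP => _ /imsetP[z zS ->]; exact: key.
by rewrite -eq_im mem_imset.
Qed.

End Transitivity.

(** * Codewords *)

Section PointSets.
Variables (F : finFieldType) (n : nat).
Local Notation V := 'rV[F]_n.+1.
Local Notation q := #|F|.
Local Notation Pt := (point F n).
Implicit Types (P Q : Pt) (T O : {set Pt}) (c v w : word F n) (U W : {vspace V}) (x y : V).

Lemma pdim_eq U d : (pdim U == d%:Z) = (\dim U == d.+1).
Proof. by rewrite /pdim; lia. Qed.

Lemma dim_point P : \dim (val P) = 1%N.
Proof. by apply/eqP; rewrite -pdim_eq (valP P). Qed.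

Lemma point_line P x : x \in val P -> x != 0 -> val P = <[x]>%VS.
Proof.
move=> xP x0; apply/esym/eqP.
by rewrite eqEdim -memvE xP dim_point dim_vline x0.
Qed.

Lemma point_of x : x != 0 -> exists P, val P = <[x]>%VS.
Proof.
move=> x0; have p : pdim <[x]>%VS == 0 by rewrite (pdim_eq _ 0) dim_vline x0.
by exists (exist _ <[x]>%VS p).
Qed.

Lemma point_pick P : vpick (val P) != 0.
Proof. by rewrite vpick0 -dimv_eq0 dim_point. Qed.

Definition vectors T : {set V} := [set x | (x != 0) && [exists P in T, x \in val P]].

Lemma mem_vectors T P x : x \in val P -> x != 0 -> (x \in vectors T) = (P \in T).
Proof.
move=> xP x0; rewrite inE x0 /=; apply/exists_inP/idP => [[Q QT xQ]|PT]; last by exists P.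
by have <- : Q = P by apply: val_inj; rewrite /= (point_line xP x0) (point_line xQ x0).
Qed.

Lemma vectors_pick T P : (vpick (val P) \in vectors T) = (P \in T).
Proof. by rewrite (mem_vectors _ (memv_pick _) (point_pick P)). Qed.

Lemma vectorsP T x : x \in vectors T -> exists P, [/\ P \in T, val P = <[x]>%VS & x != 0].
Proof.
rewrite inE => /andP[x0 /exists_inP[P PT xP]].
by exists P; split=> //; exact: point_line.
Qed.

Lemma vectors_homog T : homog (vectors T).
Proof.
split=> [|a x a0]; first by rewrite inE eqxx.
have [->|x0] := eqVneq x 0; first by rewrite scaler0.
have [P eP] := point_of x0; have xP : x \in val P by rewrite eP memv_line.
by rewrite !(@mem_vectors T P) ?memvZ // scaler_eq0 negb_or a0.
Qed.

Lemma vectors_inj : injective vectors.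
Proof. by move=> T O e; apply/setP => P; rewrite -!vectors_pick e. Qed.

Lemma vectors_onto S : homog S -> S = vectors [set P | vpick (val P) \in S].
Proof.
move=> hS; apply/setP => x; have [->|x0] := eqVneq x 0.
  by rewrite (negPf (proj1 hS)) (negPf (proj1 (vectors_homog _))).
have [P eP] := point_of x0; have xP : x \in val P by rewrite eP memv_line.
rewrite (mem_vectors _ xP x0) inE.
have : vpick (val P) \in val P by exact: memv_pick.
rewrite {2}eP => /vlineP[a e]; rewrite e homogZ //.
by apply: contra (point_pick P) => /eqP a0; rewrite e a0 scale0r.
Qed.

Lemma wt_vectors T U : wt (vectors T) U = #|T :&: points U|.
Proof.
rewrite -(card_imset _ val_inj); apply: eq_card => W; rewrite [LHS]in_set.
apply/and3P/imsetP => [[d1 WU pW]|[P]].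
  have p : pdim W == 0 by rewrite (pdim_eq _ 0).
  exists (exist _ W p) => //; rewrite in_setI [X in _ && X]inE /= WU andbT.
  by rewrite -vectors_pick.
by rewrite in_setI [X in _ && X]inE => /andP[PT PU] ->; rewrite dim_point PU vectors_pick.
Qed.

Definition supp c : {set Pt} := [set P | c P != 0].

Lemma F2_neq0 (a : 'F_2) : (a != 0)%:R = a.
Proof. by case: a => [[|[|]]] //= i; apply: val_inj. Qed.

Lemma charvec_supp c : charvec (supp c) = c.
Proof. by apply/ffunP => P; rewrite ffunE inE F2_neq0. Qed.

Lemma supp_charvec T : supp (charvec T) = T.
Proof. by apply/setP => P; rewrite inE ffunE; case: (P \in T); rewrite ?eqxx ?oner_eq0. Qed.

Lemma supp_inj : injective supp.
Proof. exact: can_inj charvec_supp. Qed.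

Definition vsupp c := vectors (supp c).

Lemma vsupp_inj : injective vsupp.
Proof. by move=> v w /vectors_inj/supp_inj. Qed.

Lemma points_full T : T :&: points fullv = T.
Proof. by apply/setP => P; rewrite !inE subvf andbT. Qed.

Lemma weight_vsupp c : weight c = wt (vsupp c) fullv.
Proof. by rewrite wt_vectors points_full. Qed.

Lemma weight_gt0 c : (0 < weight c)%N = (c != 0).
Proof.
rewrite card_gt0; congr negb; apply/eqP/eqP => [h|->].
  by apply: supp_inj; rewrite /supp h; apply/setP => P; rewrite !inE ffunE eqxx.
by apply/setP => P; rewrite !inE ffunE eqxx.
Qed.

Lemma natr_F2_eq0 (m : nat) : (m%:R == 0 :> 'F_2) = ~~ odd m.
Proof. by rewrite -val_eqE /= val_Fp_nat // modn2; case: (odd m). Qed.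

Lemma dotprod_charvec c U : dotprod c (charvec (points U)) = (wt (vsupp c) U)%:R.
Proof.
rewrite wt_vectors -sum1_card natr_sum big_mkcond /=; apply: eq_bigr => P _.
rewrite ffunE in_setI; rewrite [P \in supp c]inE -{1}[c P]F2_neq0.
by case: (c P != 0); case: (P \in points U); rewrite ?mulr1 ?mulr0 ?mul0r.
Qed.

Lemma dotprodZD c a v w : dotprod c (a *: v + w) = a * dotprod c v + dotprod c w.
Proof.
rewrite /dotprod mulr_sumr -big_split /=; apply: eq_bigr => P _.
by rewrite !ffunE mulrDr mulrCA.
Qed.

(** The scalar product with the characteristic vector of a subspace is the parity of the weight on
    it, and these vectors span the code. Projective dimension [k] is vector dimension [k.+1]. *)
Lemma dual_keven c k : reflect (keven k (vsupp c) fullv) (c \in dual_code F n k).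
Proof.
apply: (iffP idP) => [|ke]; rewrite inE.
  move=> /forall_inP h U _ dU; rewrite -natr_F2_eq0 -dotprod_charvec; apply: h.
  by apply: memv_span; apply: image_f; rewrite inE pdim_eq dU.
apply/forall_inP => w; rewrite /code; set X := image _ _ => wX.
have X0 i : (i < size X)%N -> dotprod c X`_i == 0.
  move=> iX; have /imageP[U] := mem_nth 0 iX; rewrite inE pdim_eq => /eqP dU ->.
  by rewrite dotprod_charvec natr_F2_eq0 ke ?subvf.
rewrite (coord_span (X := in_tuple X) wX).
apply: (big_ind (fun v => dotprod c v == 0)) => [|v1 v2 h1 h2|i _].
- by rewrite /dotprod big1 // => P _; rewrite ffunE mulr0.
- by rewrite -[v1]scale1r dotprodZD (eqP h1) (eqP h2) mulr0 addr0.
rewrite -[_ *: _]addr0 dotprodZD (eqP (X0 i _)) ?mulr0 ?add0r; last by rewrite ltn_ord.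
by rewrite /dotprod big1 // => P _; rewrite ffunE mulr0.
Qed.

End PointSets.

(** * Hypercylinders are the minimum sets *)

Section Hypercylinders.
Variables (F : finFieldType) (n : nat).
Local Notation V := 'rV[F]_n.+1.
Local Notation q := #|F|.
Local Notation Pt := (point F n).
Implicit Types (P Q : Pt) (T O : {set Pt}) (U W pi tau : {vspace V}) (x : V).

Hypothesis hq : q = 4%N \/ q = 8%N.

Lemma plane_frame pi : \dim pi = 3%N -> exists2 u, indep 0%VS u & span3 0%VS u = pi.
Proof.
move=> d3; have step W : (\dim W < 3)%N -> exists2 x, x \in pi & x \notin W.
  by rewrite -d3; exact: exists_notin.
have d0 : \dim (0%VS : {vspace V}) = 0%N by rewrite dimv0.
have [|x2 x2p h2] := step 0%VS; first by rewrite d0.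
have [|x1 x1p h1] := step (0 + <[x2]>)%VS; first by rewrite dim_addline ?d0.
have [|x0 x0p h0] := step (0 + <[x2]> + <[x1]>)%VS; first by rewrite !dim_addline ?d0.
have iu : indep 0%VS (x0, x1, x2) by apply/and3P.
exists (x0, x1, x2) => //; apply/eqP; rewrite eqEdim dim_span3 // d0 d3 leqnn andbT.
by rewrite !subv_add sub0v -!memvE x2p x1p.
Qed.

Lemma hyperoval_even pi O : hyperoval pi O ->
  [/\ \dim pi = 3%N, (forall x, x \in vectors O -> x \in pi), evenset (vectors O) pi &
    wt (vectors O) pi = (q + 2)%N].
Proof.
case=> /eqP; rewrite (pdim_eq _ 2) => /eqP d3 Opi cO lines; split=> //.
- move=> x /vectorsP[P [/(subsetP Opi)]]; rewrite inE => Ppi eP _.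
  by rewrite memvE -eP.
- move=> L Lpi dL; rewrite wt_vectors; have [|->|->] // := lines L _ Lpi.
  by apply/eqP; rewrite (pdim_eq _ 1) dL.
by rewrite wt_vectors (setIidPl Opi).
Qed.

Lemma cap_points pi tau : points pi :&: points tau = set0 -> (pi :&: tau = 0)%VS.
Proof.
move=> e; apply/eqP; rewrite -subv0; apply/subvP => x; rewrite memv_cap memv0.
case/andP=> xpi xtau; apply: contraT => x0; have [P eP] := point_of x0.
by have /setP/(_ P) := e; rewrite !inE eP -!memvE xpi xtau.
Qed.

Lemma points_cap pi tau : (pi :&: tau = 0)%VS -> points pi :&: points tau = set0.
Proof.
move=> e; apply/setP => P; rewrite !inE -subv_cap e subv0; apply/negbTE.
by rewrite -dimv_eq0 dim_point.
Qed.

(** Coordinates [u] of the plane [pi] stay independent modulo [tau] because the two are disjoint.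
    The hyperoval is a cylinder with zero vertex over a set [h], and [T] is the cylinder over the
    same [h] with vertex [tau]. *)
Lemma hypercylinder_minset Sigma T r : pdim Sigma = r.+2%:Z -> hypercylinder Sigma T ->
  minset (vectors T) r.
Proof.
move=> dS [_ [pi [tau [O [[piS _] [tauS dtau] cap0 hO eT]]]]].
have [d3 Opi eO wO] := hyperoval_even hO; have hO' := vectors_homog O.
have dt : \dim tau = r by move: dtau; rewrite dS /pdim; lia.
have pt0 := cap_points cap0; have [u iu eu] := plane_frame d3.
have u_in y : lin3 u y \in pi by rewrite -eu -[lin3 u y]addr0 span3_mem ?mem0v.
have iut : indep tau u.
  apply: indep_lin3 => y yt; apply: (lin3_in iu).
  by rewrite -pt0 memv_cap u_in.
pose h : {set 'rV[F]_3} := [set y | lin3 u y \in vectors O].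
have hh : homog h.
  split=> [|a y a0]; last by rewrite [LHS]in_set [RHS]in_set lin3Z (homogZ _ hO').
  by rewrite in_set -(scale0r (0 : 'rV_3)) lin3Z scale0r (negPf (proj1 hO')).
have eh0 : vectors O = cyl 0%VS u h.
  apply/setP => x; apply/idP/idP => [xO|xc].
    have := Opi x xO; rewrite -eu => /mem_span3[y [d [d0 ex]]].
    move: xO; rewrite ex cylE // [y \in h]in_set; move: d0; rewrite memv0 => /eqP ->.
    by rewrite addr0.
  have [y [d [d0 ex]]] := mem_span3 (cyl_sub xc).
  by move: xc; rewrite ex cylE // [y \in h]in_set; move: d0; rewrite memv0 => /eqP ->; rewrite addr0.
have wh : wt h fullv = (q + 2)%N.
  by have := cyl_wt iu hh; rewrite -eh0 eu wO dimv0 muln1.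
have eh : evenset h fullv by apply: (cyl_even_inv iu hh); rewrite -eh0 eu.
have -> : vectors T = cyl tau u h; last first.
  by rewrite -dt; apply: cyl_minset => //; case: hq => ->.
apply/setP => x; apply/idP/idP.
  case/vectorsP=> P []; rewrite eT inE [P \in points tau]inE.
  case/andP=> Pt /bigcupP[Q QO]; rewrite inE => PQ eP x0.
  have : x \in (val Q + tau)%VS by rewrite memvE -eP.
  case/memv_addP=> o oQ [t tt ex].
  have o0 : o != 0 by apply: contraNneq Pt => o0; rewrite eP -memvE ex o0 add0r.
  have oO : o \in vectors O by rewrite (mem_vectors _ oQ).
  have := Opi o oO; rewrite -eu => /mem_span3[y [d []]]; rewrite memv0 => /eqP ->.
  by rewrite addr0 => eo; rewrite ex eo cylE // [y \in h]in_set -eo.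
move=> xc; have [y [t [tt ex]]] := mem_span3 (cyl_sub xc).
move: xc; rewrite ex cylE // [y \in h]in_set => oO; have opi := Opi _ oO.
have [Q [QO eQ o0]] := vectorsP oO.
have xt : lin3 u y + t \notin tau.
  apply: contra o0 => h1; rewrite -memv0 -pt0 memv_cap opi /=.
  by rewrite -[lin3 u y](addrK t) rpredB.
have x0 : lin3 u y + t != 0 by apply: contraNneq xt => ->; rewrite mem0v.
have [P eP] := point_of x0; have xP : lin3 u y + t \in val P by rewrite eP memv_line.
rewrite (mem_vectors _ xP x0) eT inE [P \in points tau]inE eP -memvE xt /=.
apply/bigcupP; exists Q => //; rewrite inE eP -memvE eQ.
by rewrite memv_add ?memv_line.
Qed.

(** The vertex is the radical, the plane is any complement of it in [A], and the hyperoval is the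
    section by that plane. *)
Lemma minset_hypercylinder T r : minset (vectors T) r ->
  exists Sigma : {vspace V}, pdim Sigma = r.+2%:Z /\ hypercylinder Sigma T.
Proof.
move=> mT; have dR := minset_rad hq mT; have [x xT] := minset_neq0 mT.
have [hT [A [dA eA sA wA]]] := mT; set R := rad (vectors T) fullv in dR.
have RA : (R <= A)%VS by rewrite /R (rad_full hT sA xT) rad_sub.
have [|C [_ CA CR sCA dC]] := complement_through RA (sub0v A); first by rewrite capv0.
have d3 : \dim C = 3%N by move: dC; rewrite dA dR; lia.
have eC := evensetS CA eA.
have wC : wt (vectors T) C = (q + 2)%N.
  have := wt_add_rad hq mT CR.
  rewrite sCA wA mulnC => /eqP; rewrite eqn_pmul2l ?expn_gt0 ?(ltnW (q_gt1 F)) // => /eqP.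
  by move=> <-.
exists A; split; first by rewrite /pdim dA; lia.
split; first by rewrite /pdim dA; lia.
exists C, R, (T :&: points C); split.
- by split=> //; rewrite /pdim d3.
- by split=> //; rewrite /pdim dA dR; lia.
- exact: points_cap.
- split; rewrite ?subsetIr //; first by rewrite /pdim d3.
    by rewrite -wt_vectors.
  move=> L /eqP; rewrite (pdim_eq _ 1) => /eqP dL LC.
  have -> : T :&: points C :&: points L = T :&: points L.
    rewrite -setIA; congr (_ :&: _); apply/setIidPr/subsetP => P; rewrite !inE => PL.
    exact: subv_trans LC.
  rewrite -wt_vectors; have := hyperoval_line_le hT eC d3 wC LC dL; have := eC L LC dL.
  by case: (wt _ _) => [|[|[|]]] //; [left | right].
apply/setP => P; rewrite inE [P \in points R]inE; apply/idP/andP => [PT|[PR]].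
  have pT : vpick (val P) \in vectors T by rewrite vectors_pick.
  have eP := dim1_vline (dim_point P).
  split; first by rewrite eP -memvE; apply/negP => /(rad_notin hT); rewrite pT.
  have := sA _ pT; rewrite -sCA => /memv_addP[c cC [t tR ep]].
  have cT : c \in vectors T by rewrite -(radD hT tR) ?memvf // -ep.
  have [Q [QT eQ c0]] := vectorsP cT.
  apply/bigcupP; exists Q; first by rewrite in_setI QT inE eQ -memvE.
  by rewrite inE eP -memvE ep memv_add // eQ memv_line.
case/bigcupP=> Q; rewrite in_setI => /andP[QT _]; rewrite inE => PQ.
have : vpick (val P) \in (val Q + R)%VS by apply: (subvP PQ); exact: memv_pick.
case/memv_addP=> c cQ [t tR ep]; have c0 : c != 0.
  apply: contraNneq PR => c0; rewrite (dim1_vline (dim_point P)) -memvE.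
  by rewrite ep c0 add0r.
by rewrite -vectors_pick ep (radD hT tR) ?memvf // (mem_vectors _ cQ).
Qed.

End Hypercylinders.

(** * The number of minimum words and their equivalence *)

Section GaussianCoefficients.
Variable q : nat.
Hypothesis q1 : (1 < q)%N.

(** The q-factorial without its denominators, which cancel in Gaussian coefficients. *)
Definition qfact (m : nat) : rat := \prod_(i < m) (q%:R ^+ i.+1 - 1).

Lemma qfact_neq0 m : qfact m != 0.
Proof.
apply/prodf_neq0 => i _; rewrite subr_eq0 -natrX -[1]/(1%:R) Num.Theory.eqr_nat.
by rewrite -(expn0 q) eqn_exp2l.
Qed.

Lemma qfact_falling b c :
  \prod_(i < b) (q%:R ^+ (b + c - i) - 1) * qfact c = qfact (b + c) :> rat.
Proof.
elim: b => [|b IH]; first by rewrite big_ord0 mul1r.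
have -> : qfact (b.+1 + c) = qfact (b + c) * (q%:R ^+ (b + c).+1 - 1).
  by rewrite /qfact addSn big_ord_recr.
rewrite big_ord_recl /= subn0 -mulrA addSn mulrC -IH.
by congr (_ * _ * _); apply: eq_bigr => i _; rewrite /bump /= add1n subSS.
Qed.

Lemma gauss_qfact b c : gauss_coef q (b + c) b = qfact (b + c) / (qfact c * qfact b).
Proof.
rewrite /gauss_coef prodf_div invfM mulrA; congr (_ / _).
  by rewrite -(qfact_falling b c) mulfK // qfact_neq0.
have := qfact_falling b 0; rewrite addn0 {1}/qfact big_ord0 mulr1 => <-.
by [].
Qed.

Lemma fr_qfact (F : finFieldType) b c : #|F| = q ->
  (fr F b (b + c))%:R * qfact c = \prod_(i < b) q%:R ^+ i * qfact (b + c) :> rat.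
Proof.
move=> cF; rewrite -qfact_falling mulrA; congr (_ * _).
rewrite /fr cF natr_prod -big_split /=; apply: eq_bigr => i _.
have ib : (i <= b + c)%N by rewrite ltnW // ltn_addr.
rewrite natrB ?leq_exp2l // !natrX mulrBr mulr1 -exprD; congr (q%:R ^+ _ - _).
by rewrite subnKC.
Qed.

(** Up to a factor q - 1, the count of pairs of a hyperoval of PG(2,q) and an ordered frame in it:
    [delta q] hyperovals with (q + 2)(q + 1)q(q - 1) frames each, against the order of PGL(3,q)
    times [frame_number q]. *)
Lemma delta_frames : q = 4%N \/ q = 8%N ->
  (q * q * q)%:R * (frame_number q)%:R * qfact 3 =
  (delta q * ((q + 2) * (q - 1) * (q - 1) * (q + 1) * q))%:R :> rat.
Proof.
have q3 : qfact 3 = (q%:R - 1) * (q%:R ^+ 2 - 1) * (q%:R ^+ 3 - 1).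
  by rewrite /qfact !big_ord_recr big_ord0 /= mul1r expr1.
rewrite q3 !natrM natrB ?(ltnW q1) // !natrD => -[] ->.
  have -> : delta 4%N = 168%N by [].
  have -> : frame_number 4%N = 1%N by [].
  ring.
have -> : delta 8%N = (64 * 511)%N by [].
have -> : frame_number 8%N = 10%N by [].
rewrite natrM; ring.
Qed.

(** [M] is the number of minimum sets and [r.+3 + a] the vector dimension of the space. Written with
    [qfact], the tuple counts differ from the Gaussian coefficients only by powers of q and the
    planar factor in [delta_frames]. *)
Lemma gauss_product (F : finFieldType) (M a r : nat) : #|F| = q -> q = 4%N \/ q = 8%N ->
  (M * ((q + 2) * q ^ r * (q - 1) * ((q + 1) * q ^ r * (q - 1)) * (q * q ^ r) * fr F r r) =
   fr F r.+3 (r.+3 + a) * frame_number q)%N ->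
  M%:R = gauss_coef q (a + r.+3) a * gauss_coef q (r.+3) 3 * (delta q)%:R.
Proof.
move=> cF hq /(congr1 (fun m => m%:R : rat)).
have := fr_qfact r.+3 a cF; have := fr_qfact r 0 cF.
have -> : qfact 0 = 1 by rewrite /qfact big_ord0.
rewrite addn0 mulr1 => frr frN.
have -> : gauss_coef q r.+3 3 = qfact r.+3 / (qfact r * qfact 3) by exact: (gauss_qfact 3 r).
rewrite gauss_qfact [(a + _)%N]addnC.
rewrite !natrM frr !natrX => e; have := delta_frames hq; rewrite !natrM => d.
move: frN e; rewrite !big_ord_recr /= !exprS.
set G := \prod_(i < r) _; set X := q%:R ^+ r; set fN := (fr _ _ _)%:R => frN e.
have G0 : G != 0 by apply/prodf_neq0 => i _; rewrite expf_neq0 // Num.Theory.pnatr_eq0 -lt0n ltnW.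
have q0 : q%:R != 0 :> rat by rewrite Num.Theory.pnatr_eq0 -lt0n ltnW.
have X0 : X != 0 by rewrite expf_neq0.
have c0 : ((q + 2)%:R * (q - 1)%:R * (q - 1)%:R * (q + 1)%:R * q%:R : rat) != 0.
  rewrite !mulf_neq0 // Num.Theory.pnatr_eq0 -lt0n ?addn_gt0 ?subn_gt0 ?q1 ?orbT //.
have [a0 r0 r30 t0] := And4 (qfact_neq0 a) (qfact_neq0 r) (qfact_neq0 r.+3) (qfact_neq0 3).
apply: (mulIf (mulf_neq0 c0 (mulf_neq0 t0 (mulf_neq0 (mulf_neq0 a0 r0) (mulf_neq0 G0 (mulf_neq0 X0 (mulf_neq0 X0 X0))))))).
transitivity (M%:R * ((q + 2)%:R * X * (q - 1)%:R * ((q + 1)%:R * X * (q - 1)%:R) * (q%:R * X) * (G * qfact r)) * (qfact 3 * qfact a)).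
  by ring.
rewrite e; transitivity ((fN * qfact a) * (frame_number q)%:R * qfact 3); first by ring.
rewrite frN.
transitivity ((q%:R * q%:R * q%:R * (frame_number q)%:R * qfact 3) * (G * X * X * X * qfact (r.+3 + a))); first by ring.
rewrite d; field; exact/and4P.
Qed.

End GaussianCoefficients.

(** * Invertible linear maps as automorphisms of the code *)

Section LinearAction.
Variables (F : finFieldType) (n : nat).
Local Notation V := 'rV[F]_n.+1.
Local Notation Pt := (point F n).
Variable g : 'End(V).
Hypothesis g0 : lker g == 0%VS.

Let injg : injective g. Proof. by apply/lker0P. Qed.

Lemma dim_limg_inj (U : {vspace V}) : \dim (g @: U) = \dim U.
Proof. by apply: limg_dim_eq; rewrite (eqP g0) capv0. Qed.

Lemma point_image_proof (P : Pt) : pdim (g @: val P)%VS == 0.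
Proof. by rewrite (pdim_eq _ 0) dim_limg_inj dim_point. Qed.

Definition point_image (P : Pt) : Pt := exist _ (g @: val P)%VS (point_image_proof P).

Lemma point_image_inj : injective point_image.
Proof.
move=> P Q /(congr1 val) /= /eqP e; apply: val_inj; apply/eqP.
by move: e; rewrite eq_limg_ker0.
Qed.

Definition collineation : {perm Pt} := perm point_image_inj.

Lemma mem_permuted c x : (g x \in vsupp (permute collineation c)) = (x \in vsupp c).
Proof.
have [->|x0] := eqVneq x 0.
  by rewrite linear0 !(negPf (proj1 (vectors_homog _))).
have [P eP] := point_of x0; have xP : x \in val P by rewrite eP memv_line.
have gx0 : g x != 0 by rewrite -(linear0 g) (inj_eq injg).
rewrite /vsupp (mem_vectors _ xP x0) (@mem_vectors _ _ _ (collineation P)) //; last first.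
  by rewrite permE /= memv_img.
by rewrite !inE ffunE permK.
Qed.

(** The preimage of a [k]-space is a [k]-space containing equally many vectors of the support.
    Invariance of a finite code needs only one inclusion. *)
Lemma collineation_aut k : ~~ odd #|F| -> collineation \in code_aut (dual_code F n k).
Proof.
move=> qe; have inj : injective (permute collineation).
  move=> v w /ffunP e; apply/ffunP => P; have := e (collineation P).
  by rewrite !ffunE permK.
rewrite inE eqEcard card_imset // leqnn andbT; apply/subsetP => _ /imsetP[c /dual_keven ke ->].
apply/dual_keven => W _ dW; pose U := (g @^-1: W)%VS.
have gU : (g @: U)%VS = W.
  have full : limg g = {:V}%VS by apply/eqP; rewrite eqEdim subvf dim_limg_inj leqnn.
  by rewrite lpreimK // full subvf.
have dU : \dim U = k.+1 by rewrite -dW -gU dim_limg_inj.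
rewrite -odd_cnt //; last exact: vectors_homog.
have := ke U (subvf _) dU; rewrite -odd_cnt //; last exact: vectors_homog.
congr (~~ odd _); rewrite /cnt -(card_imset _ injg); apply: eq_card => y.
apply/imsetP/idP => [[x]|].
  rewrite in_set => /andP[xc xU] ->; rewrite in_set mem_permuted xc /=.
  by rewrite -gU memv_img.
rewrite in_set -{1}gU => /andP[yc /memv_imgP[x xU ey]]; exists x => //.
by rewrite in_set xU andbT -mem_permuted -ey.
Qed.

End LinearAction.

(** * Minimum words of the dual code correspond to minimum sets *)

Section MinimumWords.
Variables (F : finFieldType) (n k r : nat).
Hypotheses (hq : #|F| = 4%N \/ #|F| = 8%N) (dk : n.+1 = (k.+1 + r + 2)%N).
Local Notation q := #|F|.
Local Notation C := (dual_code F n k.+1).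

Implicit Types (S : {set 'rV[F]_n.+1}) (c : word F n).

Let dV : \dim {:'rV[F]_n.+1} = (k.+1 + r + 2)%N.
Proof. by rewrite dimvf /dim /= mul1n. Qed.

Let qe : ~~ odd q. Proof. by case: hq => ->. Qed.

Lemma minset_weight S : minset S r -> wt S fullv = ((q + 2) * q ^ r)%N.
Proof. by case=> hS [A [_ _ sA <-]]; apply: (wt_restrict _ hS (subvf A)) => x /sA. Qed.

Lemma minset_keven S : minset S r -> keven k.+1 S fullv.
Proof.
case=> hS [A [dA eA sA _]]; apply: (keven_of_evenset qe hS (subvf A) eA) => [x /sA //|].
by rewrite dV dA; lia.
Qed.

Lemma dual_weight_ge c : c \in C -> c != 0 -> ((q + 2) * q ^ r <= weight c)%N.
Proof.
move=> /dual_keven ke; rewrite -weight_gt0 weight_vsupp => p.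
exact: (kwt_lower qe (vectors_homog _) ke dV p).
Qed.

Lemma minset_dual c : minset (vsupp c) r ->
  [/\ c \in C, c != 0 & weight c = ((q + 2) * q ^ r)%N].
Proof.
move=> mc; have wc := minset_weight mc; rewrite -weight_gt0 weight_vsupp wc min_wt_gt0.
by split=> //; apply/dual_keven/minset_keven.
Qed.

Lemma Mset_word S : S \in Mset F n.+1 r -> exists c : word F n, S = vsupp c.
Proof.
move=> /(MsetP hq)[hS _]; exists (charvec [set P | vpick (val P) \in S]).
by rewrite /vsupp supp_charvec -vectors_onto.
Qed.

(** Existence is read off the count: frames and o-polynomials exist, so the number of minimum sets
    is not zero. This makes the lower bound the true minimum. *)
Lemma min_word_exists : exists c : word F n, minset (vsupp c) r.
Proof.
have /card_gt0P[S SM] : (0 < #|Mset F n.+1 r|)%N.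
  have := count_Mset n.+1 hq r; case: #|Mset _ _ _| => // /esym/eqP.
  rewrite mul0n card_frames muln_eq0 /frame_number; apply: contraTT => _.
  have -> : (if #|F| == 4%N then 1%N else 10%N) == 0%N = false by case: ifP.
  have lt i : (i < n.+1)%N -> (q ^ n.+1 - q ^ i != 0)%N.
    by move=> h; rewrite -lt0n subn_gt0 ltn_exp2l // q_gt1.
  rewrite orbF !muln_eq0 !negb_or !lt /=; try by lia.
  rewrite andbT -lt0n prodn_gt0 // => i; rewrite lt0n lt //.
  by have := ltn_ord i; lia.
have [c ec] := Mset_word SM; exists c; rewrite -ec.
exact/(MsetP hq).
Qed.

Lemma min_codewordsP c : reflect (minset (vsupp c) r) (c \in min_codewords C).
Proof.
rewrite inE; apply: (iffP and3P) => [[cC c0 /forall_inP h]|mc].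
  have [c1 m1] := min_word_exists; have [c1C c10 w1] := minset_dual m1.
  have wc : weight c = ((q + 2) * q ^ r)%N.
    apply/eqP; rewrite eqn_leq dual_weight_ge // andbT -w1.
    by have /implyP/(_ c10) := h _ c1C.
    have hc := vectors_homog (supp c).
  have [A [_ dA eA sA]] := kmin_in_subspace qe hc (dual_keven _ _ cC) dV (etrans (esym (weight_vsupp c)) wc).
  have sA' x : x \in vsupp c -> x \in A by move=> xc; apply: sA; rewrite ?memvf.
  split=> //; exists A; split=> //.
  by rewrite -wc weight_vsupp; apply/esym/(wt_restrict _ hc (subvf A)) => x /sA'.
have [cC c0 wc] := minset_dual mc; split=> //; apply/forall_inP => c' c'C.
by apply/implyP => c'0; rewrite wc dual_weight_ge.
Qed.

Lemma card_min_codewords : #|min_codewords C| = #|Mset F n.+1 r|.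
Proof.
rewrite -(card_imset _ (@vsupp_inj F n)); apply: eq_card => S; apply/imsetP/idP.
  by case=> c /min_codewordsP mc ->; apply/MsetP.
move=> SM; have [c ec] := Mset_word SM; exists c => //; apply/min_codewordsP; rewrite -ec.
exact/(MsetP hq).
Qed.

End MinimumWords.

Theorem corollary3p17 (F : finFieldType) (q n k : nat)
    (hF : #|F| = q) (hq : q = 4%N \/ q = 8%N)
    (hk : (1 <= k <= n - 1)%N) :
  [/\ is_min_weight (dual_code F n k) (q ^ (n - k - 1) * (q + 2))%N,
      (forall c : word F n,
         c \in min_codewords (dual_code F n k) <->
         exists (Sigma : subspace F n) (S : {set point F n}),
           [/\ pdim Sigma = n%:Z - k%:Z + 1, hypercylinder Sigma S
             & c = charvec S]),
      #|min_codewords (dual_code F n k)|%:R =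
        gauss_coef q (n + 1) (k - 1) * gauss_coef q (n - k + 2) 3 * (delta q)%:R
    & (forall c1 c2 : word F n,
         c1 \in min_codewords (dual_code F n k) ->
         c2 \in min_codewords (dual_code F n k) ->
         exists2 s : {perm point F n},
           s \in code_aut (dual_code F n k) & permute s c1 = c2)].
Proof.
(* The index of the code becomes [k.+1], and [r] is the vector dimension of the vertex [tau]. *)
case: k hk => // k hk; set r := (n - k.+1 - 1)%N.
have dk : n.+1 = (k.+1 + r + 2)%N by rewrite /r; lia.
rewrite -hF in hq *; have q1 := q_gt1 F; have qe : ~~ odd #|F| by case: hq => ->.
have min_P c : reflect (minset (vsupp c) r) (c \in min_codewords (dual_code F n k.+1)).
  exact: min_codewordsP.
split.
- rewrite mulnC; split; last by move=> c; exact: dual_weight_ge.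
  have [c mc] := min_word_exists hq dk; have [cC c0 wc] := minset_dual hq dk mc.
  by exists c.
- move=> c; split=> [/min_P mc|[Sigma [S [dS hS ->]]]].
    have [Sigma [dS hS]] := minset_hypercylinder hq mc.
    exists Sigma, (supp c); split=> //; last by rewrite charvec_supp.
    by rewrite dS; lia.
  apply/min_P; rewrite /vsupp supp_charvec; apply: (hypercylinder_minset hq _ hS).
  by rewrite dS; lia.
- have -> : #|min_codewords (dual_code F n k.+1)| = #|Mset F n.+1 r|.
    exact: card_min_codewords.
  have -> : (n + 1 = k + r.+3)%N by lia.
  have -> : (n - k.+1 + 2 = r.+3)%N by lia.
  rewrite subn1 /=; apply: (gauss_product q1 erefl hq).
  have := count_Mset n.+1 hq r; rewrite card_frames => ->; congr (_ * _)%N.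
  have -> : (r.+3 + k = n.+1)%N by lia.
  by rewrite /fr !big_ord_recr /= !mulnA.
move=> c1 c2 /min_P m1 /min_P m2.
have [g g0 gE] := minset_transitive hq m1 m2.
exists (collineation g0); first exact: collineation_aut.
apply: vsupp_inj; apply/setP => y.
have full : limg g = {:'rV[F]_n.+1}%VS.
  by apply/eqP; rewrite eqEdim subvf dim_limg_inj ?leqnn.
have /memv_imgP[x _ ->] : y \in limg g by rewrite full memvf.
by rewrite mem_permuted gE.
Qed.
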